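(* Let $\mathfrak{g}$ be the affine Kac-Moody algebra of type $A_{1}^{(1)}$, $A_{2}^{(2)}$, $A_{2}^{(1)}$, $A_{3}^{(1)}$ or $A_{4}^{(1)}$, with root system $\Delta$, and let $V$ be an irreducible non-dense weight $\mathfrak{g}$-module. Then there exist a parabolic system $P\subset\Delta$, with associated parabolic subalgebra $\mathfrak{p}(P)=\mathcal{L}\oplus\mathcal{N}$, and a non-zero vector $v\in V$ such that $\mathcal{N}v=0$.
   Context: All Lie algebras are over $\mathbb{C}$. $\mathfrak{g}$ is an affine Kac-Moody algebra (including central element $c$ and derivation $d$) with Cartan subalgebra $\mathfrak{h}$, root system $\Delta\subset\mathfrak{h}^*\setminus\{0\}$ (real and imaginary roots), root spaces $\mathfrak{g}_\alpha$, and root lattice $Q=\mathbb{Z}\Delta$. A weight module is a $\mathfrak{g}$-module $V=\bigoplus_{\lambda\in\mathfrak{h}^*}V_\lambda$ with $V_\lambda=\{v\in V\mid hv=\lambda(h)v\ \forall h\in\mathfrak{h}\}$; it is assumed to have countable dimension, and weight spaces may be infinite-dimensional. Its support is $\mathrm{supp}(V)=\{\lambda\mid V_\lambda\neq 0\}$. If $V$ is irreducible then $\mathrm{supp}(V)\subset\lambda+Q$ for some $\lambda\in\mathfrak{h}^*$; $V$ is dense if $\mathrm{supp}(V)=\lambda+Q$ and non-dense if $\mathrm{supp}(V)\subsetneq\lambda+Q$. A subset $P\subset\Delta$ is a parabolic system if $(P+P)\cap\Delta\subset P$, $P\neq\Delta$ and $P\cup(-P)=\Delta$. The associated parabolic subalgebra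 is $\mathfrak{p}(P)=\mathfrak{h}\oplus\bigoplus_{\beta\in P}\mathfrak{g}_\beta=\mathcal{L}\oplus\mathcal{N}$ with $\mathcal{N}=\bigoplus_{\beta\in P\setminus(-P)}\mathfrak{g}_\beta$ and $\mathcal{L}=\mathfrak{h}\oplus\bigoplus_{\beta\in P\cap(-P)}\mathfrak{g}_\beta$. *)

(* Defs.v *)
From HB Require Import structures.
From mathcomp Require Import all_boot all_order all_algebra.
From mathcomp Require Import boolp classical_sets cardinality reals complex.

Set Implicit Arguments.
Unset Strict Implicit.
Unset Printing Implicit Defensive.

Import GRing.Theory.
Local Open Scope ring_scope.
Local Open Scope classical_set_scope.

HB.mixin Record Lmodule_isLieAlgebra (K : fieldType) g
    of GRing.Lmodule K g := {
  bracket : g -> g -> g;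
  bracket_linearl : forall y, linear (bracket^~ y);
  bracket_linearr : forall x, linear (bracket x);
  bracketxx : forall x, bracket x x = 0;
  jacobi : forall x y z,
    bracket x (bracket y z) + bracket y (bracket z x)
      + bracket z (bracket x y) = 0
}.

#[short(type="lieAlgType")]
HB.structure Definition LieAlgebra (K : fieldType) :=
  {g of GRing.Lmodule K g & Lmodule_isLieAlgebra K g}.

HB.mixin Record Lmodule_isLieModule (K : fieldType) (g : lieAlgType K) V
    of GRing.Lmodule K V := {
  act : g -> V -> V;
  act_linearl : forall v, linear (act^~ v);
  act_linearr : forall x, linear (act x);
  act_bracket : forall x y v,
    act (bracket x y) v = act x (act y v) - act y (act x v)
}.

#[short(type="lieModType")]
HB.structure Definition LieModule (K : fieldType) (g : lieAlgType K) :=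
  {V of GRing.Lmodule K V & Lmodule_isLieModule K g V}.

Section LinearAlgebra.
Variables (K : fieldType) (V : lmodType K).

Definition subspace (W : set V) : Prop :=
  W 0 /\ forall a u v, W u -> W v -> W (a *: u + v).

Definition sum_spaces (I : eqType) (D : set I) (W : I -> set V) : set V :=
  [set v | exists (s : seq I) (u : I -> V),
     [/\ uniq s, forall i, i \in s -> D i, forall i, i \in s -> W i (u i)
       & v = \sum_(i <- s) u i]].

Definition independent_spaces (I : eqType) (W : I -> set V) : Prop :=
  forall (s : seq I) (u : I -> V), uniq s ->
    (forall i, i \in s -> W i (u i)) ->
    \sum_(i <- s) u i = 0 -> forall i, i \in s -> u i = 0.

Definition is_direct_sum (I : eqType) (W : I -> set V) : Prop :=
  sum_spaces [set: I] W = [set: V] /\ independent_spaces W.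

Definition is_basis (B : set V) : Prop :=
  (forall v, exists (s : seq V) (a : V -> K),
     (forall b, b \in s -> B b) /\ v = \sum_(b <- s) a b *: b) /\
  (forall (s : seq V) (a : V -> K), uniq s -> (forall b, b \in s -> B b) ->
     \sum_(b <- s) a b *: b = 0 -> forall b, b \in s -> a b = 0).

Definition countable_dim : Prop := exists B, is_basis B /\ countable B.

End LinearAlgebra.

Section LieSubsets.
Variables (K : fieldType) (g : lieAlgType K).

Definition lie_subalgebra (S : set g) : Prop :=
  subspace S /\ forall x y, S x -> S y -> S (bracket x y).

Definition lie_ideal (J : set g) : Prop :=
  subspace J /\ forall x y, J y -> J (bracket x y).

End LieSubsets.

(* The Kac-Moody algebra g(A), together with its Chevalley generators: A is
   realized by (cartan, simple_root, simple_coroot) with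
   A i j = <coroot i, root j>; g(A) is the Lie algebra generated by the Cartan
   subalgebra and the e_i, f_i subject to the relations km_hh, km_ef, km_he and
   km_hf, modulo the largest ideal meeting the Cartan subalgebra trivially.
   Being such a quotient amounts to km_generated, cartan_in_inj and
   km_no_ideal, so the record describes exactly the models of g(A), which is
   unique up to isomorphism; for A of affine type the central element and the
   derivation lie in the Cartan subalgebra, by dim_cartan.
   cartan is kept as a separate finite-dimensional space embedded by cartan_in,
   so that its dual is a type. *)
Record kac_moody_algebra (K : fieldType) (n : nat) (A : 'M[int]_n) :=
  KacMoodyAlgebra {
  km_alg :> lieAlgType K;
  cartan : vectType K;
  cartan_in : {linear cartan -> km_alg};
  simple_root : 'I_n -> 'Hom(cartan, K^o);
  simple_coroot : 'I_n -> cartan;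
  km_e : 'I_n -> km_alg;
  km_f : 'I_n -> km_alg;
  cartan_in_inj : injective cartan_in;
  dim_cartan : \dim {:cartan} = (n.*2 - \rank (map_mx intr A : 'M[K]_n))%N;
  simple_root_free : free [seq simple_root i | i : 'I_n];
  simple_coroot_free : free [seq simple_coroot i | i : 'I_n];
  simple_pairing : forall i j, simple_root j (simple_coroot i) = (A i j)%:~R;
  km_hh : forall h h', bracket (cartan_in h) (cartan_in h') = 0;
  km_ef : forall i j, bracket (km_e i) (km_f j) =
    if i == j then cartan_in (simple_coroot i) else 0;
  km_he : forall h i,
    bracket (cartan_in h) (km_e i) = (simple_root i h : K) *: km_e i;
  km_hf : forall h i,
    bracket (cartan_in h) (km_f i) = - (simple_root i h : K) *: km_f i;
  km_generated : forall S : set km_alg, lie_subalgebra S ->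
    (forall h, S (cartan_in h)) -> (forall i, S (km_e i)) ->
    (forall i, S (km_f i)) -> S = [set: km_alg];
  km_no_ideal : forall J : set km_alg, lie_ideal J ->
    (forall h, J (cartan_in h) -> h = 0) -> J = [set 0]
}.

Section Roots.
Variables (K : fieldType) (n : nat) (A : 'M[int]_n).
Variable g : kac_moody_algebra K A.
Local Notation hstar := 'Hom(cartan g, K^o).

Definition root_space (al : hstar) : set g :=
  [set x | forall h, bracket (cartan_in g h) x = (al h : K) *: x].

Definition roots : set hstar :=
  [set al | al <> 0 /\ exists2 x, root_space al x & x <> 0].

Definition root_lattice : set hstar :=
  [set mu | exists (s : seq hstar) (m : hstar -> int),
     (forall al, al \in s -> roots al) /\ mu = \sum_(al <- s) al *~ m al].

Definition opp_set (P : set hstar) : set hstar := [set - al | al in P].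

Definition parabolic_system (P : set hstar) : Prop :=
  [/\ P `<=` roots,
      [set al + be | al in P & be in P] `&` roots `<=` P,
      P <> roots
    & P `|` opp_set P = roots].

(* The summand N of the parabolic subalgebra p(P) = L (+) N. *)
Definition parabolic_nil (P : set hstar) : set g :=
  sum_spaces (P `\` opp_set P) root_space.

End Roots.

Arguments roots {K n A} g _.
Arguments root_lattice {K n A} g _.

Section WeightModules.
Variables (K : fieldType) (n : nat) (A : 'M[int]_n).
Variables (g : kac_moody_algebra K A) (V : lieModType g).
Local Notation hstar := 'Hom(cartan g, K^o).

Definition weight_space (la : hstar) : set V :=
  [set v | forall h, act (cartan_in g h) v = (la h : K) *: v].

(* Weight modules are of countable dimension by convention; the weight spaces
   themselves may be infinite-dimensional. *)
Definition weight_module : Prop :=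
  is_direct_sum weight_space /\ countable_dim V.

Definition supp : set hstar :=
  [set la | exists2 v, weight_space la v & v <> 0].

Definition root_coset (la : hstar) : set hstar :=
  [set la + mu | mu in root_lattice g].

(* For irreducible V the support is nonempty and lies in a single coset of the
   root lattice, so the coset below is determined by V. *)
Definition non_dense : Prop := exists la, supp `<` root_coset la.

Definition lie_submodule (W : set V) : Prop :=
  subspace W /\ forall x v, W v -> W (act x v).

Definition lie_irreducible : Prop :=
  [set: V] <> [set 0] /\
  forall W, lie_submodule W -> W = [set 0] \/ W = [set: V].

End WeightModules.

Arguments weight_space {K n A g} V la _.
Arguments weight_module {K n A g} V.
Arguments supp {K n A g} V _.
Arguments non_dense {K n A g} V.
Arguments lie_irreducible {K n A g} V.

(* Kac's labels: type_A l r is A_l^(r). *)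
Inductive affine_type := type_A1_1 | type_A2_2 | type_A2_1 | type_A3_1 | type_A4_1.

(* The Cartan matrix of A_l^(1), with nodes on the cycle Z/(l+1). For l = 1 the
   two neighbours of a node coincide, which gives the entries -2. *)
Definition gcm_A_untwisted (l : nat) : 'M[int]_l.+1 :=
  \matrix_(i, j) ((i == j)%:Z *+ 2 - (j == ordS i)%:Z - (i == ordS j)%:Z).

Definition gcm_A2_2 : 'M[int]_2 :=
  \matrix_(i, j) (if i == j then 2 else if i == ord0 then - 4%:Z else - 1%:Z).

Definition affine_nodes (X : affine_type) : nat :=
  match X with
  | type_A1_1 => 2 | type_A2_2 => 2 | type_A2_1 => 3
  | type_A3_1 => 4 | type_A4_1 => 5
  end.

Definition affine_gcm (X : affine_type) : 'M[int]_(affine_nodes X) :=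
  match X with
  | type_A1_1 => gcm_A_untwisted 1
  | type_A2_2 => gcm_A2_2
  | type_A2_1 => gcm_A_untwisted 2
  | type_A3_1 => gcm_A_untwisted 3
  | type_A4_1 => gcm_A_untwisted 4
  end.

(* Main.v *)
(* Fix a weight mu missing from the support, and let S be the set of root
   lattice elements c with mu + c in the support; thus 0 is not in S.  A root
   vector of a real root b acts on V either injectively, and then S + b is
   contained in S, or locally nilpotently, by irreducibility.  If both b and -b
   are locally nilpotent, sl2-theory yields whole b-strings in S and a
   reflection of the monoid St of all q with S + q contained in S.

   A suitable v is found from an additive phi on the root lattice, with
   P = {phi >= 0}, in two situations: when phi is maximal at some c in S as far
   as adding single roots goes, any v of weight mu + c will do; when
   phi(delta') > 0 for delta' = delta or -delta, all real roots with phi > 0 are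
   locally nilpotent, and no c + N delta' stays in S, a vector killed by all
   root spaces with phi > m + 1 can be improved to one with phi > m.

   For A_l^(1) the real roots are eps_i - eps_j + k delta.  Say that i reaches j
   if St contains one of them.  If all indices reach each other, phi comes from
   the potentials min {k | eps_i - eps_t + k delta in St}, unless St contains
   both positive and negative multiples of delta, which would put 0 in S.  If
   all real roots are locally nilpotent, the sign of the level decides, and in
   level 0 as well as in the remaining mixed case one shows that if no phi of
   the first kind worked, then 0 could be reached from any element of S.  For
   A_2^(2) the short roots +-alpha + k delta play this role. *)

Require Import Defs.
From HB Require Import structures.
From mathcomp Require Import all_boot all_order all_algebra.
From mathcomp Require Import boolp classical_sets cardinality reals complex.
From mathcomp Require Import zify ring lra.

Set Implicit Arguments.
Unset Strict Implicit.
Unset Printing Implicit Defensive.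

Import Order.TTheory GRing.Theory Num.Theory.
Local Open Scope ring_scope.

(** The algebra is given only by generators and the absence of ideals meeting the Cartan subalgebra
    trivially, so triangular decomposition, Serre relations and the list of roots must themselves be
    derived. Weight spaces of V may be infinite-dimensional, which rules out counting dimensions.
    Moreover the dichotomy for real roots rests on ad-nilpotency, which imaginary root vectors lack.
    They are kept out of the first situation by phi(delta) = 0, and in the second the condition on c
    + N delta' replaces local nilpotency. Why both signs of delta in St are fatal: St then contains,
    for one d > 0, d times every real root. A point moved far back along such a multiple has an
    sl2-string long enough for one step forward, and returning shows that the real root itself is in
    St. Hence S would be the whole lattice. Reaching 0 is a transport problem for the
    eps-coordinates of c, whose sum is 0: units move between indices along roots, and the last move
    corrects the delta-coordinate. Since mu need not be integral, string lengths are expressed by an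
    integer potential chosen class by class modulo the integers. *)

(** In the Leibniz expansion every term carries [a] derivatives on [u] or [b] on [w]. One lemma
    serves both the bracket of the algebra and its action on a module. *)
Lemma iter_bilinear_nil (U W Z : zmodType) (B : U -> W -> Z)
    (dU : U -> U) (dW : W -> W) (dZ : {additive Z -> Z}) :
  (forall w, B 0 w = 0) -> (forall u, B u 0 = 0) ->
  (forall u w, dZ (B u w) = B (dU u) w + B u (dW w)) ->
  forall a b u w, iter a dU u = 0 -> iter b dW w = 0 ->
  iter (a + b) dZ (B u w) = 0.
Proof.
move=> B0l B0r dB.
have it0 k : iter k dZ 0 = 0 by elim: k => //= k ->; rewrite raddf0.
have itD k x y : iter k dZ (x + y) = iter k dZ x + iter k dZ y.
  by elim: k => //= k ->; rewrite raddfD.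
move=> a b; have [m] := ubnP (a + b); elim: m a b => [|m IH] a b; first by rewrite ltn0.
case: a => [|a].
  by move=> _ u w /= ->; rewrite B0l it0.
case: b => [|b] lt_m u w au bw; first by rewrite /= in bw; rewrite bw B0r it0.
rewrite addSn iterSr dB itD.
have -> : iter (a + b.+1) dZ (B (dU u) w) = 0.
  by apply: IH; rewrite -?iterSr //; lia.
rewrite addnS -addSn add0r; by apply: IH; rewrite -?iterSr //; lia.
Qed.

(** * Lie algebra and weight computations *)

Section LieBasics.
Variables (K : fieldType) (g : lieAlgType K).

HB.instance Definition _ (x : g) :=
  GRing.isLinear.Build K g g *:%R (bracket x) (bracket_linearr x).

Lemma bracketC (x y : g) : bracket x y = - bracket y x.
Proof.
have addl (u v z : g) : bracket (u + v) z = bracket u z + bracket v z.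
  by have := bracket_linearl z 1 u v; rewrite !scale1r.
have := bracketxx (x + y).
rewrite addl !raddfD /= !bracketxx addr0 add0r => /eqP.
by rewrite addr_eq0 => /eqP.
Qed.

Lemma bracketNr (x y : g) : bracket x (- y) = - bracket x y.
Proof. exact: raddfN. Qed.
Lemma bracketNl (x y : g) : bracket (- x) y = - bracket x y.
Proof. by rewrite bracketC bracketNr -bracketC. Qed.
Lemma bracketDr (x y z : g) : bracket x (y + z) = bracket x y + bracket x z.
Proof. exact: raddfD. Qed.
Lemma bracketDl (x y z : g) : bracket (x + y) z = bracket x z + bracket y z.
Proof. by rewrite bracketC bracketDr opprD -!(bracketC _ z). Qed.
Lemma bracketZr (x : g) a (y : g) : bracket x (a *: y) = a *: bracket x y.
Proof. exact: linearZ. Qed.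
Lemma bracketZl a (x y : g) : bracket (a *: x) y = a *: bracket x y.
Proof. by rewrite bracketC bracketZr -scalerN -bracketC. Qed.
Lemma bracket0r (x : g) : bracket x 0 = 0.
Proof. exact: raddf0. Qed.
Lemma bracket0l (x : g) : bracket 0 x = 0.
Proof. by rewrite bracketC bracket0r oppr0. Qed.

Lemma leibniz (x y z : g) :
  bracket x (bracket y z) = bracket (bracket x y) z + bracket y (bracket x z).
Proof.
have /eqP := jacobi x y z.
rewrite addrAC (bracketC z (bracket x y)) (bracketC z x) bracketNr.
by rewrite addrAC -addrA -opprD subr_eq0 addrC => /eqP ->.
Qed.

End LieBasics.

Section KacMoody.
Variables (K : numFieldType) (n : nat) (A : 'M[int]_n).
Variable g : kac_moody_algebra K A.

Notation Q := {ffun 'I_n -> int}.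
Notation e := (km_e g).
Notation f := (km_f g).
Notation hc := (cartan_in g).
Notation hi := (simple_coroot g).
Notation hstar := 'Hom(cartan g, K^o).

Definition al (i : 'I_n) : Q := [ffun j => (i == j)%:Z].
(** Lattice elements are kept as integer coordinate vectors in the simple roots, where signs and
    heights make sense; [wt] turns them into functionals, faithfully because the simple roots are
    free and the characteristic is 0. *)
Definition wt (c : Q) : hstar := \sum_i simple_root g i *~ c i.
Definition pair (c : Q) (h : cartan g) : K := wt c h.

Lemma wt_is_additive : zmod_morphism wt.
Proof.
move=> c d; rewrite /wt -sumrB; apply: eq_bigr => i _.
by rewrite !ffunE mulrzBr.
Qed.
HB.instance Definition _ := GRing.isZmodMorphism.Build Q hstar wt wt_is_additive.

Lemma pairD c d h : pair (c + d) h = pair c h + pair d h.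
Proof. by rewrite /pair raddfD /= lfunE. Qed.
Lemma pairN c h : pair (- c) h = - pair c h.
Proof. by rewrite /pair raddfN /= lfunE. Qed.
Lemma pair0 h : pair 0 h = 0.
Proof. by rewrite /pair raddf0 /= lfunE. Qed.
Lemma pairDr c h h' : pair c (h + h') = pair c h + pair c h'.
Proof. by rewrite /pair linearD. Qed.
Lemma pairZr c a h : pair c (a *: h) = a * pair c h.
Proof. by rewrite /pair linearZ. Qed.
Lemma pairNr c h : pair c (- h) = - pair c h.
Proof. by rewrite /pair linearN. Qed.

Lemma pairMz c m h : pair (c *~ m) h = m%:~R * pair c h.
Proof.
have add : zmod_morphism (fun d => pair d h) by move=> x y; rewrite pairD pairN.
pose E : {additive Q -> K} :=
  HB.pack (fun d => pair d h) (GRing.isZmodMorphism.Build Q K _ add).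
by rewrite -[LHS]/(E _) raddfMz mulrzl.
Qed.

Lemma wt_al i : wt (al i) = simple_root g i.
Proof.
rewrite /wt (bigD1 i) //= ffunE eqxx mulr1z big1 ?addr0 // => j ji.
by rewrite ffunE eq_sym (negPf ji) mulr0z.
Qed.

Lemma pair_al i h : pair (al i) h = simple_root g i h.
Proof. by rewrite /pair wt_al. Qed.

Lemma pair_al_hi i j : pair (al j) (hi i) = (A i j)%:~R.
Proof. by rewrite pair_al; exact: simple_pairing. Qed.

Lemma wt_inj : injective wt.
Proof.
apply: raddf_inj => c; rewrite /wt => c0.
have /freeP fr : free [tuple of codom (simple_root g)] by exact: simple_root_free.
have := fr (fun i => (c (enum_val i))%:~R).
rewrite (reindex (@enum_rank _)) /=; last first.
  by exists enum_val => i _; rewrite ?enum_rankK ?enum_valK.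
under eq_bigr => i _.
  rewrite enum_rankK scaler_int nth_codom enum_rankK.
  over.
move=> /(_ c0) ce; apply/ffunP => i.
have := ce (enum_rank i); rewrite enum_rankK ffunE => /eqP.
by rewrite intr_eq0 => /eqP.
Qed.
End KacMoody.

Arguments wt {K n A} g c.
Arguments pair {K n A} g c h.

(** * Triangular decomposition *)

Section Opposite.
Variables (K : numFieldType) (n : nat) (A : 'M[int]_n).
Variable g : kac_moody_algebra K A.

Let opp_root (i : 'I_n) := - simple_root g i.
Let opp_coroot (i : 'I_n) := - simple_coroot g i.

Lemma freeN (V : vectType K) (u : 'I_n -> V) :
  free [seq u i | i : 'I_n] -> free [seq - u i | i : 'I_n].
Proof.
move=> fr; have /freeP fr' : free [tuple of codom u] by [].
apply/(@freeP _ _ _ [tuple of codom (fun i => - u i)]) => k k0 i.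
have := fr' k; apply; rewrite -[LHS]opprK -sumrN; apply/eqP; rewrite oppr_eq0.
apply/eqP; apply: etrans k0; apply: eq_bigr => j _.
by rewrite -scalerN !(nth_map (enum_val j)) //= -?enumT -cardE.
Qed.

Lemma opp_pairing i j :
  (opp_root j) (opp_coroot i) = (A i j)%:~R.
Proof. rewrite -(simple_pairing g) /opp_root /opp_coroot (linearN (- simple_root g j)).
by have := pairN (g := g) (al j) (simple_coroot g i); rewrite /pair raddfN /= wt_al => ->; rewrite opprK. Qed.

Lemma opp_ef i j : bracket (km_f g i) (km_e g j) =
    if i == j then cartan_in g (opp_coroot i) else 0.
Proof.
rewrite bracketC km_ef eq_sym; case: eqP => [->|]; last by rewrite oppr0.
by rewrite raddfN.
Qed.

Lemma opp_he h i : bracket (cartan_in g h) (km_f g i) = (opp_root i h : K) *: km_f g i.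
Proof. by rewrite km_hf lfunE. Qed.

Lemma opp_hf h i :
  bracket (cartan_in g h) (km_e g i) = - (opp_root i h : K) *: km_e g i.
Proof. by rewrite km_he lfunE opprK. Qed.

Lemma opp_generated (S : set g) : lie_subalgebra S ->
    (forall h, S (cartan_in g h)) -> (forall i, S (km_f g i)) ->
    (forall i, S (km_e g i)) -> S = [set: g]%classic.
Proof. by move=> sS hS fS eS; apply: km_generated. Qed.

(** The Chevalley involution, as a second structure on the same Lie algebra: it lets statements
    about the positive part be reused for the negative part. *)
Definition km_opp : kac_moody_algebra K A :=
  KacMoodyAlgebra (@cartan_in_inj _ _ _ g) (dim_cartan g)
    (freeN (simple_root_free g)) (freeN (simple_coroot_free g))
    opp_pairing (@km_hh _ _ _ g) opp_ef opp_he opp_hf opp_generated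
    (@km_no_ideal _ _ _ g).

End Opposite.

Section Triangular.
Variables (K : numFieldType) (n : nat) (A : 'M[int]_n).
Variable g : kac_moody_algebra K A.

Notation Q := {ffun 'I_n -> int}.
Notation e := (km_e g).
Notation f := (km_f g).
Notation hc := (cartan_in g).
Notation hi := (simple_coroot g).

Lemma wt_opp (c : Q) : wt (km_opp g) c = - wt g c.
Proof.
by rewrite /wt -sumrN; apply: eq_bigr => i _; rewrite /= mulNrz.
Qed.

Definition gspace (c : Q) (x : g) : Prop :=
  forall h, bracket (hc h) x = pair g c h *: x.

Lemma gspace_lin c a x y : gspace c x -> gspace c y -> gspace c (a *: x + y).
Proof.
by move=> Gx Gy h; rewrite bracketDr bracketZr Gx Gy scalerDr !scalerA mulrC.
Qed.
Lemma gspace0 c : gspace c 0.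
Proof. by move=> h; rewrite bracket0r scaler0. Qed.
Lemma gspaceZ c a x : gspace c x -> gspace c (a *: x).
Proof. by move=> Gx; rewrite -[_ *: x]addr0; apply/gspace_lin/gspace0. Qed.
Lemma gspaceD c x y : gspace c x -> gspace c y -> gspace c (x + y).
Proof. by move=> Gx Gy; rewrite -[x]scale1r; apply: gspace_lin. Qed.

Lemma gspace_bracket c d x y :
  gspace c x -> gspace d y -> gspace (c + d) (bracket x y).
Proof.
move=> Gx Gy h; rewrite leibniz Gx Gy bracketZl bracketZr pairD.
by rewrite scalerDl.
Qed.

Lemma gspace_cartan h : gspace 0 (hc h).
Proof. by move=> h'; rewrite km_hh pair0 scale0r. Qed.
Lemma gspace_e i : gspace (al i) (e i).
Proof. by move=> h; rewrite km_he pair_al. Qed.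
Lemma gspace_f i : gspace (- al i) (f i).
Proof. by move=> h; rewrite km_hf pairN pair_al. Qed.

Lemma gspace_indep (s : seq Q) (u : Q -> g) : uniq s ->
  (forall c, gspace c (u c)) -> \sum_(c <- s) u c = 0 ->
  forall c, c \in s -> u c = 0.
Proof.
elim: s u => [//|c0 s IH] u /= /andP[c0s us] Gu; rewrite big_cons => s0.
have uc c : c \in s -> u c = 0.
  move=> cs.
  have ne : wt g c != wt g c0.
    by apply: contraNneq c0s => /wt_inj <-.
  have [h hne] : exists h, wt g c h != wt g c0 h.
    apply: contrapT => nh; move/eqP: ne; apply; apply/lfunP => h.
    by apply/eqP; apply: contrapT => /negP ?; apply: nh; exists h.
  have : (pair g c h == pair g c0 h) || (u c == 0).
    rewrite -subr_eq0 -scaler_eq0; apply/eqP.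
    (* Applying [bracket (hc h)] minus the scalar [pair g c0 h] to the relation removes its [c0]
       term. *)
    apply: (IH (fun c => (pair g c h - pair g c0 h) *: u c)) => // [d|].
      exact: gspaceZ.
    under eq_bigr => d _ do rewrite scalerBl -Gu.
    rewrite sumrB -raddf_sum -scaler_sumr /=.
    have -> : \sum_(d <- s) u d = - u c0 by apply/eqP; rewrite -addr_eq0 addrC s0.
    by rewrite bracketNr Gu scalerN subrr.
  by rewrite (negPf hne) /= => /eqP.
move=> c; rewrite inE => /predU1P[->|]; last exact: uc.
by move: s0; rewrite big_seq big1 ?addr0.
Qed.

Definition pos (c : Q) := (forall i, 0 <= c i) /\ c <> 0.

Lemma pos_al i : pos (al i).
Proof.
split=> [j|/ffunP/(_ i)]; first by rewrite ffunE; case: eqP.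
by rewrite !ffunE eqxx.
Qed.

Lemma posD (c d : Q) : pos c -> (forall i, 0 <= d i) -> pos (c + d).
Proof.
move=> [c0 cn] d0; split=> [i|/ffunP cd]; first by rewrite ffunE addr_ge0.
apply: cn; apply/ffunP => i; have := cd i; rewrite !ffunE.
move: (c i) (d i) (c0 i) (d0 i) => x y; lia.
Qed.

Lemma posD_al c i : pos c -> pos (c + al i).
Proof. by move=> pc; apply: posD => //; have [] := pos_al i. Qed.

Lemma pos_asym c : pos c -> ~ pos (- c).
Proof.
move=> [c0 cn] [c0' _]; apply: cn; apply/ffunP => i.
have := c0 i; have := c0' i; rewrite !ffunE; move: (c i) => x; lia.
Qed.

(** Right-nested words in the [e i], graded by weight and closed under linear combinations. By the
    Jacobi identity they span the positive part, and induction on them only meets single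
    generators. *)
Inductive npos : Q -> g -> Prop :=
| npos_e i : npos (al i) (e i)
| npos_b c x i : npos c x -> npos (c + al i) (bracket (e i) x)
| npos_0 c : npos c 0
| npos_lin c a x y : npos c x -> npos c y -> npos c (a *: x + y).

Lemma npos_pos c x : npos c x -> x = 0 \/ pos c.
Proof.
elim=> {c x} [i|c x i _ [->|pc]|c|c a x y _ [->|pc] _ [->|]].
- by right; exact: pos_al.
- by left; rewrite bracket0r.
- by right; exact: posD_al.
- by left.
- by left; rewrite scaler0 addr0.
- by move=> pc; right.
- by right.
- by right.
Qed.

Lemma npos_gspace c x : npos c x -> gspace c x.
Proof.
elim=> {c x} [i|c x i _ Gx|c|c a x y _ Gx _ Gy].
- exact: gspace_e.
- by rewrite addrC; apply: gspace_bracket => //; exact: gspace_e.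
- exact: gspace0.
- exact: gspace_lin.
Qed.

Lemma nposZ c a x : npos c x -> npos c (a *: x).
Proof. by move=> Nx; rewrite -[_ *: x]addr0; apply/npos_lin/npos_0. Qed.
Lemma nposD c x y : npos c x -> npos c y -> npos c (x + y).
Proof. by move=> Nx; rewrite -[x]scale1r; apply: npos_lin. Qed.

(** All letters of a word of weight [al i *+ m] are [e i], so the word vanishes once it has two of
    them. The multiple [m] is general because the induction removes letters. *)
Lemma npos_al c x : npos c x -> forall i m, c = al i *+ m ->
  (m = 1%N -> exists a, x = a *: e i) /\ (m <> 1%N -> x = 0).
Proof.
elim=> {c x} [j|c x j Nx IH|c|c a x y _ IHx _ IHy] i m cE.
- have ij : i = j.
    have /ffunP/(_ j) := cE; rewrite ffunMnE !ffunE eqxx.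
    by case: (i =P j) => //; rewrite mul0rn.
  have m1 : m = 1%N.
    have /ffunP/(_ j) := cE; rewrite ffunMnE !ffunE eqxx ij eqxx /=.
    by rewrite -natz natr1_ne0 || lia.
  by split=> // _; exists 1; rewrite ij scale1r.
- case: (npos_pos Nx) => [->|[c0 cn]].
    by split=> _; rewrite bracket0r //; exists 0; rewrite scale0r.
  have ck k : c k + (j == k)%:Z = (i == k)%:Z *+ m.
    by have /ffunP/(_ k) := cE; rewrite ffunMnE !ffunE.
  have ij : i = j.
    have := ck j; rewrite eqxx; case: (i =P j) => // _; rewrite mul0rn.
    by move: (c j) (c0 j) => y; lia.
  have cE' : c = al i *+ m.-1.
    apply/ffunP => k; have := ck k; rewrite ffunMnE ffunE ij.
    case: (j =P k) => [<-|_]; last by rewrite mul0rn addr0 mul0rn.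
    move: (c j) (c0 j) => y; case: m {cE ck} => [|m] /=; rewrite ?mulrSr; lia.
  have [H1 H2] := IH _ _ cE'; rewrite -ij.
  have [m1|m1] := eqVneq m.-1 1%N.
    have [a ->] := H1 m1; rewrite bracketZr bracketxx scaler0.
    by split=> // _; exists 0; rewrite scale0r.
  rewrite H2; last exact/eqP.
  by rewrite bracket0r; split=> // _; exists 0; rewrite scale0r.
- by split=> // _; exists 0; rewrite scale0r.
- have [X1 X2] := IHx _ _ cE; have [Y1 Y2] := IHy _ _ cE; split=> m1.
    have [b ->] := X1 m1; have [d ->] := Y1 m1.
    by exists (a * b + d); rewrite scalerDl scalerA.
  by rewrite X2 // Y2 // scaler0 addr0.
Qed.

Lemma npos_al1 i x : npos (al i) x -> exists a, x = a *: e i.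
Proof. by move=> /npos_al /(_ i 1%N (erefl _)) [+ _]; exact. Qed.

Lemma npos_f c x j : npos c x -> c <> al j -> npos (c - al j) (bracket (f j) x).
Proof.
elim=> {c x} [i|c x i Nx IH|c|c a x y _ IHx _ IHy] cj.
- rewrite bracketC km_ef; case: eqP => [ij|_]; first by rewrite ij in cj.
  by rewrite oppr0; exact: npos_0.
- case: (npos_pos Nx) => [->|pc]; first by rewrite !bracket0r; exact: npos_0.
  rewrite leibniz; apply: nposD.
    rewrite [bracket (f j) _]bracketC km_ef; case: eqP => [<-|_]; last first.
      by rewrite oppr0 bracket0l; exact: npos_0.
    rewrite bracketNl addrK (npos_gspace Nx) -scaleNr; exact: nposZ.
  (* The induction hypothesis excludes weight [al j]. There [bracket (f j) x] is a multiple of the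
     coroot, and bracketing with [e i] gives a multiple of [e i]. *)
  have [cE|/eqP nc] := eqVneq c (al j).
    rewrite cE in Nx *; rewrite addrAC addrN add0r.
    have [a ->] := npos_al1 Nx.
    rewrite bracketZr [bracket (f j) _]bracketC km_ef eqxx bracketZr bracketNr bracketC km_he.
    by rewrite opprK scalerA; apply/nposZ/npos_e.
  by rewrite addrAC; apply/npos_b/IH.
- by rewrite bracket0r; exact: npos_0.
- rewrite bracketDr bracketZr; apply: npos_lin; [exact: IHx | exact: IHy].
Qed.

Lemma npos_hi i x : npos (al i) x -> exists a, bracket (f i) x = hc (a *: hi i).
Proof.
move=> /npos_al1[a ->]; exists (- a).
by rewrite bracketZr bracketC km_ef eqxx linearZ /= scalerN scaleNr.
Qed.

End Triangular.

Section Decomposition.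
Variables (K : numFieldType) (n : nat) (A : 'M[int]_n).
Variable g : kac_moody_algebra K A.

Notation Q := {ffun 'I_n -> int}.
Notation e := (km_e g).
Notation f := (km_f g).
Notation hc := (cartan_in g).
Notation hi := (simple_coroot g).
Notation g' := (km_opp g).

Lemma gspace_opp c (x : g) : gspace (g := g') (- c) x <-> gspace c x.
Proof.
have E h : pair g' (- c) h = pair g c h.
  by rewrite pairN /pair wt_opp -[RHS]opprK -pairN /pair raddfN.
by split=> Gx h; have := Gx h; rewrite E.
Qed.

Lemma npos_opp_gspace c (x : g) : npos (g := g') (- c) x -> gspace c x.
Proof. by move=> /npos_gspace /gspace_opp. Qed.

Inductive gsum (P : Q -> g -> Prop) : g -> Prop :=
| gsum_0 : gsum P 0
| gsum_cons c x y : P c x -> gsum P y -> gsum P (x + y).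

Lemma gsum_D P x y : gsum P x -> gsum P y -> gsum P (x + y).
Proof.
move=> Sx Sy; elim: Sx => [|c u v Pu _ IH]; first by rewrite add0r.
by rewrite -addrA; exact: gsum_cons Pu IH.
Qed.
Lemma gsum_1 P c x : P c x -> gsum P x.
Proof. by move=> Px; rewrite -[x]addr0; exact: gsum_cons Px (gsum_0 _). Qed.

Section Graded.
Variable P : Q -> g -> Prop.
Hypothesis P0 : forall c, P c 0.
Hypothesis Plin : forall c a x y, P c x -> P c y -> P c (a *: x + y).
Hypothesis PG : forall c x, P c x -> gspace c x.

Let PD c x y : P c x -> P c y -> P c (x + y).
Proof. by move=> Px Py; rewrite -[x]scale1r; exact: Plin. Qed.
Let PZ c a x : P c x -> P c (a *: x).
Proof. by move=> Px; rewrite -[_ *: _]addr0; exact: Plin. Qed.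

Lemma gsum_Z a x : gsum P x -> gsum P (a *: x).
Proof.
elim=> [|c u v Pu _ IH]; first by rewrite scaler0; exact: gsum_0.
by rewrite scalerDr; apply: gsum_cons IH; exact: PZ Pu.
Qed.

Lemma gsum_fun x : gsum P x -> exists (s : seq Q) (u : Q -> g),
  [/\ uniq s, forall c, P c (u c), forall c, c \notin s -> u c = 0
    & x = \sum_(c <- s) u c].
Proof.
elim=> [|c y z Py _ [s [u [us Pu u0 ->]]]].
  by exists [::], (fun=> 0); split=> //; rewrite big_nil.
pose u' d := if d == c then y + u c else u d.
have Pu' d : P d (u' d) by rewrite /u'; case: eqP => [->|_] //; exact: PD.
have [cs|cs] := boolP (c \in s).
  exists s, u'; split=> // [d ds|].
    by rewrite /u'; case: eqP ds => [->|_]; [rewrite cs | exact: u0].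
  rewrite (bigD1_seq c) //= [RHS](bigD1_seq c) //= addrA /u' eqxx; congr (_ + _).
  by apply: eq_bigr => d /negPf ->.
exists (c :: s), u'; split=> //= [|d|].
- by rewrite cs.
- by rewrite inE negb_or => /andP[dc ds]; rewrite /u' (negPf dc) u0.
rewrite big_cons /u' eqxx u0 // addr0; congr (_ + _); apply: eq_big_seq => d ds.
by case: eqP => // dc; rewrite dc (negPf cs) in ds.
Qed.

(** Subtract [x] from its component of degree [c]: independence of the weight spaces makes the
    difference vanish. *)
Lemma gsum_gspace c x : gsum P x -> gspace c x -> P c x.
Proof.
move=> /gsum_fun[s [u [us Pu u0 xE]]] Gx.
pose u' d := u d - (if d == c then x else 0).
have s0 : \sum_(d <- undup (c :: s)) u' d = 0.
  have ct : c \in undup (c :: s) by rewrite mem_undup inE eqxx.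
  rewrite sumrB [X in _ - X](bigD1_seq c) ?undup_uniq //= eqxx.
  rewrite [X in _ - (_ + X)]big1 ?addr0; last by move=> d /negPf ->.
  case: ifP => cs; rewrite undup_id // ?big_cons xE ?subrr //.
  by rewrite u0 ?cs // add0r subrr.
have := gspace_indep (undup_uniq _) _ s0 (c := c).
rewrite mem_undup inE eqxx /u' eqxx => uc.
have -> : x = u c.
  apply/esym/eqP; rewrite -subr_eq0; apply/eqP/uc => // d.
  apply: gspaceD; first exact/PG/Pu.
  by rewrite -scaleN1r; apply: gspaceZ; case: eqP => [->|_] //; exact: gspace0.
exact: Pu.
Qed.

End Graded.

(** The degree [c] part of the triangular decomposition: positive part, negative part, Cartan
    subalgebra, and 0 in degrees of mixed sign. [gspace_piece] shows that it is the full weight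
    space. *)
Definition piece (c : Q) (x : g) : Prop :=
  [/\ pos c -> npos c x, pos (- c) -> npos (g := g') (- c) x,
      c = 0 -> exists h, x = hc h
    & ~ pos c -> ~ pos (- c) -> c <> 0 -> x = 0].

Lemma piece0 c : piece c 0.
Proof.
by split=> // *; try exact: npos_0; exists 0; rewrite raddf0.
Qed.

Lemma piece_lin c a x y : piece c x -> piece c y -> piece c (a *: x + y).
Proof.
move=> [x1 x2 x3 x4] [y1 y2 y3 y4]; split.
- by move=> pc; apply: npos_lin; auto.
- by move=> pc; apply: npos_lin; auto.
- move=> c0; have [h ->] := x3 c0; have [h' ->] := y3 c0.
  by exists (a *: h + h'); rewrite linearP.
- by move=> *; rewrite x4 // y4 // scaler0 addr0.
Qed.

Lemma piece_pos c x : npos c x -> piece c x.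
Proof.
move=> Nx; case: (npos_pos Nx) => [->|pc]; first exact: piece0.
by split=> // [/(pos_asym pc)//|c0]; case: pc => _ /(_ c0).
Qed.

Lemma piece_neg c x : npos (g := g') (- c) x -> piece c x.
Proof.
move=> Nx; case: (npos_pos Nx) => [->|pc]; first exact: piece0.
split=> // [/(pos_asym)//|c0].
by case: pc => _; rewrite c0 oppr0 => /(_ erefl).
Qed.

Lemma piece_cartan h : piece 0 (hc h).
Proof.
by split=> [[]//||_|]//; [rewrite oppr0 => -[] | exists h].
Qed.

Lemma piece_gspace c x : piece c x -> gspace c x.
Proof.
move=> [x1 x2 x3 x4].
have [pc|npc] := pselect (pos c); first exact/npos_gspace/x1.
have [pc'|npc'] := pselect (pos (- c)); first exact/npos_opp_gspace/x2.
have [c0|/eqP c0] := eqVneq c 0.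
  by have [h ->] := x3 c0; rewrite c0; exact: gspace_cartan.
by rewrite x4 //; exact: gspace0.
Qed.

Lemma piece_e c x i : piece c x -> piece (c + al i) (bracket (e i) x).
Proof.
move=> [x1 x2 x3 x4].
have [pc|npc] := pselect (pos c); first exact/piece_pos/npos_b/x1.
have [pc'|npc'] := pselect (pos (- c)).
  have Nx := x2 pc'; have [cE|/eqP nc] := eqVneq (- c) (al i).
    rewrite cE in Nx; have [a /= ->] := npos_hi Nx.
    by rewrite -cE addrN; exact: piece_cartan.
  by apply: piece_neg; rewrite opprD; exact: (npos_f (g := g')).
have [c0|/eqP c0] := eqVneq c 0.
  have [h ->] := x3 c0; rewrite c0 add0r bracketC km_he -scaleNr.
  exact/piece_pos/nposZ/npos_e.
by rewrite x4 // bracket0r; exact: piece0.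
Qed.


(** The simple roots of [km_opp g'] are doubly negated, so it is not convertible to [g]; the words
    in the [e i] are nevertheless the same. *)
Lemma npos_opp2 c (x : g) : npos (g := g) c x -> npos (g := km_opp g') c x.
Proof.
by elim=> *; [exact: (npos_e (km_opp g')) | exact: (@npos_b _ _ _ (km_opp g'))
  | exact: npos_0 | exact: npos_lin].
Qed.
Lemma npos_opp2' c (x : g) : npos (g := km_opp g') c x -> npos (g := g) c x.
Proof.
by elim=> *; [exact: (npos_e g) | exact: (@npos_b _ _ _ g)
  | exact: npos_0 | exact: npos_lin].
Qed.
End Decomposition.

Section Pieces.
Variables (K : numFieldType) (n : nat) (A : 'M[int]_n).
Variable g : kac_moody_algebra K A.

Notation Q := {ffun 'I_n -> int}.
Notation e := (km_e g).
Notation f := (km_f g).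
Notation hc := (cartan_in g).
Notation hi := (simple_coroot g).
Notation g' := (km_opp g).

Lemma piece_opp c (x : g) : piece (g := g) c x <-> piece (g := g') (- c) x.
Proof.
split=> -[x1 x2 x3 x4]; split.
- exact: x2.
- by rewrite opprK => /x1/npos_opp2.
- by move=> /eqP; rewrite oppr_eq0 => /eqP.
- by rewrite opprK => ? ? /eqP; rewrite oppr_eq0 => /eqP; auto.
- by move: x2; rewrite opprK => x2 /x2/npos_opp2'.
- exact: x1.
- by move=> c0; apply: x3; rewrite c0 oppr0.
- move=> ? ? /eqP c0; apply: x4; rewrite ?opprK //.
  by apply/eqP; rewrite oppr_eq0.
Qed.

Lemma piece_f c x i : piece c x -> piece (c - al i) (bracket (f i) x).
Proof.
move=> /piece_opp Px; apply/piece_opp; rewrite opprB addrC.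
exact: (piece_e (g := g')).
Qed.

Lemma piece_h c x h : piece c x -> piece c (bracket (hc h) x).
Proof.
move=> Px; rewrite (piece_gspace Px) -[_ *: x]addr0.
exact/piece_lin/piece0.
Qed.

(* The elements that normalize a subspace form a subalgebra. *)
Lemma gens_stable (T : g -> Prop) :
  (forall a x y, T x -> T y -> T (a *: x + y)) -> T 0 ->
  (forall h x, T x -> T (bracket (hc h) x)) ->
  (forall i x, T x -> T (bracket (e i) x)) ->
  (forall i x, T x -> T (bracket (f i) x)) ->
  forall x y, T y -> T (bracket x y).
Proof.
move=> Tlin T0 Th Te Tf x.
have TD u v : T u -> T v -> T (u + v) by move=> Tu; rewrite -[u]scale1r; exact: Tlin.
have TN u : T u -> T (- u).
  by move=> Tu; rewrite -[- u]addr0 -scaleN1r; exact: Tlin.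
pose S : set g := fun x => forall y, T y -> T (bracket x y).
suff SE : S = setT by change (S x); rewrite SE.
apply: km_generated => [|h y|i y|i y]; [|exact: Th|exact: Te|exact: Tf].
split; [split|].
- by move=> y Ty; rewrite bracket0l.
- move=> a u v Su Sv y Ty; rewrite bracketDl bracketZl; apply: Tlin; auto.
- move=> u v Su Sv y Ty.
  have -> : bracket (bracket u v) y = bracket u (bracket v y) - bracket v (bracket u y).
    by rewrite [in RHS]leibniz addrK.
  by apply: TD; auto.
Qed.

(** The sum of the pieces contains the generators and is stable under bracketing with them. *)
Lemma gsum_piece (x : g) : gsum (piece (g := g)) x.
Proof.
have Slin a u v : gsum (piece (g := g)) u -> gsum (piece (g := g)) v ->
    gsum (piece (g := g)) (a *: u + v).
  by move=> Su; apply/gsum_D/gsum_Z; [exact: piece0|exact: piece_lin|].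
have St := gens_stable Slin (gsum_0 _).
have {}St : forall x y : g, gsum (piece (g := g)) y -> gsum (piece (g := g)) (bracket x y).
  by apply: St => [h|i|i] {}x; (elim=> [|c u v Pu _ IH];
    [rewrite bracket0r; exact: gsum_0 | rewrite bracketDr]); [exact: gsum_cons (piece_h _ Pu) IH
    |exact: gsum_cons (piece_e _ Pu) IH|exact: gsum_cons (piece_f _ Pu) IH].
pose S : set g := gsum (piece (g := g)).
suff SE : S = setT by change (S x); rewrite SE.
apply: km_generated => [|h|i|i].
- split; [split; [exact: gsum_0 | exact: Slin]|].
  by move=> u v _; exact: St.
- exact/gsum_1/piece_cartan.
- exact/gsum_1/piece_pos/npos_e.
- apply/(gsum_1 (c := - al i))/piece_neg; rewrite opprK; exact: (npos_e g').
Qed.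

Lemma gspace_piece c (x : g) : gspace c x -> piece c x.
Proof.
move=> Gx; apply: gsum_gspace Gx.
- exact: piece0.
- exact: piece_lin.
- exact: piece_gspace.
- exact: gsum_piece.
Qed.

Lemma gspace_pos c (x : g) : pos c -> gspace c x -> npos c x.
Proof. by move=> pc /gspace_piece[x1 _ _ _]; exact: x1. Qed.

Lemma gspace_coherent c (x : g) : gspace c x -> x <> 0 ->
  [\/ c = 0, pos c | pos (- c)].
Proof.
move=> /gspace_piece[x1 x2 x3 x4] xn.
have [pc|npc] := pselect (pos c); first by apply: Or32.
have [pc'|npc'] := pselect (pos (- c)); first by apply: Or33.
have [c0|/eqP c0] := eqVneq c 0; first by apply: Or31.
by case: xn; exact: x4.
Qed.

Lemma gspace_al i (x : g) : gspace (al i) x -> exists a, x = a *: e i.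
Proof. by move=> /(gspace_pos (pos_al i))/npos_al1. Qed.

Lemma gspace_mul_al i m (x : g) : gspace (al i *+ m.+2) x -> x = 0.
Proof.
move=> Gx; have p : pos (al i *+ m.+2).
  rewrite mulrSr; apply: posD_al.
  by elim: m {Gx} => [|m IH]; [exact: pos_al | rewrite mulrSr; exact: posD_al].
by have /npos_al/(_ i m.+2 erefl)[_] := gspace_pos p Gx; exact.
Qed.

(** Split [x] into pieces, whose weights lie in the lattice. If [be] differs from all of them,
    acting by the Cartan subalgebra kills each piece. *)
Lemma root_space_lattice (be : 'Hom(cartan g, K^o)) (x : g) :
  root_space be x -> x <> 0 -> exists c, be = wt g c.
Proof.
move=> Rx xn; apply: contrapT => nb.
have [s [u [us Pu u0 xE]]] :=
  gsum_fun (@piece0 _ _ _ g) (@piece_lin _ _ _ g) (gsum_piece x).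
apply: xn; rewrite xE big_seq big1 // => c cs.
have [h hne] : exists h, (be h : K) != pair g c h.
  apply: contrapT => nh; apply: nb; exists c; apply/lfunP => h.
  by apply/eqP; apply: contrapT => /negP ?; apply: nh; exists h.
have : ((be h : K) - pair g c h == 0) || (u c == 0).
  rewrite -scaler_eq0; apply/eqP.
  apply: (gspace_indep (s := s) (u := fun c => ((be h : K) - pair g c h) *: u c)) => //.
    by move=> d; apply/gspaceZ/piece_gspace.
  under eq_bigr => d _ do rewrite scalerBl -(piece_gspace (Pu d)).
  by rewrite sumrB -scaler_sumr -raddf_sum /= -xE Rx subrr.
by rewrite subr_eq0 (negPf hne) /= => /eqP.
Qed.

End Pieces.

(** * Serre relations, reflections and real roots *)

Section Sl2.
Variables (K : numFieldType) (W : lmodType K) (e f h : {linear W -> W}).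
Hypothesis ef : forall v, e (f v) = f (e v) + h v.
Hypothesis he : forall v, h (e v) = e (h v) + 2 *: e v.
Hypothesis hf : forall v, h (f v) = f (h v) - 2 *: f v.

Lemma sl2_weight_e k a v : h v = a *: v ->
  h (iter k e v) = (a + (k.*2)%:R) *: iter k e v.
Proof.
move=> hv; elim: k => [|k IH] /=; first by rewrite addr0.
rewrite he IH linearZ -scalerDl; congr (_ *: _).
by rewrite doubleS -natr1 -natr1; ring.
Qed.

Lemma sl2_weight_f k a v : h v = a *: v ->
  h (iter k f v) = (a - (k.*2)%:R) *: iter k f v.
Proof.
move=> hv; elim: k => [|k IH] /=; first by rewrite subr0.
rewrite hf IH linearZ -scalerBl; congr (_ *: _).
by rewrite doubleS -natr1 -natr1; ring.
Qed.

Lemma sl2_lowest k a v : f v = 0 -> h v = a *: v ->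
  f (iter k.+1 e v) = - (k.+1%:R * (a + k%:R)) *: iter k e v.
Proof.
move=> fv hv.
have feE u : f (e u) = e (f u) - h u by rewrite ef addrK.
elim: k => [|k IH] /=.
  by rewrite feE fv linear0 hv sub0r -scaleNr; congr (_ *: _); ring.
rewrite feE [f _]IH linearZ (sl2_weight_e k.+1 hv) -scalerBl; congr (_ *: _).
by rewrite doubleS -!natr1 -muln2 natrM; ring.
Qed.

Lemma sl2_highest k a v : e v = 0 -> h v = a *: v ->
  e (iter k.+1 f v) = (k.+1%:R * (a - k%:R)) *: iter k f v.
Proof.
move=> ev hv.
elim: k => [|k IH] /=.
  by rewrite ef ev linear0 hv add0r; congr (_ *: _); ring.
rewrite ef [e _]IH linearZ (sl2_weight_f k.+1 hv) -scalerDl; congr (_ *: _).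
by rewrite doubleS -!natr1 -muln2 natrM; ring.
Qed.

(** The last nonzero [iter k e v] is a highest weight vector, and the first power of [f] killing it
    forces its weight to be the natural number [N]. Only nilpotency is used, never the dimension of
    a weight space. *)
Lemma sl2_string a v : v <> 0 -> h v = a *: v ->
  (exists k, iter k e v = 0) -> (forall u, exists k, iter k f u = 0) ->
  exists k N : nat, [/\ a + (k.*2)%:R = N%:R, iter k e v <> 0
    & forall j, (j <= N)%N -> iter j f (iter k e v) <> 0].
Proof.
move=> vn hv exe exf.
have exe' : exists k, iter k e v == 0 by have [k /eqP] := exe; exists k.
case: (ex_minnP exe') => -[/eqP//|k] /eqP ke kmin.
have un : iter k e v <> 0 by move/eqP/kmin; rewrite ltnn.
set u := iter k e v in un *.
have eu : e u = 0 by [].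
have exf' : exists k, iter k f u == 0 by have [m /eqP] := exf u; exists m.
case: (ex_minnP exf') => -[/eqP//|N] /eqP Nf Nmin.
have fu j : (j <= N)%N -> iter j f u <> 0 by move=> jN /eqP/Nmin; lia.
exists k, N; split=> //.
have := sl2_highest N eu (sl2_weight_e k hv); rewrite Nf linear0 => /esym/eqP.
rewrite scaler_eq0 mulf_eq0 pnatr_eq0 /= subr_eq0 => /orP[/eqP ->//|/eqP fN].
by case: (fu N).
Qed.

End Sl2.

Section Serre.
Variables (K : numFieldType) (n : nat) (A : 'M[int]_n).
Variable g : kac_moody_algebra K A.

Notation Q := {ffun 'I_n -> int}.
Notation e := (km_e g).
Notation f := (km_f g).
Notation hc := (cartan_in g).
Notation hi := (simple_coroot g).
Notation g' := (km_opp g).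

Inductive eclosure (c0 : Q) (y : g) : Q -> g -> Prop :=
| ecl_start : eclosure c0 y c0 y
| ecl_e c x i : eclosure c0 y c x -> eclosure c0 y (c + al i) (bracket (e i) x)
| ecl_0 c : eclosure c0 y c 0
| ecl_lin c a u v : eclosure c0 y c u -> eclosure c0 y c v ->
    eclosure c0 y c (a *: u + v).

(* A vector of positive weight killed by all the f_k generates an ideal of
   positive weights, which therefore meets the Cartan subalgebra trivially. *)
Lemma lowest_vector_eq0 c y : pos c -> gspace c y ->
  (forall k, bracket (f k) y = 0) -> y = 0.
Proof.
move=> pc Gy fy; pose J := eclosure c y.
have JG d x : J d x -> gspace d x.
  elim=> {d x} [//|d x i _ Gx|d|d a u v _ Gu _ Gv].
  - by rewrite addrC; apply: gspace_bracket => //; exact: gspace_e.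
  - exact: gspace0.
  - exact: gspace_lin.
have Jp d x : J d x -> x = 0 \/ pos d.
  elim=> {d x} [|d x i _ [->|pd]|d|d a u v _ [->|pd] _ [->|pd']]; try by right.
  - by left; rewrite bracket0r.
  - by right; exact: posD_al.
  - by left.
  - by left; rewrite scaler0 addr0.
have J0 d : J d 0 by exact: ecl_0.
have Jlin d a u v : J d u -> J d v -> J d (a *: u + v) by exact: ecl_lin.
have JZ d a u : J d u -> J d (a *: u).
  by move=> Ju; rewrite -[_ *: _]addr0; exact: Jlin.
have JD d u v : J d u -> J d v -> J d (u + v).
  by move=> Ju; rewrite -[u]scale1r; exact: Jlin.
have Jf d x k : J d x -> J (d - al k) (bracket (f k) x).
  elim=> {d x} [|d x i Jx IH|d|d a u v _ IHu _ IHv].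
  - by rewrite fy; exact: J0.
  - rewrite leibniz; apply: JD; last by rewrite addrAC; exact: ecl_e.
    rewrite [bracket (f k) _]bracketC km_ef.
    case: eqP => [->|_]; last by rewrite oppr0 bracket0l; exact: J0.
    by rewrite bracketNl addrK (JG _ _ Jx) -scaleNr; exact: JZ.
  - by rewrite bracket0r; exact: J0.
  - by rewrite bracketDr bracketZr; exact: Jlin.
have Slin a u v : gsum J u -> gsum J v -> gsum J (a *: u + v).
  by move=> Su Sv; apply: gsum_D => //; exact: gsum_Z.
have St := gens_stable Slin (gsum_0 _).
have {}St : forall x z : g, gsum J z -> gsum J (bracket x z).
  apply: St => [h|i|i] x; (elim=> [|d u v Pu _ IH];
    [rewrite bracket0r; exact: gsum_0 | rewrite bracketDr]).
  - by apply: gsum_cons IH; rewrite (JG _ _ Pu); exact: JZ Pu.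
  - by apply: gsum_cons IH; exact: ecl_e Pu.
  - by apply: gsum_cons IH; exact: Jf Pu.
have /(congr1 (fun S : set g => S y)) : (gsum J : set g) = [set 0]%classic.
  apply: km_no_ideal => [|h Jh].
    by split; [split; [exact: gsum_0 | exact: Slin] | exact: St].
  have := gsum_gspace J0 Jlin JG Jh (gspace_cartan h).
  case/Jp => [h0|[]//]; apply: (@cartan_in_inj _ _ _ g).
  by rewrite h0 raddf0.
rewrite /set1 /= => yE; rewrite -yE; exact/gsum_1/ecl_start.
Qed.

Hypothesis A_diag : forall i, A i i = 2.
Hypothesis A_off : forall i j, i != j -> A i j <= 0.
Hypothesis A_sym0 : forall i j, A i j = 0 -> A j i = 0.

Lemma bracket_fe k i x : k != i -> bracket (f k) (bracket (e i) x) = bracket (e i) (bracket (f k) x).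
Proof.
move=> /negPf ki; rewrite leibniz [bracket (f k) (e i)]bracketC km_ef eq_sym ki.
by rewrite oppr0 bracket0l add0r.
Qed.

Lemma gspace_iter_bracket c d (x y : g) k : gspace c x -> gspace d y ->
  gspace (d + c *+ k) (iter k (bracket x) y).
Proof.
move=> Gx Gy; elim: k => [|k IH] /=; first by rewrite addr0.
by rewrite mulrS addrCA; exact: gspace_bracket.
Qed.

Lemma bracket_ef_sl2 i (v : g) : bracket (e i) (bracket (f i) v) =
  bracket (f i) (bracket (e i) v) + bracket (hc (hi i)) v.
Proof. by rewrite leibniz km_ef eqxx addrC. Qed.
Lemma bracket_he_sl2 i (v : g) : bracket (hc (hi i)) (bracket (e i) v) =
  bracket (e i) (bracket (hc (hi i)) v) + 2 *: bracket (e i) v.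
Proof.
rewrite leibniz km_he -pair_al pair_al_hi A_diag addrC; congr (_ + _).
by rewrite bracketZl.
Qed.
(** The vector is killed by every [f k] and has positive weight, so [lowest_vector_eq0] applies. The
    case [k = i] is an sl2-computation, the case [k = j] leads back to brackets of [e i] with a
    coroot. *)
Lemma serre i j : i != j -> iter (absz (A i j)).+1 (bracket (e i)) (e j) = 0.
Proof.
move=> ij; set N := (absz (A i j)).+1.
have AN : A i j = - (absz (A i j))%:Z by have := A_off ij; lia.
apply: (@lowest_vector_eq0 (al j + al i *+ N)).
- apply: posD; first exact: pos_al.
  by move=> k; rewrite ffunMnE mulrn_wge0 // ffunE; case: eqP.
- apply: gspace_iter_bracket; exact: gspace_e.
move=> k; have [->|ki] := eqVneq k i.
  (* With [a = A i j] and [k] the absolute value of [A i j], the scalar in [sl2_lowest] has the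
     factor [a + k = 0]. *)
  rewrite (@sl2_lowest _ _ (bracket (e i)) (bracket (f i)) (bracket (hc (hi i)))
    (bracket_ef_sl2 i) (bracket_he_sl2 i) _ (A i j)%:~R).
  - have -> : (A i j)%:~R = - (absz (A i j))%:R :> K by rewrite {1}AN mulrNz.
    by rewrite addNr mulr0 oppr0 scale0r.
  - by apply: etrans (bracketC _ _) _; rewrite km_ef eq_sym (negPf ij) oppr0.
  - by apply: etrans (gspace_e j (hi i)) _; rewrite pair_al_hi.
have it m : bracket (f k) (iter m (bracket (e i)) (e j)) =
    iter m (bracket (e i)) (bracket (f k) (e j)).
  by elim: m => //= m IH; rewrite bracket_fe // IH.
rewrite it bracketC km_ef; have [kj|jk] := eqVneq j k; last first.
  by rewrite oppr0; elim: (N) => //= m ->; rewrite bracket0r.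
rewrite /N iterSr.
have -> : bracket (e i) (- hc (hi j)) = (A j i)%:~R *: e i.
  by rewrite bracketNr bracketC opprK (gspace_e i) pair_al_hi.
(* If [A i j = 0], the single bracket with the coroot has coefficient [A j i = 0]; otherwise a
   further bracket of [e i] with itself occurs. *)
case: (absz (A i j)) (AN) => [/A_sym0 -> /=|m _]; first by rewrite scale0r.
by rewrite iterSr bracketZr bracketxx scaler0; elim: m => //= m ->; rewrite bracket0r.
Qed.

Definition ad_nil (x : g) := forall y : g, exists k, iter k (bracket x) y = 0.

Lemma iter_bracket0 (x : g) k : iter k (bracket x) 0 = 0.
Proof. by elim: k => //= k ->; rewrite bracket0r. Qed.

Lemma iter_bracketD (x y z : g) k :
  iter k (bracket x) (y + z) = iter k (bracket x) y + iter k (bracket x) z.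
Proof. by elim: k => //= k ->; rewrite bracketDr. Qed.

Lemma iter_bracketZ (x : g) a y k :
  iter k (bracket x) (a *: y) = a *: iter k (bracket x) y.
Proof. by elim: k => //= k ->; rewrite bracketZr. Qed.

(** By the Leibniz rule the elements killed by a power of [bracket x] form a subalgebra. *)
Lemma ad_nil_gens (x : g) :
  (forall h, exists k, iter k (bracket x) (hc h) = 0) ->
  (forall i, exists k, iter k (bracket x) (e i) = 0) ->
  (forall i, exists k, iter k (bracket x) (f i) = 0) -> ad_nil x.
Proof.
move=> nh ne nf y; pose S : set g := fun y => exists k, iter k (bracket x) y = 0.
suff SE : S = setT by change (S y); rewrite SE.
apply: km_generated => //; split; [split|].
- by exists 0%N.
- move=> a u v [k ku] [m mv]; exists (k + m)%N.
  rewrite iter_bracketD iter_bracketZ {1}addnC !iterD ku mv.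
  by rewrite !iter_bracket0 scaler0 addr0.
- move=> u v [k ku] [m mv]; exists (k + m)%N.
  apply: (iter_bilinear_nil (B := bracket (s := g)) (dU := bracket x) (dW := bracket x)) => //.
  + exact: bracket0l.
  + exact: bracket0r.
  + exact: leibniz.
Qed.

Lemma ad_nil_e i : ad_nil (e i).
Proof.
apply: ad_nil_gens => [h|j|j].
- exists 2; rewrite /= [bracket (e i) (hc h)]bracketC km_he bracketNr bracketZr.
  by rewrite bracketxx scaler0 oppr0.
- have [->|ij] := eqVneq i j; first by exists 1%N; rewrite /= bracketxx.
  by eexists; exact: serre.
- exists 3; rewrite /= km_ef; case: eqP => _; last by rewrite !bracket0r.
  by rewrite [bracket (e i) (hc _)]bracketC km_he bracketNr bracketZr bracketxx scaler0 oppr0.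
Qed.
End Serre.

(** * Exponentials of locally nilpotent derivations *)

Section Convolution.
Variable V : nmodType.

(** The Cauchy product of finite series; it makes the exponential of a derivation multiplicative. *)
Lemma big_convolution (F : nat -> nat -> V) N :
  (forall i j, (N <= i)%N || (N <= j)%N -> F i j = 0) ->
  \sum_(k < N + N) \sum_(i < k.+1) F i (k - i)%N = \sum_(i < N) \sum_(j < N) F i j.
Proof.
move=> F0.
have -> : \sum_(k < N + N) \sum_(i < k.+1) F i (k - i)%N =
    \sum_(k < N + N) \sum_(i < N + N) (if (i <= k)%N then F i (k - i)%N else 0).
  apply: eq_bigr => k _; rewrite -big_mkcond /=.
  by rewrite (big_ord_widen_cond (N + N) xpredT (fun i => F i (k - i)%N)).
rewrite exchange_big /= big_split_ord /= addrC big1 ?add0r => [|i _]; last first.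
  by rewrite big1 // => k _; case: ifP => // _; rewrite F0 // leq_addr.
apply: eq_bigr => i _; rewrite -big_mkcond /=.
rewrite -(big_mkord (fun k => (i <= k)%N) (fun k => F i (k - i)%N)).
rewrite (big_cat_nat _ (n := i)) //=; last by have := ltn_ord i; lia.
rewrite big1_seq ?add0r => [|k]; last first.
  by rewrite mem_index_iota => /andP[]; lia.
rewrite big_nat_cond (eq_bigl (fun k => (i <= k < N + N)%N)); last first.
  by move=> k; rewrite andbAC andbb.
rewrite -big_nat -{1}[nat_of_ord i]add0n big_addn.
rewrite (big_cat_nat _ (n := N)) //=; last by have := ltn_ord i; lia.
rewrite [X in _ + X]big1_seq ?addr0 => [|k]; last first.
  by rewrite mem_index_iota addnK => /andP[_ /andP[kN _]]; rewrite F0 // kN orbT.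
by rewrite big_mkord; apply: eq_bigr => j _; rewrite addnK.
Qed.
End Convolution.

Section Exponential.
Variables (K : numFieldType) (g : lieAlgType K).

Lemma it_bracket0 (x : g) k : iter k (bracket x) 0 = 0.
Proof. by elim: k => //= k ->; rewrite bracket0r. Qed.

Definition dpow (x : g) k y := (k`!)%:R^-1 *: iter k (bracket x) y : g.

Lemma dpow_lin x k : linear (dpow x k).
Proof.
move=> a u v; rewrite /dpow; have -> : iter k (bracket x) (a *: u + v) =
    a *: iter k (bracket x) u + iter k (bracket x) v.
  by elim: k => //= k ->; rewrite linearP.
by rewrite scalerDr !scalerA mulrC.
Qed.
HB.instance Definition _ x k := GRing.isLinear.Build K g g *:%R (dpow x k) (dpow_lin x k).

Lemma dpow_geq x k m y : iter m (bracket x) y = 0 -> (m <= k)%N -> dpow x k y = 0.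
Proof.
move=> my mk; rewrite /dpow -(subnK mk) iterD my.
by rewrite it_bracket0 scaler0.
Qed.

Lemma dpowS x k y : bracket x (dpow x k y) = k.+1%:R *: dpow x k.+1 y.
Proof.
rewrite /dpow bracketZr scalerA factS natrM invfM mulrA divff ?mul1r //.
by rewrite pnatr_eq0.
Qed.

Lemma dpow_bracket x k y z :
  dpow x k (bracket y z) = \sum_(i < k.+1) bracket (dpow x i y) (dpow x (k - i) z).
Proof.
elim: k => [|k IH].
  by rewrite big_ord_recl big_ord0 addr0 /dpow /= !fact0 !invr1 !scale1r.
have k0 : k.+1%:R != 0 :> K by rewrite pnatr_eq0.
apply: (scalerI k0); rewrite -dpowS IH raddf_sum /=.
under eq_bigr => i _ do rewrite leibniz !dpowS bracketZl bracketZr.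
rewrite big_split /=.
have -> : \sum_(i < k.+1) i.+1%:R *: bracket (dpow x i.+1 y) (dpow x (k - i) z)
   = \sum_(i < k.+2) i%:R *: bracket (dpow x i y) (dpow x (k.+1 - i) z).
  by rewrite [RHS]big_ord_recl /= scale0r add0r.
have -> : \sum_(i < k.+1) (k - i).+1%:R *: bracket (dpow x i y) (dpow x (k - i).+1 z)
   = \sum_(i < k.+2) (k.+1 - i)%:R *: bracket (dpow x i y) (dpow x (k.+1 - i) z).
  rewrite [RHS]big_ord_recr /= subnn scale0r addr0; apply: eq_bigr => i _.
  by rewrite subSn // -ltnS.
rewrite -big_split scaler_sumr; apply: eq_bigr => i _ /=.
by rewrite -scalerDl -natrD subnKC // -ltnS.
Qed.

(** The exponential series cut off at some exponent killing [y]; by [expadE] the choice is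
    irrelevant. The default of [xget] is met only where no power of [bracket x] kills [y]. *)
Definition expad (x y : g) : g :=
  \sum_(k < xget 0%N [set k | iter k (bracket x) y = 0]) dpow x k y.

Lemma expadE x y N : iter N (bracket x) y = 0 -> expad x y = \sum_(k < N) dpow x k y.
Proof.
move=> yN; rewrite /expad; case: xgetP => [m _ my|/(_ N)//].
have aux a b : (a <= b)%N -> iter a (bracket x) y = 0 ->
    \sum_(k < b) dpow x k y = \sum_(k < a) dpow x k y.
  move=> ab ya; rewrite -(subnKC ab) big_split_ord /= [X in _ + X]big1 ?addr0 // => i _.
  by apply: dpow_geq ya _; rewrite leq_addr.
by case: (leqP m N) => mN; [rewrite (aux _ _ mN) | rewrite (aux N m (ltnW mN))].
Qed.

Variable x : g.
Hypothesis nilx : forall y : g, exists k, iter k (bracket x) y = 0.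

Lemma nil_bound y z : exists N, iter N (bracket x) y = 0 /\ iter N (bracket x) z = 0.
Proof.
have [a ya] := nilx y; have [b zb] := nilx z; exists (a + b)%N.
by rewrite {1}addnC !iterD ya zb !it_bracket0.
Qed.

Lemma expad_lin : linear (expad x).
Proof.
move=> a y z; have [N [yN zN]] := nil_bound y z.
rewrite (expadE yN) (expadE zN) (expadE (N := N)).
  by rewrite scaler_sumr -big_split; apply: eq_bigr => k _; rewrite linearP.
have -> : iter N (bracket x) (a *: y + z) =
    a *: iter N (bracket x) y + iter N (bracket x) z.
  by elim: {yN zN} N => //= N ->; rewrite linearP.
by rewrite yN zN scaler0 addr0.
Qed.

Lemma expad_bracket y z : expad x (bracket y z) = bracket (expad x y) (expad x z).
Proof.
have [N [yN zN]] := nil_bound y z.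
rewrite (expadE yN) (expadE zN) (expadE (N := (N + N)%N)); last first.
  apply: (@iter_bilinear_nil _ _ _ (bracket (s := g)) (bracket x) (bracket x)) => //.
  - exact: bracket0l.
  - exact: bracket0r.
  - exact: leibniz.
under eq_bigr => k _ do rewrite dpow_bracket.
rewrite (big_convolution (F := fun i j => bracket (dpow x i y) (dpow x j z))).
  rewrite bracketC raddf_sum -sumrN; apply: eq_bigr => i _.
  by rewrite /= -bracketC raddf_sum.
move=> i j /orP[iN|jN]; first by rewrite (dpow_geq yN) // bracket0l.
by rewrite (dpow_geq zN) // bracket0r.
Qed.

(** The last power of [bracket x] that does not kill [y] leaves only the constant term of the
    series. *)
Lemma expad_eq0 y : expad x y = 0 -> y = 0.
Proof.
have ex : exists k, iter k (bracket x) y == 0 by have [k /eqP] := nilx y; exists k.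
case: (ex_minnP ex) => -[/eqP//|N] /eqP yN Nmin; rewrite (expadE yN) => E.
have : iter N (bracket x) (\sum_(k < N.+1) dpow x k y) = 0 by rewrite E it_bracket0.
have -> : iter N (bracket x) (\sum_(k < N.+1) dpow x k y) = iter N (bracket x) y.
  have itD m u v : iter m (bracket x) (u + v) = iter m (bracket x) u + iter m (bracket x) v.
    by elim: m => //= m ->; rewrite bracketDr.
  have itZ m a u : iter m (bracket x) (a *: u) = a *: iter m (bracket x) u.
    by elim: m => //= m ->; rewrite bracketZr.
  rewrite big_ord_recl itD (_ : iter N _ (\sum_(i < N) _) = 0) ?addr0.
    by rewrite itZ fact0 invr1 scale1r.
  elim/big_rec: _ => [|i z _ IH]; first exact: it_bracket0.
  by rewrite itD IH addr0 itZ -iterD /= addnS -addSn addnC iterD yN it_bracket0 scaler0.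
by move/eqP/Nmin; rewrite ltnn.
Qed.
End Exponential.

Section Reflections.
Variables (K : numFieldType) (n : nat) (A : 'M[int]_n).
Variable g : kac_moody_algebra K A.

Notation Q := {ffun 'I_n -> int}.
Notation e := (km_e g).
Notation f := (km_f g).
Notation hc := (cartan_in g).
Notation hi := (simple_coroot g).
Notation g' := (km_opp g).

Hypothesis A_diag : forall i, A i i = 2.
Hypothesis A_off : forall i j, i != j -> A i j <= 0.
Hypothesis A_sym0 : forall i j, A i j = 0 -> A j i = 0.

Definition spair (i : 'I_n) (c : Q) : int := \sum_j A i j * c j.

Lemma pair_hi i c : pair g c (hi i) = (spair i c)%:~R.
Proof.
rewrite {1}/pair /wt sum_lfunE /spair raddf_sum; apply: eq_bigr => j _.
rewrite -wt_al -raddfMz -/(pair g _ _) pairMz pair_al_hi.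
by rewrite mulrC [RHS]intrM.
Qed.

Lemma spairD i c d : spair i (c + d) = spair i c + spair i d.
Proof. by rewrite /spair -big_split; apply: eq_bigr => j _; rewrite ffunE mulrDr. Qed.
Lemma spairN i c : spair i (- c) = - spair i c.
Proof. by rewrite /spair -sumrN; apply: eq_bigr => j _; rewrite ffunE mulrN. Qed.
Lemma spair_al i j : spair i (al j) = A i j.
Proof.
rewrite /spair (bigD1 j) //= ffunE eqxx mulr1 big1 ?addr0 // => k kj.
by rewrite ffunE eq_sym (negPf kj) mulr0.
Qed.

Definition refl i (c : Q) : Q := c - al i *~ spair i c.
Definition reflc i (h : cartan g) : cartan g := h - pair g (al i) h *: hi i.

Lemma pair_refl i c h : pair g (refl i c) h = pair g c (reflc i h).
Proof.
rewrite /refl /reflc pairD pairN pairDr pairNr pairZr pair_hi; congr (_ - _).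
by rewrite pairMz mulrC.
Qed.

Lemma reflcK i : involutive (reflc i).
Proof.
move=> h; rewrite /reflc pairDr pairNr pairZr pair_al_hi A_diag -addrA -opprD -scalerDl.
by rewrite (_ : forall p : K, p + (p - p * 2%:~R) = 0) ?scale0r ?subr0 // => p; ring.
Qed.

(** The standard lift of a simple reflection to the Lie algebra: it preserves brackets, acts on the
    Cartan subalgebra by [reflc i], and hence permutes root spaces by [refl i]. *)
Definition tau i (x : g) : g := expad (e i) (expad (- f i) (expad (e i) x)).

Let nile i (y : g) : exists k, iter k (bracket (e i)) y = 0.
Proof. exact: ad_nil_e. Qed.

Let nilf i (y : g) : exists k, iter k (bracket (- f i)) y = 0.
Proof.
have [k ky] := ad_nil_e (g := g') A_diag A_off A_sym0 i y; exists k.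
have -> : iter k (bracket (- f i)) y = (-1) ^+ k *: iter k (bracket (f i)) y.
  elim: {ky} k => [|k IH]; first by rewrite expr0 scale1r.
  by rewrite !iterS IH bracketNl bracketZr -scaleNr exprS mulN1r.
by rewrite [iter k _ y]ky scaler0.
Qed.

Lemma tau_bracket i x y : tau i (bracket x y) = bracket (tau i x) (tau i y).
Proof. by rewrite /tau !expad_bracket. Qed.

Lemma tau_lin i : linear (tau i).
Proof. by move=> a x y; rewrite /tau !expad_lin. Qed.
HB.instance Definition _ i := GRing.isLinear.Build K g g *:%R (tau i) (tau_lin i).

Lemma tau_inj i x : tau i x = 0 -> x = 0.
Proof. by move=> /expad_eq0-/(_ (nile i))/expad_eq0-/(_ (nilf i))/expad_eq0; apply. Qed.

Lemma dpow0 (x y : g) : dpow x 0 y = y.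
Proof. by rewrite /dpow fact0 invr1 scale1r. Qed.
Lemma dpow1 (x y : g) : dpow x 1 y = bracket x y.
Proof. by rewrite /dpow factS fact0 invr1 scale1r. Qed.

Lemma expad_e_cartan i h : expad (e i) (hc h) = hc h - pair g (al i) h *: e i.
Proof.
have E : bracket (e i) (hc h) = - (pair g (al i) h *: e i).
  by rewrite bracketC gspace_e.
rewrite (expadE (N := 2)); last by rewrite /= E bracketNr bracketZr bracketxx scaler0 oppr0.
by rewrite big_ord_recl big_ord1 dpow0 dpow1 E.
Qed.

Lemma tau_cartan i h : tau i (hc h) = hc (reflc i h).
Proof.
have fh h' : bracket (- f i) (hc h') = - (pair g (al i) h' *: f i).
  by rewrite bracketNl bracketC opprK gspace_f pairN scaleNr.
have fe : bracket (- f i) (e i) = hc (hi i).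
  by rewrite bracketNl bracketC opprK km_ef eqxx.
have ff : bracket (- f i) (f i) = 0 by rewrite bracketNl bracketxx oppr0.
have E1 h' : expad (- f i) (hc h') = hc h' - pair g (al i) h' *: f i.
  rewrite (expadE (N := 2)); last by rewrite /= fh bracketNr bracketZr ff scaler0 oppr0.
  by rewrite big_ord_recl big_ord1 dpow0 dpow1 fh.
have E2 : expad (- f i) (e i) = e i + hc (hi i) - f i.
  rewrite (expadE (N := 3)); last first.
    by rewrite /= fe fh bracketNr bracketZr ff scaler0 oppr0.
  rewrite !big_ord_recl big_ord0 addr0 dpow0 dpow1 fe /dpow /= fe fh addrA.
  congr (_ + _); rewrite scalerN scalerA pair_al_hi A_diag.
  by rewrite (_ : (1 + 1)`! = 2)%N // mulVf ?scale1r // pnatr_eq0.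
rewrite /tau expad_e_cartan.
have L := expad_lin (nilf i); have L' := expad_lin (nile i).
pose E : {linear g -> g} := HB.pack (expad (- f i)) (GRing.isLinear.Build K g g *:%R _ L).
pose E' : {linear g -> g} := HB.pack (expad (e i)) (GRing.isLinear.Build K g g *:%R _ L').
set p := pair g (al i) h.
have -> : expad (- f i) (hc h - p *: e i) = hc (reflc i h) - p *: e i.
  rewrite -[expad _ _]/(E _) linearB linearZ /= E1 E2 /reflc linearB linearZ /=.
  rewrite -/p !scalerDr scalerN !opprD opprK !addrA.
  have abel (V : zmodType) (a b c d : V) : a - b - c - d + b = a - d - c.
    by rewrite addrAC [a - b - c + b]addrAC subrK addrAC.
  have hE : hc (h - p *: hi i) = hc h - p *: hc (hi i).
    by rewrite linearB linearZ.
  rewrite hE; exact: abel.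
rewrite -[expad _ _]/(E' _) linearB linearZ /= !expad_e_cartan.
rewrite (expadE (N := 1)) /= ?bracketxx // big_ord1 dpow0.
rewrite /reflc pairDr pairNr pairZr pair_al_hi A_diag -/p.
rewrite -addrA -opprD -scalerDl.
by rewrite (_ : forall p : K, p - p * 2%:~R + p = 0) ?scale0r ?subr0 // => q; ring.
Qed.

Lemma gspace_tau i c x : gspace c x -> gspace (refl i c) (tau i x).
Proof.
move=> Gx h; rewrite pair_refl -linearZ /= -Gx tau_bracket tau_cartan.
by rewrite reflcK.
Qed.

Lemma spairMz i c m : spair i (c *~ m) = m * spair i c.
Proof.
have add : zmod_morphism (spair i) by move=> x y; rewrite spairD spairN.
pose E : {additive Q -> int} := HB.pack (spair i) (GRing.isZmodMorphism.Build Q int _ add).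
by rewrite -[spair i _]/(E _) raddfMz mulrzz mulrC.
Qed.

Lemma reflK i : involutive (refl i).
Proof.
move=> c; rewrite /refl spairD spairN spairMz spair_al A_diag -addrA -opprD -mulrzDr.
by rewrite (_ : forall p : int, p + (p - p * 2) = 0) ?mulr0z ?subr0 // => p; ring.
Qed.

Lemma reflN i c : refl i (- c) = - refl i c.
Proof. by rewrite /refl spairN mulrNz opprB opprK addrC. Qed.

(** Weyl group orbits of pairs of a simple root and its coroot. Induction along [tau] transports
    sl2-triples, multiplicity one and ad-nilpotency from the simple roots. *)
Inductive real : Q -> cartan g -> Prop :=
| real_simple i : real (al i) (hi i)
| real_refl i c h : real c h -> real (refl i c) (reflc i h).

Lemma real_opp c h : real c h -> real (- c) (- h).
Proof.
elim=> {c h} [i|i c h _ R].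
  have -> : - al i = refl i (al i).
    by rewrite /refl spair_al A_diag (mulrzDr _ 1 1) opprD addrA subrr add0r.
  have -> : - hi i = reflc i (hi i); last exact/real_refl/real_simple.
  by rewrite /reflc pair_al_hi A_diag -[2%:~R]/(1 + 1) scalerDl scale1r opprD addrA subrr add0r.
rewrite -reflN; have -> : - reflc i h = reflc i (- h); last exact: real_refl.
by rewrite /reflc pairNr scaleNr opprB opprK addrC.
Qed.

Lemma real_pair c h : real c h -> pair g c h = 2.
Proof.
elim=> {c h} [i|i c h _ R]; first by rewrite pair_al_hi A_diag.
by rewrite pair_refl reflcK.
Qed.

Lemma real_triple c h : real c h ->
  exists x y : g, [/\ gspace c x, gspace (- c) y & bracket x y = hc h].
Proof.
elim=> {c h} [i|i c h _ [x [y [Gx Gy xy]]]].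
  by exists (e i), (f i); rewrite km_ef eqxx; split=> //; [exact: gspace_e | exact: gspace_f].
exists (tau i x), (tau i y); split; first exact: gspace_tau.
  by rewrite -reflN; exact: gspace_tau.
by rewrite -tau_bracket xy tau_cartan.
Qed.

Lemma real_dim1 c h : real c h -> forall x y : g,
  gspace c x -> gspace c y -> y <> 0 -> exists a, x = a *: y.
Proof.
elim=> {c h} [i|i c h _ IH] x y Gx Gy yn.
  have [a xE] := gspace_al Gx; have [b yE] := gspace_al Gy.
  exists (a / b); rewrite xE yE scalerA divfK //.
  by apply/eqP => b0; apply: yn; rewrite yE b0 scale0r.
have := gspace_tau i Gx; have := gspace_tau i Gy; rewrite reflK => Ty Tx.
have tyn : tau i y <> 0 by move/tau_inj.
have [a aE] := IH _ _ Tx Ty tyn.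
exists a; apply/eqP; rewrite -subr_eq0; apply/eqP/(@tau_inj i).
by rewrite raddfB /= linearZ aE subrr.
Qed.

Lemma real_nil c h : real c h -> forall x : g, gspace c x -> ad_nil x.
Proof.
elim=> {c h} [i|i c h _ IH] x Gx y.
  have [a ->] := gspace_al Gx; have [k ky] := ad_nil_e A_diag A_off A_sym0 i y.
  exists k; have -> : iter k (bracket (a *: e i)) y = a ^+ k *: iter k (bracket (e i)) y.
    elim: {ky} k => [|k IH]; first by rewrite expr0 scale1r.
    by rewrite !iterS IH bracketZl bracketZr scalerA -exprS.
  by rewrite ky scaler0.
have := gspace_tau i Gx; rewrite reflK => Tx.
have [k ky] := IH _ Tx (tau i y); exists k; apply: (@tau_inj i).
rewrite -ky; elim: {ky} k => //= k <-; exact: tau_bracket.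
Qed.

Definition isroot (c : Q) : Prop := c <> 0 /\ exists2 x : g, gspace c x & x <> 0.

Lemma real_isroot c h : real c h -> isroot c.
Proof.
move=> R; have [x [y [Gx Gy xy]]] := real_triple R; have p2 := real_pair R.
split=> [c0|].
  by move: p2; rewrite c0 pair0 => /esym/eqP; rewrite pnatr_eq0.
exists x => // x0; move: xy; rewrite x0 bracket0l -(raddf0 hc).
move=> /esym/(@cartan_in_inj _ _ _ g) h0; move: p2; rewrite h0 /pair linear0.
by move=> /esym/eqP; rewrite pnatr_eq0.
Qed.

Lemma isroot_refl i c : isroot c -> isroot (refl i c).
Proof.
move=> [cn [x Gx xn]]; split.
  by move=> r0; apply: cn; rewrite -[c](reflK i) r0 /refl /spair big1 ?mulr0z ?subr0 // => j _; rewrite ffunE mulr0.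
by exists (tau i x); [exact: gspace_tau | move/tau_inj].
Qed.

Lemma isroot_coherent c : isroot c -> pos c \/ pos (- c).
Proof. by move=> [cn [x Gx xn]]; case: (gspace_coherent Gx xn); auto. Qed.

Lemma isroot_mul_al i m : isroot (al i *+ m) -> m = 1%N.
Proof.
case: m => [|[|m]] //; first by rewrite mulr0n => -[].
by move=> [_ [x /gspace_mul_al]].
Qed.

End Reflections.

Arguments real {K n A} g _ _.
Arguments isroot {K n A} g c.

(** * Supports of irreducible modules *)

Section LieModuleBasics.
Variables (K : fieldType) (g : lieAlgType K) (V : lieModType g).

HB.instance Definition _ (x : g) :=
  GRing.isLinear.Build K V V *:%R (act x) (act_linearr x).

Lemma actD (x y : g) (v : V) : act (x + y) v = act x v + act y v.
Proof. by have := act_linearl v 1 x y; rewrite !scale1r. Qed.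
Lemma act0 (v : V) : act (0 : g) v = 0.
Proof. by apply: (addrI (act 0 v)); rewrite -actD !addr0. Qed.
Lemma actZ a (x : g) (v : V) : act (a *: x) v = a *: act x v.
Proof. by have := act_linearl v a x 0; rewrite addr0 act0 addr0. Qed.

Lemma act_comm (x y : g) (v : V) : act x (act y v) = act (bracket x y) v + act y (act x v).
Proof. by rewrite act_bracket subrK. Qed.

Definition locnil (x : g) := forall v : V, exists k, iter k (act x) v = 0.

Lemma iter_act0 (x : g) k : iter k (act x) (0 : V) = 0.
Proof. by elim: k => //= k ->; rewrite raddf0. Qed.

End LieModuleBasics.

Section WeightModule.
Variables (K : numFieldType) (n : nat) (A : 'M[int]_n).
Variables (g : kac_moody_algebra K A) (V : lieModType g).
Variable mu : 'Hom(cartan g, K^o).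

Notation Q := {ffun 'I_n -> int}.
Notation hc := (cartan_in g).

Hypothesis A_diag : forall i, A i i = 2.
Hypothesis A_off : forall i j, i != j -> A i j <= 0.
Hypothesis A_sym0 : forall i j, A i j = 0 -> A j i = 0.
Hypothesis irrV : lie_irreducible V.

(* The vectors killed by a power of x form a submodule. *)
Lemma act_inj (x : g) : ad_nil x -> ~ locnil V x ->
  forall v : V, act x v = 0 -> v = 0.
Proof.
move=> adx nx v xv; have [_ irr] := irrV.
pose W : set V := fun v => exists k, iter k (act x) v = 0.
have WV : W v by exists 1%N.
have /irr : lie_submodule W.
  split; [split; first by exists 0%N|].
    move=> a u w [k ku] [p pw]; exists (k + p)%N.
    have -> : iter (k + p) (act x) (a *: u + w) =
        a *: iter (k + p) (act x) u + iter (k + p) (act x) w.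
      by elim: (k + p)%N => //= ? ->; rewrite linearP.
    by rewrite {1}addnC !iterD ku pw !iter_act0 scaler0 addr0.
  move=> y w [p pw]; have [k ky] := adx y; exists (k + p)%N.
  apply: (@iter_bilinear_nil _ _ _ (@act _ _ V) (bracket x) (act x)) => //.
  - exact: act0.
  - by move=> u; rewrite raddf0.
  - by move=> u z; exact: act_comm.
case=> WE; first by move: WV; rewrite WE.
by case: nx => u; change (W u); rewrite WE.
Qed.
Definition wval (c : Q) (h : cartan g) : K := (mu h : K) + pair g c h.

Definition vspace (c : Q) (v : V) : Prop := forall h, act (hc h) v = wval c h *: v.

Definition insupp (c : Q) : Prop := exists2 v, vspace c v & v <> 0.

Definition nilroot (b : Q) : Prop := forall x, gspace b x -> locnil V x.

Lemma vspace_act b c x v : gspace b x -> vspace c v -> vspace (c + b) (act x v).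
Proof.
move=> Gx Vv h; rewrite act_comm Gx actZ Vv linearZ /= -scalerDl; congr (_ *: _).
by rewrite /wval pairD addrC -addrA.
Qed.

Lemma vspace_iter b c x v k : gspace b x -> vspace c v ->
  vspace (c + b *+ k) (iter k (act x) v).
Proof.
move=> Gx Vv; elim: k => [|k IH] /=; first by rewrite addr0.
by rewrite mulrSr addrA; exact: vspace_act.
Qed.

Lemma insupp_inj b h c : real g b h -> ~ nilroot b -> insupp c -> insupp (c + b).
Proof.
move=> R nN [v Vv vn].
have [x Gx nx] : exists2 x, gspace b x & ~ locnil V x.
  apply: contrapT => ex; apply: nN => x Gx; apply: contrapT => nx; apply: ex.
  by exists x.
exists (act x v); first exact: vspace_act.
by move/(act_inj (real_nil A_diag A_off A_sym0 R Gx) nx).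
Qed.

Lemma insupp_string b h c : real g b h -> nilroot b -> nilroot (- b) -> insupp c ->
  exists m : int, wval c h = m%:~R /\ forall j : nat, j%:Z <= m -> insupp (c - b *+ j).
Proof.
move=> R Nb Nb' [v Vv vn].
have [x [y [Gx Gy xy]]] := real_triple A_diag A_off A_sym0 R.
have p2 := real_pair A_diag R.
have ef u : act x (act y u) = act y (act x u) + act (hc h) u :> V.
  by rewrite act_comm xy addrC.
have he u : act (hc h) (act x u) = act x (act (hc h) u) + 2 *: act x u :> V.
  by rewrite act_comm Gx p2 actZ addrC.
have hf u : act (hc h) (act y u) = act y (act (hc h) u) - 2 *: act y u :> V.
  by rewrite act_comm Gy pairN p2 actZ scaleNr addrC.
have [k [N [kN un fu]]] := sl2_string ef he hf vn (Vv h) (Nb x Gx v) (Nb' y Gy).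
exists (N%:Z - (k.*2)%:Z); split.
  by rewrite rmorphB /= -!pmulrn -kN addrK.
(* Climb [k] steps to the top of the string, then descend [k + j] steps; this stays within length
   [N] because [m = N - 2k]. *)
move=> j jm; exists (iter (k + j) (act y) (iter k (act x) v)); last by apply: fu; lia.
have := vspace_iter (k + j) Gy (vspace_iter k Gx Vv).
by rewrite mulNrn mulrnDr opprD addrA addrK.
Qed.

End WeightModule.

(** * Primitive vectors from additive functionals *)

Section Primitive.
Variables (K : numFieldType) (n : nat) (A : 'M[int]_n).
Variables (g : kac_moody_algebra K A) (V : lieModType g).
Variable mu : 'Hom(cartan g, K^o).

Notation Q := {ffun 'I_n -> int}.
Notation hc := (cartan_in g).
Notation S := (insupp V mu).

Hypothesis A_diag : forall i, A i i = 2.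
Hypothesis A_off : forall i j, i != j -> A i j <= 0.
Hypothesis A_sym0 : forall i j, A i j = 0 -> A j i = 0.

Definition has_primitive :=
  exists (P : set 'Hom(cartan g, K^o)) (v : V),
    [/\ parabolic_system P, v <> 0
      & forall x, parabolic_nil P x -> act x v = 0].

Lemma rootsE (be : 'Hom(cartan g, K^o)) :
  Defs.roots g be <-> exists2 c, be = wt g c & isroot g c.
Proof.
split=> [[bn [x Rx xn]]|[c -> [cn [x Gx xn]]]].
  have [c bE] := root_space_lattice Rx xn.
  exists c => //; split; first by move=> c0; apply: bn; rewrite bE c0 raddf0.
  by exists x => // h; rewrite Rx bE.
split; last by exists x.
by rewrite -(raddf0 (wt g)) => /wt_inj.
Qed.

Hypothesis root_opp : forall c, isroot g c -> isroot g (- c).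

Lemma primitive_functional (phi : {additive Q -> int}) (v : V) :
  (exists2 c, isroot g c & phi c <> 0) -> v <> 0 ->
  (forall c x, 0 < phi c -> gspace c x -> act (x : g) v = 0) -> has_primitive.
Proof.
move=> [c0 c0r phi0] vn kill.
pose P : set 'Hom(cartan g, K^o) := fun be => exists2 c, be = wt g c & isroot g c /\ 0 <= phi c.
exists P, v; split=> //; last first.
  move=> x [s [u [us sP su ->]]].
  have -> : act (\sum_(i <- s) u i) v = \sum_(i <- s) act (u i) v.
    by elim: (s) => [|b t IH]; rewrite ?big_nil ?act0 // !big_cons actD IH.
  rewrite big_seq big1 // => b bs; have [[c bE [cr c0']] nP] := sP _ bs.
  apply: (kill c); last by move=> h; rewrite (su _ bs) bE.
  (* A root with [phi c = 0] has its negative in [P] as well, so it belongs to the Levi part. *)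
  rewrite lt_neqAle c0' andbT; apply/eqP => phic; apply: nP.
  exists (wt g (- c)); last by rewrite raddfN opprK bE.
  by exists (- c) => //; split; [exact: root_opp | rewrite raddfN -phic oppr0].
split.
- by move=> be [c -> [cr _]]; apply/rootsE; exists c.
- move=> be [[_ [c -> [cr c0']] [_ [d -> [dr d0]]] <-]].
  rewrite -raddfD => /rootsE[e /wt_inj <- er].
  by exists (c + d) => //; split=> //; rewrite raddfD addr_ge0.
- move=> PE; have neg : exists2 c, isroot g c & phi c < 0.
    have [c0n|c0p] := ltP (phi c0) 0; first by exists c0.
    exists (- c0); first exact: root_opp.
    by rewrite raddfN oppr_lt0 lt_neqAle c0p andbT eq_sym; apply/eqP.
  have [c cr cn] := neg.
  have : P (wt g c) by rewrite PE; apply/rootsE; exists c.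
  by case=> d /wt_inj <- [_]; rewrite leNgt cn.
- apply/seteqP; split=> be.
    case=> [[c -> [cr _]]|[_ [c -> [cr _]] <-]]; apply/rootsE; first by exists c.
    by exists (- c); [rewrite raddfN | exact: root_opp].
  move=> /rootsE[c -> cr]; have [c0'|c0'] := leP 0 (phi c); first by left; exists c.
  right; exists (wt g (- c)); last by rewrite raddfN opprK.
  by exists (- c) => //; split; [exact: root_opp | rewrite raddfN oppr_ge0 ltW].
Qed.

Lemma primitive_support (phi : {additive Q -> int}) (c : Q) :
  (exists2 b, isroot g b & phi b <> 0) -> S c ->
  (forall b, isroot g b -> 0 < phi b -> ~ S (c + b)) -> has_primitive.
Proof.
move=> phin [v Vv vn] kill; apply: (primitive_functional phin vn) => b x b0 Gx.
apply: contrapT => xvn; apply: (kill b) => //; last first.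
  by exists (act x v) => //; exact: vspace_act.
split; first by move=> bE; move: b0; rewrite bE raddf0 ltxx.
by exists x => // x0; apply: xvn; rewrite x0 act0.
Qed.

Section FarSupport.
Variables (phi : {additive Q -> int}) (de : Q) (reps : seq Q).
Hypothesis phi_de : 0 < phi de.
Hypothesis root_reps : forall c, isroot g c ->
  exists2 q, q \in reps & exists k : int, c = q + de *~ k.
Hypothesis root_kind : forall c, isroot g c ->
  (exists h, real g c h) \/ (exists k : int, c = de *~ k).
Hypothesis real_nilroot : forall b h, real g b h -> 0 < phi b -> nilroot V b.
Hypothesis far : forall c q, exists N : nat, forall k : nat, (N <= k)%N -> ~ S (c + q + de *+ k).

Definition killed (m : nat) (v : V) :=
  forall b (x : g), m%:Z < phi b -> gspace b x -> act x v = 0.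

Let kills (L : seq Q) (v : V) := forall b (x : g), b \in L -> gspace b x -> act x v = 0.

Let good m L := exists c v, [/\ vspace mu c v, v <> 0, killed m v & kills L v].

Lemma killed_act m b x (v : V) : phi b = m%:Z -> (0 < m)%N -> gspace b x ->
  killed m v -> killed m (act x v).
Proof.
move=> bm m0 Gx kv b' y b'm Gy; rewrite act_comm (kv _ _ b'm Gy) raddf0 addr0.
by apply: kv (gspace_bracket Gy Gx); rewrite raddfD /= bm; lia.
Qed.

Lemma kills_act m L b x v : phi b = m%:Z -> (0 < m)%N -> gspace b x ->
  (forall b', b' \in L -> phi b' = m%:Z) ->
  killed m v -> kills L v -> kills L (act x v).
Proof.
move=> bm m0 Gx Lm kv Lv b' y b'L Gy; rewrite act_comm (Lv _ _ b'L Gy) raddf0 addr0.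
by apply: kv (gspace_bracket Gy Gx); rewrite raddfD /= bm (Lm _ b'L); lia.
Qed.

(** On vectors whose levels above [m] are dead, root vectors of level [m] commute, since their
    brackets have level [2m > m]. So killing one more root space preserves what was killed before.
    Real root vectors are exhausted by local nilpotency, imaginary ones by running out of the
    support. *)
Lemma kill_list m L : (0 < m)%N -> (forall b, b \in L -> phi b = m%:Z) ->
  (exists c v, [/\ vspace mu c v, v <> 0 & killed m v]) -> good m L.
Proof.
move=> m0; elim: L => [|b L IH] Lm ex.
  by have [c [v [Vv vn kv]]] := ex; exists c, v; split.
have bm : phi b = m%:Z by apply: Lm; rewrite inE eqxx.
have Lm' b' : b' \in L -> phi b' = m%:Z by move=> b'L; apply: Lm; rewrite inE b'L orbT.
have [c [v [Vv vn kv Lv]]] := IH Lm' ex.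
have cons v' : (forall x, gspace b x -> act (x : g) v' = 0) -> kills L v' -> kills (b :: L) v'.
  by move=> bv' Lv' b' x; rewrite inE => /predU1P[->|]; [exact: bv' | exact: Lv'].
have [rb|nrb] := pselect (isroot g b); last first.
  exists c, v; split=> //; apply: cons => // x Gx.
  suff -> : x = 0 by rewrite act0.
  apply: contrapT => xn; apply: nrb; split; last by exists x.
  by move=> b0; move: bm; rewrite b0 raddf0; lia.
case: (root_kind rb) => [[h R]|[k bE]].
  have [_ [x Gx xn]] := rb.
  have := real_nilroot R; rewrite bm => /(_ _)/(_ x Gx v).
  have -> : 0 < m%:Z by lia.
  move=> /(_ isT)[k0 k0v].
  have ex' : exists k, iter k (act x) v == 0 by exists k0; apply/eqP.
  case: (ex_minnP ex') => -[/eqP//|k] /eqP kv0 kmin.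
  exists (c + b *+ k), (iter k (act x) v); split.
  - exact: vspace_iter.
  - by move/eqP/kmin; rewrite ltnn.
  - elim: {kv0 kmin} k => //= k IHk; exact: (killed_act bm m0 Gx IHk).
  - apply: cons => [y Gy|].
      (* A real root space is a line, so the single root vector [x] decides. *)
      have [a ->] := real_dim1 A_diag A_off A_sym0 R Gy Gx xn.
      by rewrite actZ -[act x _]/(iter k.+1 _ _) kv0 scaler0.
    suff [] : killed m (iter k (act x) v) /\ kills L (iter k (act x) v) by [].
    elim: {kv0 kmin} k => //= k [IH1 IH2]; split; first exact: (killed_act bm m0 Gx IH1).
    exact: (kills_act bm m0 Gx Lm' IH1 IH2).
have k0 : 0 < k.
  have : 0 < phi b by rewrite bm; lia.
  by rewrite bE raddfMz mulrzz pmulr_rgt0.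
have [N farN] := far c 0.
have {farN} farN t : (N <= t)%N -> ~ S (c + de *+ t).
  by move=> Nt; have := farN t Nt; rewrite addr0.
(* [N] bounds how far the support extends from [c] along [de]. Each nonzero application of a root
   vector of weight [de *~ k] with [k > 0] lowers this bound by at least one. *)
elim: N c v Vv vn kv Lv farN => [|N IHN] c v Vv vn kv Lv farN.
  by case: (farN 0%N) => //; rewrite addr0; exists v.
have [all0|] := pselect (forall x, gspace b x -> act (x : g) v = 0).
  by exists c, v; split=> //; exact: cons.
move=> /existsNP[x /not_implyP[Gx xv]].
apply: (IHN (c + b) (act x v)) => //.
- exact: vspace_act.
- exact: (killed_act bm m0 Gx kv).
- exact: (kills_act bm m0 Gx Lm' kv Lv).
move=> t Nt; case: k bE k0 => // k bE k0.
rewrite bE -addrA -pmulrn -mulrnDr; apply: farN; lia.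
Qed.

Lemma kill_level m : (exists c v, [/\ vspace mu c v, v <> 0 & killed m.+1 v]) ->
  exists c v, [/\ vspace mu c v, v <> 0 & killed m v].
Proof.
(* Each class modulo [de] has at most one member of level [m.+1]; the filter discards the classes
   where the division is not exact. *)
move=> ex; pose L := [seq b <- [seq q + de *~ ((m.+1%:Z - phi q) %/ phi de)%Z | q <- reps] | phi b == m.+1%:Z].
have [||c [v [Vv vn kv Lv]]] := @kill_list m.+1 L _ _ ex => //.
  by move=> b; rewrite mem_filter => /andP[/eqP].
exists c, v; split=> // b x bm Gx.
have [m1b|bm1] := ltP m.+1%:Z (phi b); first exact: kv Gx.
have bE : phi b = m.+1%:Z by lia.
have [->|xn] := pselect (x = 0); first by rewrite act0.
have rb : isroot g b.
  by split; [move=> b0; move: bE; rewrite b0 raddf0 | exists x].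
apply: Lv Gx; rewrite mem_filter bE eqxx /=; apply/mapP.
have [q qr [k bqk]] := root_reps rb; exists q => //.
rewrite {1}bqk; congr (_ + _ *~ _).
by rewrite -bE bqk raddfD raddfMz /= mulrzz addrAC subrr add0r mulKz // gt_eqF.
Qed.

Lemma primitive_far : (exists c, S c) -> (exists b, isroot g b /\ phi b <> 0) -> has_primitive.
Proof.
move=> [c [v Vv vn]] [b0 [rb0 b0n]].
have [N farN] : exists N, forall q, q \in reps -> forall k : nat, (N <= k)%N -> ~ S (c + q + de *+ k).
  elim: (reps) => [|q r [N IH]]; first by exists 0%N.
  have [M farM] := far c q; exists (N + M)%N => p.
  by rewrite inE => /predU1P[->|pr] k kN; [apply: farM | apply: (IH p)] => //; lia.
(* Large enough that a root [q + de *~ k] with [phi] above [M] has [k > N], and so leads out of the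
   support. *)
pose M := (\sum_(q <- reps) absz (phi q) + N * absz (phi de))%N.
have start : exists c v, [/\ vspace mu c v, v <> 0 & killed M v].
  exists c, v; split=> // b x Mb Gx.
  apply: contrapT => xvn.
  have rb : isroot g b.
    split; first by move=> bE; move: Mb; rewrite bE raddf0; lia.
    by exists x => // x0; apply: xvn; rewrite x0 act0.
  have [q qr [k bE]] := root_reps rb.
  have Sq : (absz (phi q) <= \sum_(q <- reps) absz (phi q))%N.
    by rewrite (big_rem q) //= leq_addr.
  have kN : N%:Z < k.
    move: Mb; rewrite /M bE (raddfD phi) (raddfMz phi) mulrzz => Mb.
    rewrite -(ltr_pM2l phi_de); move: Mb Sq phi_de.
    move: (phi q) (phi de) => p d; nia.
  case: k kN bE => // k kN bE; apply: (farN q qr k); first lia.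
  rewrite -addrA pmulrn -bE; exists (act x v) => //; exact: vspace_act.
elim: M start => [|m IH] start; last exact/IH/kill_level.
have [c' [v' [Vv' vn' kv']]] := start.
apply: (primitive_functional _ vn' kv'); by exists b0.
Qed.

End FarSupport.
End Primitive.

Lemma ffunMzE (I : finType) (V : zmodType) (f : {ffun I -> V}) k x : (f *~ k) x = f x *~ k.
Proof. by case: k => t; rewrite ?NegzE ?mulrNz -?pmulrn ?ffunE ffunMnE. Qed.

(** * Roots of affine type *)

Section Descent.
Variables (K : numFieldType) (n : nat) (A : 'M[int]_n).
Variables (g : kac_moody_algebra K A).
Notation Q := {ffun 'I_n -> int}.

Hypothesis A_diag : forall i, A i i = 2.

Variables (de : Q) (X : Q -> Prop).
Hypothesis de_null : forall i, spair A i de = 0.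
Hypothesis descent : forall c, pos c -> (exists k, c = de *~ k) \/ exists i, 0 < spair A i c.
Hypothesis X_coherent : forall c, X c -> c <> 0 -> pos c \/ pos (- c).
Hypothesis X_refl : forall i c, X c -> X (refl A i c).
Hypothesis X_opp : forall c, X c -> X (- c).
Hypothesis X_simple : forall i m, X (al i *+ m) -> (m <= 1)%N.

Lemma refl_null i k : refl A i (de *~ k) = de *~ k.
Proof. by rewrite /refl spairMz de_null mulr0 mulr0z subr0. Qed.

(** Reflections lower the height until a simple root or a multiple of [de] is left. The set [X] is
    abstract since the descent is used in both directions: on the roots, to classify them, and on an
    explicit list of vectors, to show that they are roots. *)
Lemma real_descent c : X c -> c <> 0 ->
  (exists k, c = de *~ k) \/ exists h, real g c h.
Proof.
have main m c' : X c' -> pos c' -> (absz (\sum_i c' i)%R < m)%N ->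
    (exists k, c' = de *~ k) \/ exists h, real g c' h.
  elim: m c' => // m IH c' Xc pc lt.
  case: (descent pc) => [|[i si]]; first by left.
  have Xr := X_refl i Xc.
  have rn : refl A i c' <> 0.
    move=> r0; case: pc => _; apply; rewrite -[c'](reflK A_diag i) r0.
    by rewrite -(mulr0z de) refl_null.
  case: (X_coherent Xr rn) => pr.
    have sumE : \sum_j (refl A i c') j = \sum_j c' j - spair A i c'.
      rewrite /refl (eq_bigr (fun j => c' j - (i == j)%:Z * spair A i c')).
        rewrite sumrB; congr (_ - _); rewrite (bigD1 i) //= eqxx mul1r big1 ?addr0 // => j ji.
        by rewrite eq_sym (negPf ji) mul0r.
      by move=> j _; rewrite !ffunE ffunMzE ffunE mulrzz.
    have pos_sum (d : Q) : pos d -> 0 <= \sum_j d j.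
      by move=> [d0 _]; apply: sumr_ge0 => j _; exact: d0.
    case: (IH _ Xr pr).
    - by have := pos_sum _ pr; have := pos_sum _ pc; rewrite sumE; lia.
    - move=> [k rE]; left; exists k; rewrite -[c'](reflK A_diag i) rE; exact: refl_null.
    - move=> [h R]; right; exists (reflc i h); rewrite -[c'](reflK A_diag i).
      exact: real_refl.
  (* The reflection changes only the [i]-th coordinate, so a positive vector that becomes negative
     is a multiple of [al i]. *)
  right; have cE : c' = al i *+ absz (c' i).
    case: pc pr => [c0 _] [c0' _]; apply/ffunP => j; rewrite ffunMnE ffunE.
    case: eqP => [->|/eqP ij]; first by move: (c' j) (c0 j) => y; rewrite pmulrn mulrzz; lia.
    have := c0 j; have := c0' j; rewrite /refl !ffunE.
    rewrite ffunMzE ffunE (negPf ij) mul0rz.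
    rewrite mul0rn; move: (c' j) => x; lia.
  have := Xc; rewrite cE => /X_simple; case: (absz (c' i)) cE => [|[|//]] cE _.
    by case: pc => _; rewrite cE mulr0n.
  by exists (simple_coroot g i); rewrite mulr1n; exact: real_simple.
move=> Xc cn; case: (X_coherent Xc cn) => pc; first exact: (main _.+1 c Xc pc (ltnSn _)).
case: (main _.+1 (- c) (X_opp Xc) pc (ltnSn _)) => [[k cE]|[h R]].
  by left; exists (- k); rewrite mulrNz -cE opprK.
by right; exists (- h); rewrite -[c]opprK; exact: real_opp.
Qed.
End Descent.

Lemma isroot_kind (K : numFieldType) (n : nat) (A : 'M[int]_n) (g : kac_moody_algebra K A)
    (de : {ffun 'I_n -> int}) :
  (forall i, A i i = 2) -> (forall i j, i != j -> A i j <= 0) ->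
  (forall i j, A i j = 0 -> A j i = 0) -> (forall i, spair A i de = 0) ->
  (forall c, pos c -> (exists k, c = de *~ k) \/ exists i, 0 < spair A i c) ->
  forall c, isroot g c -> (exists k, c = de *~ k) \/ exists h, real g c h.
Proof.
move=> A_diag A_off A_sym0 de_null descent c rc.
(* The set is symmetrized by hand, because closure of the roots under negation is obtained only from
   the classification. Multiples of a negative simple root are excluded in the opposite algebra. *)
apply: (@real_descent _ _ _ g A_diag de (fun c => isroot g c \/ isroot g (- c)) de_null descent).
- by move=> d [] /isroot_coherent []; rewrite ?opprK; auto.
- by move=> i d []; [left|right]; rewrite -?reflN; exact: isroot_refl A_diag A_off A_sym0 _ _ _.
- by move=> d []; rewrite ?opprK; auto.
- move=> i m [/isroot_mul_al -> //|[dn [x Gx xn]]].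
  have : isroot (km_opp g) (al i *+ m).
    split; first by move=> d0; apply: dn; rewrite d0 oppr0.
    by exists x => //; rewrite -[al i *+ m]opprK; apply/(gspace_opp (g := g)).
  by move/isroot_mul_al ->.
- by left.
- by case: rc.
Qed.

Section Imaginary.
Variables (K : numFieldType) (n : nat) (A : 'M[int]_n).
Variables (g : kac_moody_algebra K A).
Notation Q := {ffun 'I_n -> int}.

Hypothesis A_diag : forall i, A i i = 2.
Hypothesis A_off : forall i j, i != j -> A i j <= 0.
Hypothesis A_sym0 : forall i j, A i j = 0 -> A j i = 0.
Variable de : Q.
Hypothesis de_null : forall i, spair A i de = 0.
Notation hc := (cartan_in g).

Lemma pair_null b h : real g b h -> pair g de h = 0.
Proof.
elim=> {b h} [i|i b h _ IH]; first by rewrite pair_hi de_null.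
by rewrite /reflc pairDr pairNr pairZr IH pair_hi de_null mulr0 subr0.
Qed.

(** Bracket a root vector of weight [b + de *~ k] with one of weight [- b]. For the sl2-triple of
    [- b] the former has weight -2, and a vector of negative weight is not killed by the raising
    operator. *)
Lemma imaginary_isroot b h h' k : k != 0 -> de <> 0 ->
  real g b h -> real g (b + de *~ k) h' -> isroot g (de *~ k).
Proof.
move=> kn den R R'; split.
  move=> E; apply: den; apply/ffunP => i.
  have /ffunP/(_ i)/eqP := E; rewrite ffunMzE !ffunE mulrzz mulf_eq0 (negPf kn) orbF.
  by move/eqP.
have Ro := real_opp A_diag R.
have [y [z [Gy Gz yz]]] := real_triple A_diag A_off A_sym0 Ro.
have [_ [x Gx xn]] := real_isroot A_diag A_off A_sym0 R'.
exists (bracket y x).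
  by have := gspace_bracket Gy Gx; rewrite addrA addNr add0r.
have p2 := real_pair A_diag Ro.
have xw : bracket (hc (- h)) x = - 2 *: x.
  rewrite Gx pairD pairMz !pairNr (pair_null R) oppr0 mulr0 addr0.
  by rewrite (real_pair A_diag R).
have ef u : bracket y (bracket z u) = bracket z (bracket y u) + bracket (hc (- h)) u.
  by rewrite leibniz yz addrC.
have he u : bracket (hc (- h)) (bracket y u) = bracket y (bracket (hc (- h)) u) + 2 *: bracket y u.
  by rewrite leibniz Gy p2 bracketZl addrC.
have hf u : bracket (hc (- h)) (bracket z u) = bracket z (bracket (hc (- h)) u) - 2 *: bracket z u.
  by rewrite leibniz Gz pairN p2 bracketZl scaleNr addrC.
have [[|t] [N [tN tn _]]] := sl2_string ef he hf xn xw (real_nil A_diag A_off A_sym0 Ro Gy x) (real_nil A_diag A_off A_sym0 (real_opp A_diag Ro) Gz).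
  have : (N + 2)%:R = 0 :> K by rewrite natrD -tN addr0 addNr.
  by move/eqP; rewrite pnatr_eq0 addn2.
move=> yx; apply: tn; rewrite iterSr [X in iter _ _ X]yx.
by elim: (t) => //= t' ->; rewrite bracket0r.
Qed.
End Imaginary.

(** * The root system of A_l^(1) *)

Section TypeA.
Variables (l : nat).
Hypothesis l_gt0 : (0 < l)%N.
Notation n := l.+1.
Notation A := (gcm_A_untwisted l).
Notation Q := {ffun 'I_n -> int}.

Lemma ordS_val (i : 'I_n) : (ordS i : nat) = (if (i : nat) == l then 0 else i.+1)%N.
Proof.
rewrite /=; case: eqP => [->|]; first by rewrite modnn.
by move=> il; rewrite modn_small //; have := ltn_ord i; lia.
Qed.

Lemma ord_pred_val (i : 'I_n) : (ord_pred i : nat) = (if (i : nat) == 0 then l else i.-1)%N.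
Proof.
rewrite /=; case: eqP => [->|] /=; first by rewrite modn_small.
move=> i0; rewrite (_ : (i + l.+1).-1 = i.-1 + l.+1)%N; last by lia.
by rewrite modnDr modn_small //; have := ltn_ord i; lia.
Qed.

Lemma eq_ordE (i j : 'I_n) : (i == j) = (nat_of_ord i == nat_of_ord j).
Proof. by []. Qed.

Lemma ordS_neq (i : 'I_n) : ordS i != i.
Proof. by apply/eqP => /(congr1 (@nat_of_ord _)); rewrite ordS_val; case: eqP; lia. Qed.

Lemma A_diag_A i : A i i = 2.
Proof. by rewrite mxE eqxx eq_sym (negPf (ordS_neq i)) !subr0. Qed.

Lemma A_off_A i j : i != j -> A i j <= 0.
Proof. by move=> /negPf ij; rewrite mxE ij; case: eqP; case: eqP. Qed.

Lemma A_sym i j : A i j = A j i.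
Proof. by rewrite !mxE eq_sym addrAC. Qed.

Lemma A_sym0_A i j : A i j = 0 -> A j i = 0.
Proof. by rewrite A_sym. Qed.

Definition pA (i : 'I_n) (c : Q) : int := c i - c (ord_pred i).

Lemma pA_is_additive i : zmod_morphism (pA i).
Proof. by move=> c d; rewrite /pA !ffunE; move: (c i) => x; ring. Qed.
HB.instance Definition _ i := GRing.isZmodMorphism.Build Q int (pA i) (pA_is_additive i).

Lemma spairA i c : spair A i c = pA i c - pA (ordS i) c.
Proof.
rewrite /spair /pA ordSK.
under eq_bigr => j _ do rewrite mxE mulrBl mulrBl.
rewrite !sumrB [X in X - _ - _](bigD1 i) //= eqxx big1; last by move=> j; rewrite eq_sym => /negPf ->; rewrite mul0rn mul0r.
rewrite [X in _ - X - _](bigD1 (ordS i)) //= eqxx big1; last by move=> j /negPf ->; rewrite mul0r.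
rewrite [X in _ - _ - X](bigD1 (ord_pred i)) //= ord_predK eqxx big1.
  by rewrite mulr2n mulrDl !mul1r !addr0; move: (c i) (c _) (c _) => x y z; ring.
move=> j ji; rewrite (_ : (i == ordS j) = false) ?mul0r //.
by apply/negP => /eqP iE; case/eqP: ji; rewrite iE ordSK.
Qed.

Definition deA : Q := [ffun=> 1].
(** The usual eps_i, determined up to a common shift, normalized by eps_0 = 0 so that they lie in
    the root lattice. Node [l] is the affine one, so its coefficient is the level. [pA i] is the
    coordinate at [epsA i]. *)
Definition epsA (i : 'I_n) : Q := [ffun k : 'I_n => - ((k < i)%N : nat)%:Z].
Definition rtA (i j : 'I_n) (k : int) : Q := epsA i - epsA j + deA *~ k.

Lemma rtAE i j k x : rtA i j k x = (x < j)%N%:Z - (x < i)%N%:Z + k.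
Proof. by rewrite /rtA !ffunE ffunMzE ffunE opprK intz [- _ + _]addrC. Qed.

Lemma alAE i : al i = rtA i (ordS i) (ordS i == ord0)%:Z.
Proof.
apply/ffunP => x; rewrite rtAE ffunE !eq_ordE ordS_val.
by have := ltn_ord x; have := ltn_ord i; case: (nat_of_ord i =P l) => /=; lia.
Qed.

Lemma pA_rtA m i j k : pA m (rtA i j k) = (m == i)%:Z - (m == j)%:Z.
Proof.
rewrite /pA !rtAE !eq_ordE ord_pred_val.
have := ltn_ord m; have := ltn_ord i; have := ltn_ord j.
by case: (nat_of_ord m =P 0)%N => /=; lia.
Qed.

Lemma refl_rtA m i j k : exists i' j' k', refl A m (rtA i j k) = rtA i' j' k'.
Proof.
(* Reflection [m] exchanges the indices [m] and [ordS m]. Only at the affine node is [z] equal to 1,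
   and wrapping around the cycle then changes the level. *)
pose z := (ordS m == ord0)%:Z.
pose s x := if m == x then ordS m else if ordS m == x then m else x.
exists (s i), (s j), (k - z * (m == i)%:Z + z * (ordS m == i)%:Z + z * (m == j)%:Z - z * (ordS m == j)%:Z).
rewrite /s /refl spairA !pA_rtA alAE -/z; have /eqP mS := ordS_neq m.
apply/ffunP => x; rewrite [LHS]ffunE [X in _ + X = _]ffunE ffunMzE !rtAE mulrzz; move: (z) => t.
have [mi|mi] := eqVneq m i; have [Si|Si] := eqVneq (ordS m) i;
have [mj|mj] := eqVneq m j; have [Sj|Sj] := eqVneq (ordS m) j; subst; try congruence; rewrite /=; lia.
Qed.

Lemma rtA_diag i k : rtA i i k = deA *~ k.
Proof. by rewrite /rtA subrr add0r. Qed.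

Lemma rtA_opp i j k : - rtA i j k = rtA j i (- k).
Proof. by rewrite /rtA opprD opprB mulrNz. Qed.

Lemma rtA_simple i m a b k : al i *+ m = rtA a b k -> (m <= 1)%N.
Proof.
move=> E; have := congr1 (fun c : Q => c i) E; have := congr1 (fun c : Q => c (ordS i)) E.
rewrite !rtAE !ffunMnE ![al i _]ffunE eqxx eq_sym (negPf (ordS_neq i)) mul0rn /= pmulrn mulrzz.
have : nat_of_ord (ordS i) <> i by have /eqP := ordS_neq i; move=> h h'; apply: h; exact: val_inj.
lia.
Qed.

(** All coordinates lie in [k, k + 1] or all lie in [k - 1, k], so they never have both signs. *)
Lemma rtA_coherent a b k : rtA a b k <> 0 -> pos (rtA a b k) \/ pos (- rtA a b k).
Proof.
move=> cn; have [h|h] := pselect (forall x, 0 <= rtA a b k x); first by left.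
right; split; last by move/eqP; rewrite oppr_eq0 => /eqP.
move=> x; rewrite ffunE oppr_ge0 leNgt; apply/negP => x0; apply: h => y.
by move: x0; rewrite !rtAE; lia.
Qed.

Lemma spair_deA i : spair A i deA = 0.
Proof. by rewrite spairA /pA !ffunE !subrr. Qed.

Lemma ordS_closed (P : 'I_n -> Prop) i0 : P i0 -> (forall i, P i -> P (ordS i)) -> forall j, P j.
Proof.
move=> P0 PS j.
have itv m : nat_of_ord (iter m (@ordS n) i0) = ((i0 + m) %% n)%N.
  elim: m => [|m IH]; first by rewrite addn0 modn_small.
  by rewrite iterS /= IH -addn1 modnDml addn1 addnS.
have -> : j = iter (j + n - i0) (@ordS n) i0.
  apply/val_inj; rewrite /= itv (_ : i0 + (j + n - i0) = j + n)%N.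
    by rewrite modnDr modn_small.
  by have := ltn_ord i0; lia.
by elim: (_ - _)%N => //= m IH; apply: PS.
Qed.

(** Maximum principle on the cycle: if no [spair A i c] is positive, each value is at most the mean
    of its neighbours, and a maximum spreads to all nodes. *)
Lemma descent_A c : pos c -> (exists k, c = deA *~ k) \/ exists i, 0 < spair A i c.
Proof.
move=> _; have [[m]|h] := pselect (exists i, 0 < spair A i c); first by right; exists m.
left; have {}h i : c i + c i <= c (ordS i) + c (ord_pred i).
  rewrite leNgt; apply/negP => lt; apply: h; exists i.
  by rewrite spairA /pA ordSK; move: lt; lia.
pose i0 := [arg max_(i > ord0) c i]%O.
have i0max i : c i <= c i0 by rewrite /i0; case: arg_maxP => // j _; exact.
exists (c i0); apply/ffunP => j; rewrite ffunMzE ffunE intz.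
apply: (ordS_closed (P := fun j => c j = c i0) (i0 := i0)) => // i ci.
by have := h i; have := i0max (ordS i); have := i0max (ord_pred i); rewrite ci; lia.
Qed.

Section RootsA.
Variables (K : numFieldType) (g : kac_moody_algebra K A).

Let XA (c : Q) : Prop := exists i j k, c = rtA i j k.

Let XA_refl i c : XA c -> XA (refl A i c).
Proof. by move=> [a [b [k ->]]]; exact: refl_rtA. Qed.

Let XA_opp c : XA c -> XA (- c).
Proof. by move=> [a [b [k ->]]]; exists b, a, (- k); exact: rtA_opp. Qed.

Lemma realA_exists i j k : i != j -> exists h, real g (rtA i j k) h.
Proof.
move=> ij.
have rn m : rtA i j k <> deA *~ m.
  move=> E; have := pA_rtA i i j k.
  by rewrite E eqxx (negPf ij) /pA !ffunMzE !ffunE subrr.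
have [||||[m E]|//] := @real_descent _ _ _ g A_diag_A deA XA spair_deA descent_A _ XA_refl XA_opp _ (rtA i j k).
- by move=> c [a [b [t ->]]]; exact: rtA_coherent.
- by move=> a m [b [d [t E]]]; exact: rtA_simple E.
- by exists i, j, k.
- by move=> E; apply: (rn 0); rewrite E mulr0z.
by case: (rn m).
Qed.

Lemma real_XA c h : real g c h -> exists i j k, i != j /\ c = rtA i j k.
Proof.
move=> R; have [i [j [k cE]]] : XA c.
  by elim: R => {c h} [i|i c h _]; [rewrite alAE; do 3 eexists | exact: XA_refl].
exists i, j, k; split=> //; apply/eqP => ij.
have := real_pair A_diag_A R; rewrite cE ij rtA_diag pairMz (pair_null spair_deA R) mulr0.
by move/esym/eqP; rewrite pnatr_eq0.
Qed.

Lemma isrootA c : isroot g c <->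
  (exists i j k, i != j /\ c = rtA i j k) \/ (exists2 k, k != 0 & c = deA *~ k).
Proof.
split=> [rc|].
  case: (isroot_kind A_diag_A A_off_A A_sym0_A spair_deA descent_A rc) => [[k cE]|[h R]]; last by left; exact: real_XA R.
  right; exists k => //; apply/eqP => k0; case: rc => cn _; apply: cn.
  by rewrite cE k0 mulr0z.
case=> [[i [j [k [ij ->]]]]|[k kn ->]].
  by have [h R] := realA_exists k ij; exact: (real_isroot A_diag_A A_off_A A_sym0_A R).
have ij : (ord0 : 'I_n) != ord_max by rewrite eq_ordE /= eq_sym -lt0n.
have [h R] := realA_exists 0 ij; have [h' R'] := realA_exists k ij.
have E : rtA ord0 ord_max k = rtA ord0 ord_max 0 + deA *~ k.
  by rewrite /rtA mulr0z addr0.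
rewrite E in R'; apply: (imaginary_isroot A_diag_A A_off_A A_sym0_A spair_deA kn _ R R').
by move=> /ffunP/(_ ord0); rewrite !ffunE.
Qed.

Lemma isroot_oppA c : isroot g c -> isroot g (- c).
Proof.
move=> /isrootA [[i [j [k [ij ->]]]]|[k kn ->]]; apply/isrootA; [left|right].
  by exists j, i, (- k); rewrite eq_sym rtA_opp.
by exists (- k); rewrite ?oppr_eq0 // mulrNz.
Qed.

(** As the Cartan matrix is symmetric, a real root and its coroot have the same coordinates.
    Additivity in [c] makes the value of a weight at a coroot affine in the level. *)
Definition corA (c : Q) : cartan g := \sum_i simple_coroot g i *~ c i.

Lemma corA_is_additive : zmod_morphism corA.
Proof. by move=> c d; rewrite /corA -sumrB; apply: eq_bigr => i _; rewrite !ffunE mulrzBr. Qed.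
HB.instance Definition _ := GRing.isZmodMorphism.Build Q (cartan g) corA corA_is_additive.

Lemma corA_al i : corA (al i) = simple_coroot g i.
Proof.
rewrite /corA (bigD1 i) //= ffunE eqxx mulr1z big1 ?addr0 // => j ji.
by rewrite ffunE eq_sym (negPf ji) mulr0z.
Qed.

Lemma pair_al_corA i c : pair g (al i) (corA c) = (spair A i c)%:~R.
Proof.
rewrite /pair raddf_sum /spair [RHS]raddf_sum; apply: eq_bigr => j _ /=.
rewrite raddfMz -[X in X *~ _]/(pair g _ _) pair_al_hi A_sym -mulrzr.
by rewrite [RHS]intrM.
Qed.

Lemma real_corA c h : real g c h -> h = corA c.
Proof.
elim=> {c h} [i|i c h _ ->]; first by rewrite corA_al.
by rewrite /reflc /refl raddfB raddfMz /= corA_al pair_al_corA scaler_int.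
Qed.

Lemma realA i j k : i != j -> real g (rtA i j k) (corA (rtA i j k)).
Proof. by move=> ij; have [h R] := realA_exists k ij; rewrite -(real_corA R). Qed.

Lemma pair_corA_rtA c i j k : pair g c (corA (rtA i j k)) = (pA i c - pA j c)%:~R.
Proof.
pose F (u : Q) := pair g c (corA u).
have FD u v : F (u + v) = F u + F v by rewrite /F raddfD pairDr.
have FN u : F (- u) = - F u by rewrite /F raddfN pairNr.
have Fal m : F (al m) = (pA m c - pA (ordS m) c)%:~R by rewrite /F corA_al pair_hi spairA.
(* The element attached to [deA] is the sum of all simple coroots, and the values telescope around
   the cycle. *)
have Fde : F deA = 0.
  have -> : deA = \sum_(m < n) al m.
    apply/ffunP => x; rewrite sum_ffunE (bigD1 x) //= !ffunE eqxx big1 ?addr0 // => m mx.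
    by rewrite ffunE (negPf mx).
  have -> : F (\sum_(m < n) al m) = \sum_(m < n) (pA m c - pA (ordS m) c)%:~R.
    rewrite /F raddf_sum /pair raddf_sum; apply: eq_bigr => m _; exact: Fal.
  rewrite -raddf_sum sumrB /= [X in _ - X](_ : _ = \sum_(m < n) pA m c) ?subrr //.
  by rewrite [RHS](reindex (@ordS n)) //; exists (@ord_pred n) => ? _; [exact: ordSK | exact: ord_predK].
have Fz t : F (deA *~ t) = 0.
  by rewrite /F raddfMz /= /pair raddfMz /= -/(pair g _ _) -/(F _) Fde mul0rz.
have Feps : F (epsA i) - F (epsA j) = (pA i c - pA j c)%:~R.
  have F0 m : F (epsA m) = (pA m c - pA ord0 c)%:~R.
    case: m => m; elim: m => [|m IH] mn.
      have -> : Ordinal mn = ord0 by exact: val_inj.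
      rewrite subrr; have -> : epsA ord0 = 0 by apply/ffunP => x; rewrite !ffunE ltn0 oppr0.
      by rewrite /F raddf0 /pair linear0.
    have mn' : (m < n)%N by exact: ltnW.
    have SE : ordS (Ordinal mn') = Ordinal mn.
      by apply/val_inj; rewrite /= modn_small.
    have := alAE (Ordinal mn'); rewrite SE (_ : (_ == ord0) = false) // /rtA mulr0z addr0.
    move=> E; have := Fal (Ordinal mn'); rewrite E FD FN IH SE => /eqP.
    move=> /eqP E'; rewrite -[LHS](subKr (pA (Ordinal mn') c - pA ord0 c)%:~R) E' -intrB.
    by congr (_%:~R); move: (pA _ c) (pA _ c) (pA _ c) => x y z; ring.
  by rewrite !F0 -intrB; congr (_%:~R); move: (pA _ c) (pA _ c) (pA _ c) => x y z; ring.
by rewrite -/(F _) /rtA FD FD FN Fz addr0.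
Qed.
End RootsA.

Lemma spanA c : c = \sum_i epsA i *~ pA i c + deA *~ c ord_max.
Proof.
apply/ffunP => x; rewrite ffunE ffunMzE ffunE intz sum_ffunE.
rewrite (eq_bigr (fun i : 'I_n => - (if (x < i)%N then pA i c else 0))); last first.
  move=> i _; rewrite ffunMzE ffunE; case: ltnP => _; last by rewrite oppr0 mul0rz.
  by rewrite mulNrz intz.
rewrite sumrN -big_mkcond /=.
have tele m : (m <= l - x)%N -> \sum_(i < n | (l - m < i)%N) pA i c = c ord_max - c (inord (l - m)).
  elim: m => [|m IH] mx.
    rewrite subn0 big1 => [|i]; last by have := ltn_ord i; lia.
    by rewrite (_ : inord l = ord_max) ?subrr //; apply/val_inj; rewrite /= inordK.
  have ml : (l - m < n)%N by lia.
  rewrite (bigD1 (Ordinal ml)) /=; last by lia.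
  rewrite (eq_bigl (fun i : 'I_n => (l - m < i)%N)); last first.
    by move=> i; rewrite eq_ordE /=; lia.
  rewrite IH; last by lia.
  rewrite /pA (_ : inord (l - m) = Ordinal ml); last by apply/val_inj; rewrite /= inordK.
  rewrite (_ : ord_pred (Ordinal ml) = inord (l - m.+1)).
    by move: (c _) (c _) (c _) => a b d; ring.
  apply/val_inj; rewrite /= inordK; last by lia.
  have := ord_pred_val (Ordinal ml); rewrite /= => ->.
  by case: eqP; lia.
have := tele (l - x)%N (leqnn _); rewrite subKn; last by have := ltn_ord x; lia.
rewrite inord_val => ->; move: (c _) (c _) => a b; ring.
Qed.

Lemma sum_pA c : \sum_i pA i c = 0.
Proof.
rewrite sumrB; apply/eqP; rewrite subr_eq0; apply/eqP.
by rewrite [LHS](reindex (@ord_pred n)) //; exists (@ordS n) => ? _; [exact: ord_predK | exact: ordSK].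
Qed.

Lemma rtA_last i j k : rtA i j k ord_max = k.
Proof. by rewrite rtAE /=; have := ltn_ord i; have := ltn_ord j; lia. Qed.
End TypeA.

(** * Stabilizers of supports *)

Ltac zmod_ring := apply/ffunP => ?; rewrite ?(ffunE, ffunMzE, ffunMnE) ?mulrzz; ring.

Section Support.
Variables (K : numFieldType) (I : finType).
Notation Q := {ffun I -> int}.
Variables (S N : Q -> Prop).
Variables (J : finType) (op : J -> J) (a : J -> Q) (pr : J -> {additive Q -> int}).
Variables (de : Q) (w : J -> K) (lev : K).

(** From here on the module enters only through its support [S] and the set [N] of locally nilpotent
    roots, by [S1] and [S2]. [J] indexes root directions modulo delta: ordered pairs of indices for
    A_l^(1), a sign for the short roots of A_2^(2). [jval] is the value of mu + c at the coroot of
    [rt j k]. *)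
Definition rt j (k : int) := a j + de *~ k.
Definition jval j (k : int) (c : Q) : K := w j + lev * k%:~R + (pr j c)%:~R.
Definition St q := forall c, S c -> S (c + q).

Hypothesis a_op : forall j, a (op j) = - a j.
Hypothesis w_op : forall j, w (op j) = - w j.
Hypothesis pr_op : forall j c, pr (op j) c = - pr j c.
Hypothesis pr_a : forall j, pr j (a j) = 2.
Hypothesis pr_de : forall j, pr j de = 0.
Hypothesis a_gen : forall P : Q -> Prop, P 0 -> (forall q j, P q -> P (q + a j)) ->
  (forall q, P q -> P (q + de)) -> (forall q, P q -> P (q - de)) -> forall q, P q.
Variable j0 : J.
Hypothesis S1 : forall j k, ~ N (rt j k) -> St (rt j k).
Hypothesis S2 : forall j k c, N (rt j k) -> N (- rt j k) -> S c ->
  exists m : int, jval j k c = m%:~R /\ forall t : nat, t%:Z <= m -> S (c - rt j k *+ t).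
Hypothesis Sn0 : ~ S 0.
Hypothesis Sex : exists c, S c.

Lemma rt_op j k : rt (op j) (- k) = - rt j k.
Proof. by rewrite /rt a_op mulrNz opprD. Qed.

Lemma val_op j k c : jval (op j) (- k) c = - jval j k c.
Proof. by rewrite /jval w_op pr_op !mulrNz mulrN !opprD. Qed.

Lemma pr_rt j k : pr j (rt j k) = 2.
Proof. by rewrite /rt raddfD raddfMz /= pr_a pr_de mul0rz addr0. Qed.

Lemma valB j k c m : jval j k (c - rt j k *~ m) = jval j k c - (2 * m)%:~R.
Proof.
rewrite /jval (raddfB (pr j)) (raddfMz (pr j)) pr_rt mulrzz rmorphB /= addrA //.
Qed.

Lemma St0 : St 0. Proof. by move=> c; rewrite addr0. Qed.
Lemma StD q q' : St q -> St q' -> St (q + q').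
Proof. by move=> Sq Sq' c Sc; rewrite addrA; exact/Sq'/Sq. Qed.
Lemma StMn q t : St q -> St (q *+ t).
Proof. by move=> Sq; elim: t => [|t IH]; [exact: St0 | rewrite mulrS; exact: StD]. Qed.

Definition sym j k := N (rt j k) /\ N (- rt j k).

Lemma sym_op j k : sym j k -> sym (op j) (- k).
Proof. by move=> [n1 n2]; split; rewrite rt_op ?opprK. Qed.

Lemma nSt_N j k : ~ St (rt j k) -> N (rt j k).
Proof. by move=> nS; apply: contrapT => /S1. Qed.

Lemma S_refl j k c : sym j k -> S c -> exists m : int,
  jval j k c = m%:~R /\ S (c - rt j k *~ m).
Proof.
move=> sy Sc; have [m [vm str]] := S2 sy.1 sy.2 Sc; exists m; split=> //.
have [m0|m0] := leP 0 m; first by case: m m0 vm str => // m _ _; rewrite -pmulrn; exact.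
(* For negative [m] the reflected point lies on the string of the opposite root. *)
have [n1 n2] := sym_op sy; have [m' [vm' str']] := S2 n1 n2 Sc.
have mE : m' = - m.
  by apply: (@intr_inj K); rewrite -vm' val_op vm mulrNz.
have -> : c - rt j k *~ m = c - rt (op j) (- k) *+ absz m.
  rewrite rt_op mulNrn opprK; congr (_ + _).
  by rewrite pmulrn -mulrNz; congr (_ *~ _); lia.
by apply: str'; rewrite mE; lia.
Qed.

(** Conjugate the translation by [q] with the reflection of [S]. The integer [m] depends on [c] but
    cancels between the two reflections. *)
Lemma St_refl j k q : sym j k -> St q -> St (q - rt j k *~ pr j q).
Proof.
move=> sy Sq c Sc; have [m [vm Sm]] := S_refl sy Sc.
have [m' [vm' Sm']] := S_refl sy (Sq _ Sm).
suff mE : m' = pr j q - m.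
  have <- : c - rt j k *~ m + q - rt j k *~ m' = c + (q - rt j k *~ pr j q) by rewrite mE; zmod_ring.
  by [].
apply: (@intr_inj K); rewrite -vm'.
have -> : jval j k (c - rt j k *~ m + q) = jval j k (c - rt j k *~ m) + (pr j q)%:~R.
  by rewrite /jval (raddfD (pr j)) rmorphD /= !addrA.
by rewrite valB vm -!intrB -intrD; congr (_%:~R); ring.
Qed.

(** Two parallel reflections compose to a translation of the affine Weyl group. *)
Lemma St_shift j k l q : sym j k -> sym j l -> St q -> St (q + de *~ ((k - l) * pr j q)).
Proof.
move=> sk sl Sq; have := St_refl sk (St_refl sl Sq).
rewrite (raddfB (pr j)) (raddfMz (pr j)) pr_rt mulrzz.
set x := pr j q; rewrite (_ : x - 2 * x = - x); last by ring.
have -> : q - rt j l *~ x - rt j k *~ - x = q + de *~ ((k - l) * x) by rewrite /rt; zmod_ring.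
by [].
Qed.

(** The multiples [d] can be reduced to 1, so that every real root, hence also [de] and [- de],
    translates [S] into itself; then [S] reaches 0. *)
Lemma St_dense :
  (forall j k, exists d : nat, [/\ (0 < d)%N, St (rt j k *+ d) & St (- (rt j k *+ d))]) -> False.
Proof.
move=> H.
have all j k : St (rt j k).
  have [d [d0 Sd Sd']] := H j k.
  have [//|nSt] := pselect (St (rt j k)).
  have n1 := nSt_N nSt.
  have [n2|n2] := pselect (N (- rt j k)); last first.
    have := S1 (j := op j) (k := - k); rewrite rt_op => /(_ n2) Sm.
    have := StD Sd (StMn d.-1 Sm); rewrite mulNrn -{1}(prednK d0) mulrSr.
    by rewrite addrAC subrr add0r.
  move=> c Sc; have [n1' n2'] := sym_op (conj n1 n2).
  have [m [vm _]] := S2 n1' n2' Sc.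
  (* After [d * t] steps back the string value has grown by [2 * d * t] and is positive: one step
     forward is possible, and [t] translations by [rt j k *+ d] lead back to [c + rt j k]. *)
  pose t := (absz m).+1.
  have Sc' : S (c - rt j k *+ (d * t)).
    by rewrite mulrnA -mulNrn; exact: (StMn t Sd').
  have [m' [vm' str']] := S2 n1' n2' Sc'.
  have m'E : m' = m + 2 * (d * t)%:Z.
    apply: (@intr_inj K); rewrite -vm' intrD -vm.
    have -> : c - rt j k *+ (d * t) = c - rt (op j) (- k) *~ - (d * t)%:Z.
      by rewrite rt_op pmulrn; zmod_ring.
    by rewrite valB mulrN mulrNz opprK.
  have := StMn t Sd (str' 1%N _); rewrite m'E mulr1n rt_op opprK.
  have -> : c - rt j k *+ (d * t) + rt j k + rt j k *+ d *+ t = c + rt j k.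
    by rewrite -mulrnA; zmod_ring.
  by apply; nia.
have Sde : St de /\ St (- de).
  have E k : de *~ k = rt j0 k + rt (op j0) 0 by rewrite /rt a_op; zmod_ring.
  have := StD (all j0 1) (all (op j0) 0); have := StD (all j0 (-1)) (all (op j0) 0).
  by rewrite -!E mulr1z mulrNz mulr1z.
have [c Sc] := Sex; have [Sd Sd'] := Sde.
have : forall q, S (c + q).
  apply: a_gen => [|q j Sq|q Sq|q Sq]; rewrite ?addr0 // addrA; [|exact: Sd|exact: Sd'].
  by have := all j 0 _ Sq; rewrite /rt mulr0z addr0.
by move/(_ (- c)); rewrite subrr.
Qed.

(** Every lattice vector enters [St] after adding a large multiple of [de]. Were [c + q] minus such
    a multiple in [S], the element of [St] with the opposite sum would lead to 0. *)
Lemma far_injective (k0 : nat) :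
  (forall j (k : nat), (k0 <= k)%N -> St (rt j k)) ->
  forall c q, exists M : nat, forall k : nat, (M <= k)%N -> ~ S (c + q + (- de) *+ k).
Proof.
move=> H.
have main : forall q, exists M : nat, forall k : nat, (M <= k)%N -> St (q + de *+ k).
  apply: a_gen => [|q j [M HM]|q [M HM]|q [M HM]].
  - exists (k0 + k0)%N => k kk.
    have := StD (H j0 k0 (leqnn _)) (H (op j0) (k - k0)%N _).
    have -> : rt j0 k0 + rt (op j0) (k - k0)%N = 0 + de *+ k.
      by rewrite /rt a_op -!pmulrn -{2}(subnKC (leq_trans (leq_addr _ _) kk)) mulrnDr; zmod_ring.
    by apply; lia.
  - exists (M + k0)%N => k kk; have := StD (HM (k - k0)%N _) (H j k0 (leqnn _)).
    have -> : q + de *+ (k - k0) + rt j k0 = q + a j + de *+ k.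
      have kk' : (k0 <= k)%N by lia.
      by rewrite /rt -pmulrn -{2}(subnKC kk') mulrnDr; zmod_ring.
    by apply; lia.
  - exists M => k kk; have -> : q + de + de *+ k = q + de *+ k.+1 by rewrite mulrS addrA.
    by apply: HM; lia.
  - exists M.+1 => -[//|k] kk; have -> : q - de + de *+ k.+1 = q + de *+ k.
      by rewrite mulrS addrA subrK.
    exact: HM.
move=> c q; have [M HM] := main (- (c + q)); exists M => k kM Sc.
apply: Sn0; have := HM k kM _ Sc.
by have -> : c + q + - de *+ k + (- (c + q) + de *+ k) = 0 by rewrite mulNrn; zmod_ring.
Qed.

(** Dual to [far_injective]: here the complement of [S] is propagated, starting from 0. The bound
    [k1] must not depend on [t], because the induction is about a whole ray. *)
Lemma far_strings :
  (forall q j, exists k1 : nat, forall k : nat, (k1 <= k)%N -> forall t : nat,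
     ~ S (q + de *+ t) -> ~ S (q + de *+ t + rt j k)) ->
  forall c q, exists M : nat, forall k : nat, (M <= k)%N -> ~ S (c + q + de *+ k).
Proof.
move=> H.
have main : forall q, exists M : nat, forall k : nat, (M <= k)%N -> ~ S (q + de *+ k).
  apply: a_gen => [|q j [M HM]|q [M HM]|q [M HM]].
  - have [k1 H1] := H 0 j0; have [k2 H2] := H (a j0) (op j0).
    exists (k1 + k2)%N => k kk.
    have := H2 (k - k1)%N _ k1; rewrite -{1}[a j0]add0r.
    have -> : 0 + a j0 + de *+ k1 = 0 + de *+ 0 + rt j0 k1.
      by rewrite /rt -pmulrn mulr0n; zmod_ring.
    have -> : a j0 + de *+ k1 + rt (op j0) (k - k1)%N = 0 + de *+ k.
      have kk' : (k1 <= k)%N by lia.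
      by rewrite /rt a_op -pmulrn -{2}(subnKC kk') mulrnDr; zmod_ring.
    by apply; [lia | apply: H1 => //; rewrite mulr0n addr0].
  - have [k1 H1] := H q j; exists (M + k1)%N => k kk.
    have := H1 (k - M)%N _ M (HM M (leqnn _)).
    have -> : q + de *+ M + rt j (k - M)%N = q + a j + de *+ k.
      have kk' : (M <= k)%N by lia.
      by rewrite /rt -pmulrn -{2}(subnKC kk') mulrnDr; zmod_ring.
    by apply; lia.
  - exists M => k kk; have -> : q + de + de *+ k = q + de *+ k.+1 by rewrite mulrS addrA.
    by apply: HM; lia.
  - exists M.+1 => -[//|k] kk; have -> : q - de + de *+ k.+1 = q + de *+ k.
      by rewrite mulrS addrA subrK.
    exact: HM.
by move=> c q; exact: main.
Qed.

(* Positive level: translating by a_j + k delta with k large leaves the support. *)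
Lemma far_integrable (la : int) : lev = la%:~R -> 0 < la ->
  (forall j k, sym j k) ->
  forall c q, exists M : nat, forall k : nat, (M <= k)%N -> ~ S (c + q + de *+ k).
Proof.
move=> levE la0 allsym; apply: far_strings => q j.
have [c0 Sc0] := Sex.
have [m0 [vm0 _]] := S2 (allsym j 0).1 (allsym j 0).2 Sc0.
(* The integral value at [c0] shows that [w j] is an integer. *)
have valE k c : jval j k c = (m0 + la * k + pr j c - pr j c0)%:~R.
  have w0 : w j = m0%:~R - (pr j c0)%:~R by rewrite -vm0 /jval mulr0 addr0 addrK.
  by rewrite /jval w0 levE rmorphB /= 2!rmorphD /= intrM; ring.
(* For such [k] the string value at the translated point is at least 1, whatever [t] is, so a step
   back to [q + de *+ t] would stay in [S]. *)
exists (absz (m0 + pr j q - pr j c0)%R).+1 => k kk t nS Sq; apply: nS.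
have [m [vm str]] := S2 (allsym j k).1 (allsym j k).2 Sq.
have mE : m = m0 + la * k + (pr j q + 2) - pr j c0.
  apply: (@intr_inj K); rewrite -vm valE; congr (_%:~R).
  by rewrite (raddfD (pr j)) (raddfD (pr j)) pr_rt (raddfMn (pr j)) pr_de mul0rn addr0.
have := str 1%N; rewrite mulr1n addrK; apply; rewrite mE.
by move: (pr j q) (pr j c0) kk => x y kk; nia.
Qed.

Hypothesis op_ex : forall j, exists k, St (rt j k).

(** [rt j k *+ d] differs from [d] times a member of [St] in the same direction by a multiple of
    [de *+ d]. *)
Lemma St_multiple (d : nat) j k : St (de *+ d) -> St (- (de *+ d)) -> St (rt j k *+ d).
Proof.
move=> Sd Sd'; have [q Sq] := op_ex j.
have E : rt j k *+ d = rt j q *+ d + (de *+ d) *~ (k - q).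
  by rewrite /rt; zmod_ring.
rewrite E; apply: StD; first exact: StMn.
case: (k - q) => t; first by rewrite -pmulrn; exact: StMn.
by rewrite NegzE mulrNz -pmulrn -mulNrn; exact: StMn.
Qed.

Lemma St_null_mixed (k l : nat) : (0 < k)%N -> (0 < l)%N -> St (de *+ k) -> St (- (de *+ l)) -> False.
Proof.
move=> k0 l0 Sk Sl; apply: St_dense => j q; exists (k * l)%N.
have S1' : St (de *+ (k * l)) by rewrite mulrnA; exact: StMn.
have S2' : St (- (de *+ (k * l))) by rewrite mulnC mulrnA -mulNrn; exact: StMn.
split; [by rewrite muln_gt0 k0 | exact: St_multiple|].
have := @St_multiple (k * l) (op j) (- q) S1' S2'.
by rewrite rt_op mulNrn.
Qed.

Hypothesis de_nonneg : forall k : int, St (de *~ k) -> 0 <= k.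

Lemma St_rt_le j k q : St (rt j k) -> St (rt (op j) q) -> 0 <= k + q.
Proof.
move=> Sk Sq; apply: de_nonneg; have := StD Sk Sq.
by have -> : rt j k + rt (op j) q = de *~ (k + q) by rewrite /rt a_op; zmod_ring.
Qed.

(** Two such levels would translate a member of [St] in direction [j] arbitrarily far down; added to
    a member in the opposite direction it gives a negative multiple of [de]. *)
Lemma sym_unique j k l : sym j k -> sym j l -> k = l.
Proof.
move=> sk sl; apply/eqP; apply: contrapT => /negP kl.
have [q Sq] := op_ex j; have [q' Sq'] := op_ex (op j).
have key x y (t : nat) : sym j x -> sym j y -> St (rt j (q + t%:Z * ((x - y) * 2))).
  move=> sx sy; elim: t => [|t IH]; first by rewrite mul0r addr0.
  have := St_shift sx sy IH; rewrite pr_rt.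
  have -> // : rt j (q + t%:Z * ((x - y) * 2)) + de *~ ((x - y) * 2) = rt j (q + t.+1%:Z * ((x - y) * 2)).
  rewrite /rt -addrA -mulrzDr_tmp -addrA; congr (_ + _ *~ (_ + _)).
  by rewrite intS; ring.
pose t := (absz (q + q')%R).+1.
have := St_rt_le (key k l t sk sl) Sq'; have := St_rt_le (key l k t sl sk) Sq'.
by move: kl; rewrite /t; nia.
Qed.

(** High in direction [j] the negative of a root is not in [St], hence is locally nilpotent. The
    root itself is then in [St], except at the at most one level allowed by [sym_unique]. *)
Lemma far_nonneg :
  forall c q, exists M : nat, forall k : nat, (M <= k)%N -> ~ S (c + q + (- de) *+ k).
Proof.
have H j : exists k0 : nat, forall k : nat, (k0 <= k)%N -> St (rt j k).
  have [q Sq] := op_ex j.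
  have nS k : (q < k) -> N (- rt j k).
    move=> qk; rewrite -rt_op; apply: nSt_N => Sk; have := St_rt_le Sq Sk; lia.
  have [[k1 sk1]|nsym] := pselect (exists k, sym j k).
    exists ((absz q).+1 + (absz k1).+1)%N => k kk.
    apply: contrapT => nSt; have sk : sym j k by split; [exact: nSt_N | apply: nS; lia].
    by have := sym_unique sk sk1; lia.
  exists (absz q).+1 => k kk; apply: contrapT => nSt; apply: nsym; exists k.
  by split; [exact: nSt_N | apply: nS; lia].
have [k0 Hk] := choice H.
apply: (@far_injective (\max_j k0 j)) => j k kk; apply: Hk.
exact: leq_trans (leq_bigmax j) kk.
Qed.

End Support.

Lemma closed_mulrz (M : zmodType) (P : M -> Prop) (b : M) :
  (forall q, P q -> P (q + b)) -> (forall q, P q -> P (q - b)) ->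
  forall m q, P q -> P (q + b *~ m).
Proof.
move=> Pb Pb' [] m q Pq; last first.
  rewrite NegzE mulrNz -pmulrn; elim: m.+1 => [|t IH]; first by rewrite subr0.
  by rewrite mulrSr opprD addrA; exact: Pb'.
rewrite -pmulrn; elim: m => [|t IH]; first by rewrite addr0.
by rewrite mulrSr addrA; exact: Pb.
Qed.

Lemma int_min (P : int -> Prop) b : (exists k, P k) -> (forall k, P k -> b <= k) ->
  exists2 k, P k & forall k', P k' -> k <= k'.
Proof.
move=> [k Pk] low; have ex : exists m : nat, `[< P (b + m%:Z) >].
  exists (absz (k - b)); apply/asboolP; rewrite (_ : b + _ = k) //.
  by have := low _ Pk; lia.
case: (ex_minnP ex) => m /asboolP Pm mmin; exists (b + m%:Z) => // k' Pk'.
have := low _ Pk' => bk'.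
have := mmin (absz (k' - b)); rewrite (_ : b + _ = k'); last by lia.
by move=> /(_ (asboolT Pk')); lia.
Qed.

(** Differences of [u] need not be integers. Measuring each value from a chosen representative of
    its class modulo the integers gives a potential that is correct wherever a string exists. *)
Lemma integral_lift (K : numFieldType) (T : finType) (u : T -> K) :
  exists th : T -> int, forall i j (m : int), u i - u j = m%:~R -> th i - th j = m.
Proof.
pose R i j := `[< exists m : int, u i - u j = m%:~R >].
have Rref i : R i i by apply/asboolP; exists 0; rewrite subrr.
have Rsym i j : R i j -> R j i.
  by move=> /asboolP[m E]; apply/asboolP; exists (- m); rewrite mulrNz -E opprB.
have Rtr i j k : R i j -> R j k -> R i k.
  move=> /asboolP[m E] /asboolP[m' E']; apply/asboolP; exists (m + m').
  by rewrite intrD -E -E' addrA subrK.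
pose rep i := odflt i [pick j | R i j].
have repR i : R i (rep i) by rewrite /rep; case: pickP => [//|/(_ i)]; rewrite Rref.
have repE i j : R i j -> rep i = rep j.
  move=> Rij; have E : R i =1 R j.
    by move=> k; apply/idP/idP; [exact/Rtr/Rsym | exact: Rtr].
  rewrite /rep (eq_pick E); case: pickP => // /(_ j).
  by rewrite Rref.
have /choice[th thE] : forall i, exists m : int, u i - u (rep i) = m%:~R.
  by move=> i; apply/asboolP; exact: repR.
exists th => i j m E; apply: (@intr_inj K); rewrite intrB -!thE -E.
rewrite (repE i j); first by rewrite opprB addrA subrK.
by apply/asboolP; exists m.
Qed.

(** * Type A_l^(1) *)

Section Transfer.
Variables (I T : finType).
Notation Q := {ffun I -> int}.
Variables (eps : T -> Q) (p : T -> {additive Q -> int}) (de : Q) (d : {additive Q -> int}).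
Definition rte i j k : Q := eps i - eps j + de *~ k.
Notation r := rte.
Hypothesis p_r : forall m i j k, p m (r i j k) = (m == i)%:Z - (m == j)%:Z.
Hypothesis d_r : forall i j k, d (r i j k) = k.
Hypothesis span : forall c, c = \sum_i eps i *~ p i c + de *~ d c.
Hypothesis sum_p : forall c, \sum_i p i c = 0.

Variables (S : Q -> Prop) (rk : T -> nat) (b0 i1 : T) (th : T -> int).
Hypothesis b0_min : forall i, (rk b0 <= rk i)%N.
Hypothesis i1_gt : (rk b0 < rk i1)%N.

Definition bsum t c : int := \sum_(i | rk i == t) p i c.

Hypothesis flatten : forall c i j, S c -> rk i = rk j -> i != j ->
  p j c + th j < p i c + th i -> exists k, S (c - r i j k).
Hypothesis flow : forall c i j k, S c -> (rk b0 < rk i)%N -> rk j = rk b0 ->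
  0 < p j c -> p i c < 0 -> S (c + r i j k).
Hypothesis lower : forall c t, S c -> (rk b0 < t)%N -> (exists i, rk i = t) ->
  exists c', [/\ S c', bsum t c' = bsum t c - 1 &
    forall t', t' <> t -> t' <> rk b0 -> bsum t' c' = bsum t' c].

Lemma bsumD t c c' : bsum t (c + c') = bsum t c + bsum t c'.
Proof. by rewrite /bsum -big_split; apply: eq_bigr => i _; rewrite raddfD. Qed.
Lemma bsumN t c : bsum t (- c) = - bsum t c.
Proof. by rewrite /bsum -sumrN; apply: eq_bigr => i _; rewrite raddfN. Qed.

Lemma bsum_r t i j k : bsum t (r i j k) = (rk i == t)%:Z - (rk j == t)%:Z.
Proof.
have E x : \sum_(m | rk m == t) (m == x)%:Z = (rk x == t)%:Z.
  case: eqP => [xt|xt]; last first.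
    by rewrite big1 // => m /eqP mt; case: eqP => // mx; case: xt; rewrite -mx.
  by rewrite (bigD1 x) /= ?xt // eqxx big1 ?addr0 // => m /andP[_ /negPf ->].
by rewrite /bsum; under eq_bigr do rewrite p_r; rewrite sumrB !E.
Qed.

Definition spread : nat := (\sum_i \sum_j absz (th i - th j)%R)%N.

Lemma spread_ge (P : pred T) i : `|\sum_(j | P j) (th i - th j)| <= spread%:Z.
Proof.
apply: le_trans (ler_norm_sum _ _ _) _.
have -> : \sum_(j | P j) `|th i - th j| = (\sum_(j | P j) absz (th i - th j)%R)%N%:Z.
  by rewrite (big_morph _ PoszD (erefl _)); apply: eq_bigr => j _; lia.
rewrite lez_nat /spread [leqRHS](bigD1 i) //=; apply: leq_trans _ (leq_addr _ _).
by rewrite [leqRHS](bigID P) /= leq_addr.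
Qed.

Definition low c := forall i, (rk b0 < rk i)%N -> bsum (rk i) c <= - (spread.+1)%:Z.

Lemma lower_iter c t m : S c -> (rk b0 < t)%N -> (exists i, rk i = t) ->
  exists c', [/\ S c', bsum t c' = bsum t c - m%:Z &
    forall t', t' <> t -> t' <> rk b0 -> bsum t' c' = bsum t' c].
Proof.
move=> Sc t0 tex; elim: m => [|m [c1 [S1 b1 o1]]]; first by exists c; rewrite subr0.
have [c2 [S2 b2 o2]] := lower S1 t0 tex; exists c2; split=> //.
  by rewrite b2 b1; lia.
by move=> t' tt tb; rewrite o2 // o1.
Qed.

Lemma low_exists : (exists c, S c) -> exists2 c, S c & low c.
Proof.
move=> [c Sc].
suff [c' Sc' lc'] : exists2 c', S c' & forall i, i \in enum T -> (rk b0 < rk i)%N ->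
    bsum (rk i) c' <= - (spread.+1)%:Z.
  by exists c' => // i; apply: lc'; rewrite mem_enum.
elim: (enum T) => [|i s [c1 Sc1 l1]]; first by exists c.
have [i0|i0] := leqP (rk i) (rk b0).
  exists c1 => // j; rewrite inE => /predU1P[->|]; [by rewrite ltnNge i0 | exact: l1].
have [c2 [Sc2 b2 o2]] := lower_iter (absz (bsum (rk i) c1 + spread.+1%:Z)%R) Sc1 i0 (ex_intro _ i erefl).
have le2 : bsum (rk i) c2 <= - (spread.+1)%:Z by rewrite b2; lia.
exists c2 => // j; have [ji|ji] := eqVneq (rk j) (rk i); first by rewrite ji.
rewrite inE => /predU1P[E|js j0]; first by rewrite E eqxx in ji.
by rewrite o2; [exact: l1 | exact/eqP | move=> E; rewrite E ltnn in j0].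
Qed.

Definition admissible c := (forall i, (rk b0 < rk i)%N -> p i c <= 0) /\
  (forall j, rk j = rk b0 -> 0 <= p j c).

Let above i : rk i != rk b0 -> (rk b0 < rk i)%N.
Proof. by move=> ib; rewrite ltn_neqAle eq_sym ib b0_min. Qed.

Lemma sum_above c : \sum_(i | rk i != rk b0) p i c = - bsum (rk b0) c.
Proof.
have := sum_p c; rewrite (bigID (fun i => rk i == rk b0)) /= => /eqP.
by rewrite addrC addr_eq0 => /eqP.
Qed.

Lemma flow_pick c : admissible c -> 0 < bsum (rk b0) c ->
  exists i j, [/\ (rk b0 < rk i)%N, rk j = rk b0, 0 < p j c & p i c < 0].
Proof.
move=> [cn cp] bc.
have [j jb jp] : exists2 j, rk j = rk b0 & 0 < p j c.
  apply: contrapT => nj; have : bsum (rk b0) c <= 0; last by rewrite leNgt bc.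
  apply: sumr_le0 => j /eqP jb; rewrite leNgt; apply/negP => jp.
  by apply: nj; exists j.
have [i ib ip] : exists2 i, (rk b0 < rk i)%N & p i c < 0.
  apply: contrapT => ni; have : 0 <= - bsum (rk b0) c; last by rewrite oppr_ge0 leNgt bc.
  rewrite -sum_above; apply: sumr_ge0 => i ib; rewrite leNgt; apply/negP => ip.
  by apply: ni; exists i => //; exact: above.
by exists i, j.
Qed.

Lemma admissible_flow c i j k : (rk b0 < rk i)%N -> rk j = rk b0 ->
  0 < p j c -> p i c < 0 -> admissible c -> admissible (c + r i j k).
Proof.
move=> ib jb jp ip [cn cp]; split=> x xb; rewrite (raddfD (p x)) p_r /=.
  have xj : x != j by apply/eqP => E; move: xb; rewrite E jb ltnn.
  by have := cn x xb; rewrite (negPf xj); have [->|_] := eqVneq x i; move: ip; lia.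
have xi : x != i by apply/eqP => E; move: ib; rewrite -E xb ltnn.
by have := cp x xb; rewrite (negPf xi); have [->|_] := eqVneq x j; move: jp; lia.
Qed.

Lemma admissible_eq0 c : admissible c -> bsum (rk b0) c = 0 -> forall x, p x c = 0.
Proof.
move=> [cn cp] bc x; have [xb|xb] := eqVneq (rk x) (rk b0).
  have /eqP := bc; rewrite psumr_eq0 => [|y /eqP]; last exact: cp.
  by move=> /allP/(_ x (mem_index_enum x)); rewrite xb eqxx => /eqP.
have /eqP : \sum_(y | rk y != rk b0) - p y c = 0 by rewrite sumrN sum_above opprK bc.
rewrite psumr_eq0 => [|y yb]; last by rewrite oppr_ge0; exact/cn/above.
by move=> /allP/(_ x (mem_index_enum x)); rewrite xb /= oppr_eq0 => /eqP.
Qed.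

(** Each move along a root carries one unit between the bottom block and the others without breaking
    the signs, until all coordinates vanish. *)
Lemma flow_end m c : S c -> admissible c -> bsum (rk b0) c = m.+1%:Z -> S 0.
Proof.
elim: m c => [|m IH] c Sc adm bc.
all: have [|i [j [ib jb jp ip]]] := flow_pick adm; first by rewrite bc.
(* The last move may use any multiple of [de]; this one cancels the remaining delta-coordinate. *)
- have := flow (- d c) Sc ib jb jp ip; set c' := c + _ => Sc'.
  have adm' : admissible c' by exact: admissible_flow.
  have bc' : bsum (rk b0) c' = 0 by rewrite bsumD bc bsum_r jb eqxx (gtn_eqF ib).
  suff -> : 0 = c' by [].
  rewrite [c']span big1 => [|x _]; last by rewrite admissible_eq0 // mulr0z.
  by rewrite (raddfD d) d_r subrr mulr0z addr0.
- apply: (IH (c + r i j 0)); [exact: flow | exact: admissible_flow|].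
  by rewrite bsumD bc bsum_r jb eqxx (gtn_eqF ib); lia.
Qed.

(** Within a block the coordinates are, up to 1, a constant minus [th]. One positive coordinate
    would therefore bound the block sum below by [- spread], against [low]. The bottom block has sum
    above [spread] and is treated dually. *)
Lemma low_admissible c : low c ->
  (forall i j, rk i = rk j -> p i c + th i <= p j c + th j + 1) ->
  admissible c /\ 0 < bsum (rk b0) c.
Proof.
move=> lc flat.
have cn i : (rk b0 < rk i)%N -> p i c <= 0.
  move=> ib; rewrite leNgt; apply/negP => ip; have := lc i ib.
  have : \sum_(j | rk j == rk i) (th i - th j) <= bsum (rk i) c.
    by apply: ler_sum => j /eqP ji; have := flat i j (esym ji); move: ip; lia.
  by have := spread_ge (fun j => rk j == rk i) i; lia.
have bp : spread%:Z < bsum (rk b0) c.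
  have := sum_p c; rewrite (bigID (fun i => rk i == rk b0)) /= -/(bsum _ _).
  rewrite (bigID (fun i => rk i == rk i1)) /=.
  rewrite (eq_bigl (fun i => rk i == rk i1)); last first.
    by move=> i; have [->|_] := eqVneq (rk i) (rk i1); rewrite ?andbF // gtn_eqF.
  rewrite -/(bsum (rk i1) c) => E; have := lc i1 i1_gt.
  have : \sum_(i | (rk i != rk b0) && (rk i != rk i1)) p i c <= 0.
    apply: sumr_le0 => i /andP[ib _]; apply: cn.
    by rewrite ltn_neqAle eq_sym ib b0_min.
  by move: E; move: (\sum_(i | _) _) => x; lia.
split; last by move: bp; lia.
split=> // j jb; rewrite leNgt; apply/negP => jp.
have : bsum (rk b0) c <= \sum_(i | rk i == rk b0) (th j - th i).
  by apply: ler_sum => i /eqP ib; have := flat i j (etrans ib (esym jb)); move: jp; lia.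
by have := spread_ge (fun i => rk i == rk b0) j; move: bp; lia.
Qed.

(* Lower all blocks but the bottom one far below 0, make the coordinates nearly
   constant within each block, then move the excess of the bottom block back. *)
Lemma transfer : (exists c, S c) -> S 0.
Proof.
move=> /low_exists[c Sc lc].
(* The sum of squares drops when a unit moves from a value to one smaller by at least 2; this gap is
   why values are levelled only up to 1. *)
pose meas c : nat := (\sum_i absz ((p i c + th i) * (p i c + th i))%R)%N.
have [m] := ubnP (meas c); elim: m c Sc lc => // m IH c Sc lc lt.
have [[i [j [ij ji]]]|nex] := pselect (exists i j, rk i = rk j /\ p j c + th j + 2 <= p i c + th i).
  have nij : i != j by apply/eqP => E; move: ji; rewrite E; lia.
  have [|k Sk] := flatten Sc ij nij; first by move: ji; lia.
  apply: (IH _ Sk).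
    by move=> x xb; rewrite bsumD bsumN bsum_r ij subrr subr0; exact: lc.
  rewrite ltnS in lt; apply: leq_trans lt.
  rewrite /meas (bigD1 i) // (bigD1 j) /=; last by rewrite eq_sym.
  rewrite [X in (_ < X)%N](bigD1 i) // [X in (_ < _ + X)%N](bigD1 j) /=; last by rewrite eq_sym.
  rewrite !addnA; set s := (X in (_ + X < _)%N); set s' := (X in (_ < _ + X)%N).
  have -> : s = s'.
    apply: eq_bigr => x /andP[xi xj].
    by rewrite (raddfB (p x)) p_r (negPf xi) (negPf xj) !subr0.
  rewrite ltn_add2r !raddfB /= !p_r !eqxx (negPf nij) eq_sym (negPf nij).
  have sq (x : int) : (absz (x * x)%R)%:Z = x * x by rewrite abszE ger0_norm // -expr2 sqr_ge0.
  rewrite -ltz_nat !PoszD !sq /=.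
  move: (p i c) (p j c) ji => x y; move: (th i) (th j) => a b; nia.
have flat i j : rk i = rk j -> p i c + th i <= p j c + th j + 1.
  move=> ij; rewrite leNgt; apply/negP => lt'; apply: nex; exists i, j; split=> //.
  by move: lt'; lia.
have [adm bp] := low_admissible lc flat.
by apply: (@flow_end (absz (bsum (rk b0) c)).-1 c Sc adm); lia.
Qed.
End Transfer.

Section CombinatoricsA.
Variables (K : numFieldType) (I T : finType).
Notation Q := {ffun I -> int}.
Variables (eps : T -> Q) (p : T -> {additive Q -> int}) (de : Q) (d : {additive Q -> int}).
Notation r := (rte eps de).
Hypothesis p_r : forall m i j k, p m (r i j k) = (m == i)%:Z - (m == j)%:Z.
Hypothesis d_r : forall i j k, d (r i j k) = k.
Hypothesis span : forall c, c = \sum_i eps i *~ p i c + de *~ d c.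
Hypothesis sum_p : forall c, \sum_i p i c = 0.
Variables (t0 t1 : T).
Hypothesis t01 : t0 != t1.

Variables (S N : Q -> Prop) (u : T -> K) (lev : K).
Notation St := (St S).
Hypothesis S1 : forall i j k, i != j -> ~ N (r i j k) -> St (r i j k).
Hypothesis S2 : forall i j k c, i != j -> N (r i j k) -> N (- r i j k) -> S c ->
  exists m : int, (u i - u j) + lev * k%:~R + (p i c - p j c)%:~R = m%:~R /\
    forall t : nat, t%:Z <= m -> S (c - r i j k *+ t).
Hypothesis Sn0 : ~ S 0.
Hypothesis Sex : exists c, S c.

Variable goal : Prop.
Hypothesis goal_support : forall phi : {additive Q -> int}, phi de = 0 ->
  (exists i j, i != j /\ phi (r i j 0) <> 0) -> forall c, S c ->
  (forall i j k, i != j -> 0 < phi (r i j k) -> ~ S (c + r i j k)) -> goal.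
Hypothesis goal_far : forall (phi : {additive Q -> int}) de', de' = de \/ de' = - de ->
  0 < phi de' -> (forall i j k, i != j -> 0 < phi (r i j k) -> N (r i j k)) ->
  (forall c q, exists M : nat, forall k : nat, (M <= k)%N -> ~ S (c + q + de' *+ k)) -> goal.

Let rii i k : r i i k = de *~ k. Proof. by rewrite /rte subrr add0r. Qed.

Let p_de m : p m de = 0.
Proof. by have := p_r m t0 t0 1; rewrite rii mulr1z subrr. Qed.

Definition J := {x : T * T | x.1 != x.2}.

Let op_proof (x : J) : (val x).2 != (val x).1. Proof. by rewrite eq_sym (valP x). Qed.
Definition jop (x : J) : J := exist _ ((val x).2, (val x).1) (op_proof x).
Definition ja (x : J) : Q := eps (val x).1 - eps (val x).2.
Definition jpr (x : J) : {additive Q -> int} := p (val x).1 \- p (val x).2.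
Definition jw (x : J) : K := u (val x).1 - u (val x).2.
Definition jmk i j (ij : i != j) : J := exist _ (i, j) ij.

Let a_op x : ja (jop x) = - ja x. Proof. by rewrite /ja /= opprB. Qed.
Let w_op x : jw (jop x) = - jw x. Proof. by rewrite /jw /= opprB. Qed.
Let pr_op x c : jpr (jop x) c = - jpr x c. Proof. by rewrite /jpr /= opprB. Qed.
Let pr_a x : jpr x (ja x) = 2.
Proof.
have -> : ja x = r (val x).1 (val x).2 0 by rewrite /rte mulr0z addr0.
by rewrite /jpr /= !p_r !eqxx (negPf (valP x)) eq_sym (negPf (valP x)).
Qed.
Let pr_de x : jpr x de = 0. Proof. by rewrite /jpr /= !p_de. Qed.

Let a_gen (P : Q -> Prop) : P 0 -> (forall q x, P q -> P (q + ja x)) ->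
  (forall q, P q -> P (q + de)) -> (forall q, P q -> P (q - de)) -> forall q, P q.
Proof.
move=> P0 Pa Pd Pd' q.
have step i m q' : P q' -> P (q' + (eps i - eps t0) *~ m).
  have [->|it] := eqVneq i t0; first by rewrite subrr mul0rz addr0.
  apply: closed_mulrz => q1 Pq1; first exact: (Pa q1 (jmk it)).
  have it' : t0 != i by rewrite eq_sym.
  by rewrite opprB; exact: (Pa q1 (jmk it')).
have -> : q = \sum_i (eps i - eps t0) *~ p i q + de *~ d q.
  rewrite {1}[q]span; congr (_ + _).
  under [RHS]eq_bigr do rewrite mulrzBl.
  by rewrite sumrB -mulrz_sumr sum_p mulr0z subr0.
apply: closed_mulrz => //; elim/big_rec: _ => // i x _ Px.
by rewrite addrC; exact: step.
Qed.

Let rtE x k : rt ja de x k = r (val x).1 (val x).2 k. Proof. by []. Qed.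

Let S1' x k : ~ N (rt ja de x k) -> St (rt ja de x k).
Proof. by move=> nN; apply: S1 nN; exact: (valP x). Qed.

Let S2' x k c : N (rt ja de x k) -> N (- rt ja de x k) -> S c ->
  exists m : int, jval jpr jw lev x k c = m%:~R /\
    forall t : nat, t%:Z <= m -> S (c - rt ja de x k *+ t).
Proof. by move=> n1 n2; exact: (S2 (valP x)). Qed.


Lemma r_opp i j k : - r i j k = r j i (- k).
Proof. by rewrite /rte opprD opprB mulrNz. Qed.

Lemma r_comp i j m k k' : r i j k + r j m k' = r i m (k + k').
Proof. by rewrite /rte mulrzDr; zmod_ring. Qed.

Lemma St_nN i j k : i != j -> ~ St (r i j k) -> N (r i j k).
Proof. by move=> ij nS; apply: contrapT => /(S1 ij). Qed.

Lemma St_refl_A i j k q : i != j -> N (r i j k) -> N (- r i j k) -> St q ->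
  St (q - r i j k *~ (p i q - p j q)).
Proof.
move=> ij n1 n2 Sq.
exact: (St_refl a_op w_op pr_op pr_a pr_de S2' (j := jmk ij) (conj n1 n2) Sq).
Qed.

Definition strong := forall i j, i != j -> exists k, St (r i j k).

Let d_de : d de = 1.
Proof. by have := d_r t0 t0 1; rewrite rii mulr1z. Qed.

Let op_ex : strong -> forall x, exists k, St (rt ja de x k).
Proof. by move=> st x; exact: (st _ _ (valP x)). Qed.

Lemma strong_null_mixed : strong -> forall k l : nat, (0 < k)%N -> (0 < l)%N ->
  St (de *+ k) -> St (- (de *+ l)) -> False.
Proof.
move=> st.
exact: (St_null_mixed a_op pr_a pr_de a_gen (jmk t01) S1' S2' Sn0 Sex (op_ex st)).
Qed.

(* With [x i] the least k such that [r i t0 k] is in St, the functional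
   [- d + \sum_i x i * p i] is nonpositive on the real roots in St. *)
Lemma strong_nonneg : strong -> (forall k : int, St (de *~ k) -> 0 <= k) -> goal.
Proof.
move=> st de_nonneg.
have st' i j : exists k, St (r i j k).
  have [->|/st //] := eqVneq i j; exists 0; rewrite rii mulr0z; exact: St0.
have /choice[x xP] : forall i, exists m, St (r i t0 m) /\ forall k, St (r i t0 k) -> m <= k.
  move=> i; have [k' Sk'] := st' t0 i.
  have [|m Sm mmin] := @int_min (fun k => St (r i t0 k)) (- k') (st' i t0); last by exists m.
  move=> k Sk; have := StD Sk Sk'; rewrite r_comp rii => /de_nonneg; lia.
pose phi0 (c : Q) : int := - d c + \sum_i p i c * x i.
have phi0_add : zmod_morphism phi0.
  move=> c c'; rewrite /phi0 raddfB /= (eq_bigr (fun i => p i c * x i - p i c' * x i)).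
    by rewrite sumrB; ring.
  by move=> i _; rewrite raddfB mulrBl.
pose phi : {additive Q -> int} := HB.pack phi0 (GRing.isZmodMorphism.Build Q int _ phi0_add).
have sumx j : \sum_m (m == j)%:Z * x m = x j.
  by rewrite (bigD1 j) //= eqxx mul1r big1 ?addr0 // => m /negPf ->; rewrite mul0r.
have phi_r i j k : phi (r i j k) = - k + x i - x j.
  rewrite /phi /= /phi0 d_r -addrA; congr (_ + _).
  rewrite (eq_bigr (fun m => (m == i)%:Z * x m - (m == j)%:Z * x m)); last by move=> m _; rewrite p_r mulrBl.
  by rewrite sumrB !sumx.
have phi_de : phi de = -1.
  by have := phi_r t0 t0 1; rewrite rii mulr1z addrK.
apply: (goal_far (phi := phi) (de' := - de)); first by right.
- by rewrite raddfN phi_de.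
- move=> i j k ij; rewrite phi_r => pos; apply: St_nN => // Sk.
  have := StD Sk (xP j).1; rewrite r_comp => /((xP i).2 _); move: pos; lia.
exact: (far_nonneg a_op w_op pr_op pr_a pr_de a_gen (jmk t01) S1' S2' Sn0 (op_ex st) de_nonneg).
Qed.

Definition allsym := forall i j k, i != j -> N (r i j k).

Lemma allsym_pos la : allsym -> lev = la%:~R -> 0 < la -> goal.
Proof.
move=> asym levE la0; apply: (goal_far (phi := d) (de' := de)); first by left.
- by rewrite d_de.
- by move=> *; exact: asym.
apply: (far_integrable a_op pr_a pr_de a_gen (jmk t01) S2' Sn0 Sex levE la0).
move=> x k; split; rewrite ?rtE ?r_opp; apply: asym; first exact: (valP x).
by rewrite eq_sym; exact: (valP x).
Qed.

(** The string value is exactly the drop of [p + th] from [i] to [j], so a positive drop allows one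
    step. *)
Lemma string_step th c i j k : (forall i j (m : int), u i - u j = m%:~R -> th i - th j = m) ->
  i != j -> N (r i j k) -> N (- r i j k) -> lev * k%:~R = 0 -> S c ->
  p j c + th j < p i c + th i -> S (c - r i j k).
Proof.
move=> thP ij n1 n2 l0 Sc lt; have [m [mE str]] := S2 ij n1 n2 Sc.
rewrite l0 addr0 in mE.
have := thP i j (m - (p i c - p j c)); rewrite intrB -mE addrK => /(_ erefl) E.
by apply: (str 1%N); move: lt E; move: (p i c) (p j c) => x y; lia.
Qed.

Lemma allsym_zero : allsym -> lev = 0 -> goal.
Proof.
move=> asym lev0; apply: contrapT => ng; apply: Sn0.
have asym' i j k : i != j -> N (- r i j k) by rewrite r_opp eq_sym => /asym.
have [th thP] := integral_lift u.
(* The bottom block is the single index [i0]. Maximality of [th i0] makes the string value positive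
   whenever [p i0 c] is positive and [p i c] negative. *)
pose i0 := [arg max_(i > t0) th i]%O.
have i0max i : th i <= th i0 by rewrite /i0; case: arg_maxP => // j _; exact.
pose i1 := if t0 == i0 then t1 else t0.
have i1n : i1 != i0.
  by rewrite /i1; case: ifP => [/eqP <-|->//]; rewrite eq_sym.
pose rk i : nat := i != i0.
have rk0 : rk i0 = 0%N by rewrite /rk eqxx.
apply: (@transfer _ _ eps p de d p_r d_r span sum_p S rk i0 i1 th) => //.
- by move=> i; rewrite rk0.
- by rewrite rk0 /rk i1n.
- move=> c i j Sc _ ij lt; exists 0.
  by apply: (string_step thP) => //; [exact: asym | exact: asym' | rewrite mulr0].
- move=> c i j k Sc; rewrite rk0 /rk => ii0 /eqP; rewrite eqb0 negbK => /eqP -> jp ip.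
  rewrite -[r _ _ _]opprK r_opp.
  have ni : i0 != i by rewrite eq_sym; case: eqP ii0.
  apply: (string_step thP) => //; [exact: asym | exact: asym' | by rewrite lev0 mul0r |].
  by have := i0max i; move: jp ip; move: (p i c) (p i0 c) => x y; lia.
- move=> c t Sc; rewrite rk0 => t_gt [i' rki'].
  (* Since [p i0] is never maximal on [S], some root out of [i0] can be added, which takes one unit
     from the other indices. *)
  apply: contrapT => nc; apply: ng; apply: (goal_support (phi := p i0) _ _ Sc) => //.
    by exists i0, i1; rewrite p_r eqxx [i0 == i1]eq_sym (negPf i1n); split.
  move=> i j k ij; rewrite p_r; have [<-|_] := eqVneq i0 i; last by lia.
  have [//|ji0 _ Sc'] := eqVneq i0 j; apply: nc; exists (c + r i0 j k).
  have tE : t = 1%N by move: rki' t_gt; rewrite /rk; case: eqP => _ /= <-.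
  have rkj : rk j = 1%N by rewrite /rk eq_sym ji0.
  split=> // [|t' /eqP tt' /eqP tt0]; rewrite bsumD (bsum_r p_r) rkj rk0 ?tE //.
  by rewrite tE eq_sym in tt'; rewrite eq_sym in tt0; rewrite (negPf tt') (negPf tt0) subrr addr0.
Qed.

Let C i j := exists k, St (r i j k).

Let C_refl i : C i i.
Proof. by exists 0; rewrite rii mulr0z; exact: St0. Qed.

Let C_trans i j m : C i j -> C j m -> C i m.
Proof. by move=> [k Sk] [k' Sk']; exists (k + k'); rewrite -(r_comp i j); exact: StD. Qed.

(** A missing level would be symmetric, and reflecting a present level in it would let [j] reach
    [i]. *)
Lemma one_way i j k : C i j -> ~ C j i -> St (r i j k).
Proof.
move=> [q Sq] nji; apply: contrapT => nS.
have ij : i != j by apply/eqP => E; apply: nji; rewrite E.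
have ji : j != i by rewrite eq_sym.
have n2 : N (- r i j k) by rewrite r_opp; apply: St_nN => // Sk; apply: nji; exists (- k).
have := St_refl_A ij (St_nN ij nS) n2 Sq.
rewrite !p_r !eqxx (negPf ij) (negPf ji) => Sr; apply: nji; exists (q - 2 * k).
have -> // : r j i (q - 2 * k) = r i j q - r i j k *~ 2.
by rewrite /rte; zmod_ring.
Qed.

Definition tie i j := ~ C i j /\ ~ C j i.

Let tie_sym i j : tie i j -> tie j i.
Proof. by case. Qed.

Let tie_neq i j : tie i j -> i != j.
Proof. by move=> [nC _]; apply/eqP => E; apply: nC; rewrite E. Qed.

Let tie_N i j k : tie i j -> N (r i j k).
Proof. by move=> ti; apply: St_nN; [exact: tie_neq | move=> Sk; apply: ti.1; exists k]. Qed.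

Let tie_Nopp i j k : tie i j -> N (- r i j k).
Proof. by rewrite r_opp => /tie_sym ti; exact: tie_N. Qed.

(** The reflection exchanging two tied indices preserves [St], so they have the same relations to
    every third index. *)
Lemma tie_from i j m : tie i j -> m != i -> m != j -> C i m -> C j m.
Proof.
move=> ti mi mj [q Sq]; exists q.
have := St_refl_A (tie_neq ti) (tie_N 0 ti) (tie_Nopp 0 ti) Sq.
rewrite !p_r eqxx [j == i]eq_sym (negPf (tie_neq ti)).
rewrite [i == m]eq_sym [j == m]eq_sym (negPf mi) (negPf mj).
suff -> : r j m q = r i m q - r i j 0 *~ 1 by [].
by rewrite /rte; zmod_ring.
Qed.

Lemma tie_to i j m : tie i j -> m != i -> m != j -> C m i -> C m j.
Proof.
move=> ti mi mj [q Sq]; exists q.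
have := St_refl_A (tie_neq ti) (tie_N 0 ti) (tie_Nopp 0 ti) Sq.
rewrite !p_r eqxx [j == i]eq_sym (negPf (tie_neq ti)).
rewrite [i == m]eq_sym [j == m]eq_sym (negPf mi) (negPf mj).
suff -> : r m j q = r m i q - r i j 0 *~ -1 by [].
by rewrite /rte; zmod_ring.
Qed.

(** The size of what [i] reaches. It drops strictly along one-way relations and agrees on tied
    indices, so its level sets form a chain of blocks. *)
Let rk i := #|[pred m | `[< C i m >]]|.

Let C_rk i j : C i j -> (rk j <= rk i)%N.
Proof.
move=> Cij; apply: subset_leq_card; apply/fintype.subsetP => m; rewrite !inE => Cjm.
exact: C_trans Cjm.
Qed.

Let one_way_rk i j : C i j -> ~ C j i -> (rk j < rk i)%N.
Proof.
move=> Cij nC; apply: proper_card; apply/fintype.properP; split.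
  by apply/fintype.subsetP => m; rewrite !inE => Cjm; exact: C_trans Cjm.
by exists i; rewrite !inE; [exact: C_refl | exact/asboolPn].
Qed.

Let tie_rk_le i j : tie i j -> (rk i <= rk j)%N.
Proof.
move=> ti; have [nij nji] := ti.
rewrite /rk (cardD1 i) [leqRHS](cardD1 j) !inE !asboolT // leq_add2l.
apply: subset_leq_card; apply/fintype.subsetP => m; rewrite !inE => /andP[mi /asboolP Cim].
have mj : m != j by apply/eqP => mj; apply: nij; rewrite -mj.
by rewrite mj; apply/asboolP; exact: tie_from Cim.
Qed.

Let tie_rk i j : tie i j -> rk i = rk j.
Proof. by move=> ti; apply/eqP; rewrite eqn_leq !tie_rk_le //; exact: tie_sym. Qed.

Let rk_eq i j : rk i = rk j -> (C i j /\ C j i) \/ tie i j.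
Proof.
move=> E; have [Cij|nij] := pselect (C i j); have [Cji|nji] := pselect (C j i); [by left| | |by right].
- by have := one_way_rk Cij nji; rewrite E ltnn.
- by have := one_way_rk Cji nij; rewrite E ltnn.
Qed.

Let rk_lt i j k : (rk j < rk i)%N -> St (r i j k).
Proof.
move=> lt; have nji : ~ C j i by move=> /C_rk; rewrite leqNgt lt.
apply: one_way => //; apply: contrapT => nij.
by move: lt; rewrite (tie_rk (conj nij nji)) ltnn.
Qed.

Hypothesis not_strong : ~ strong.
Hypothesis not_allsym : ~ allsym.

(** With constant rank any two indices are tied or reach each other. A single tie spreads to all
    pairs, giving [allsym]; without ties, [strong] holds. *)
Let rk_nonconst : exists i j, (rk i < rk j)%N.
Proof.
apply: contrapT => nc.
have cst i j : rk i = rk j.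
  by apply/eqP; rewrite eqn_leq; apply/andP; split; rewrite leqNgt; apply/negP => lt; apply: nc; [exists j, i | exists i, j].
have spread_tie i j : tie i j -> forall m, m != i -> tie i m.
  move=> ti m mi; have [->//|mj] := eqVneq m j.
  case: (rk_eq (cst i m)) => // -[Cim Cmi]; case: ti.1.
  exact: C_trans Cim (tie_to ti mi mj Cmi).
have [i [j tij]] : exists i j, tie i j.
  apply: contrapT => nt; apply: not_strong => i j ij.
  by case: (rk_eq (cst i j)) => [[]//|ti]; case: nt; exists i, j.
apply: not_allsym => a b k ab; apply: tie_N.
have [aE|ai] := eqVneq a i.
  by rewrite aE; apply: spread_tie tij _ _; rewrite -aE eq_sym.
have ta := tie_sym (spread_tie _ _ tij _ ai).
by apply: spread_tie ta _ _; rewrite eq_sym.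
Qed.

(* The blocks are the level sets of [rk]: roots from a higher to a lower block
   are all in St, and inside a block any two indices reach each other or are
   unrelated and joined by sl2-strings. *)
Lemma mixed : goal.
Proof.
apply: contrapT => ng; apply: Sn0; have [th thP] := integral_lift u.
pose b0 := [arg min_(i < t0) rk i]%N.
have b0_min i : (rk b0 <= rk i)%N by rewrite /b0; case: arg_minnP => // j _; exact.
have [i1 i1_gt] : exists i1, (rk b0 < rk i1)%N.
  by have [i [j lt]] := rk_nonconst; exists j; exact: leq_ltn_trans lt.
apply: (@transfer _ _ eps p de d p_r d_r span sum_p S rk b0 i1 th) => //.
- move=> c i j Sc E ij lt; case: (rk_eq E) => [[_ [k Sk]]|ti].
    by exists (- k); rewrite r_opp opprK; exact: Sk.
  exists 0; apply: (string_step thP) => //; [exact: tie_N | exact: tie_Nopp | exact: mulr0].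
- by move=> c i j k Sc ib jb _ _; apply: rk_lt => //; rewrite jb.
move=> c t; have [m] := ubnP t; elim: m t c => // m IH t c tm Sc bt [i' rki'].
have [i [j [ij tj it [k Sk]]]] : exists i j, [/\ i != j, (t <= rk j)%N, (rk i < t)%N & exists k, S (c + r i j k)].
  apply: contrapT => nex; apply: ng.
  (* If this functional is not maximal at [c], a root can be added that moves a unit from a block of
     rank at least [t] to one below [t]. *)
  pose phi0 (c : Q) : int := - \sum_(x | (t <= rk x)%N) p x c.
  have phi0_add : zmod_morphism phi0.
    move=> a b; rewrite /phi0 -opprD -sumrN -sumrN -big_split /=.
    by rewrite -sumrN; apply: eq_bigr => x _; rewrite raddfB opprB addrC.
  pose phi : {additive Q -> int} := HB.pack phi0 (GRing.isZmodMorphism.Build Q int _ phi0_add).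
  have phi_r i j k : phi (r i j k) = (t <= rk j)%N%:Z - (t <= rk i)%N%:Z.
    rewrite /phi /= /phi0; under eq_bigr do rewrite p_r.
    have E y : \sum_(x | (t <= rk x)%N) (x == y)%:Z = (t <= rk y)%N%:Z.
      rewrite big_mkcond (bigD1 y) //= eqxx big1 ?addr0; first by case: (_ <= _)%N.
      by move=> x /negPf ->; case: ifP.
    by rewrite sumrB !E opprB.
  apply: (goal_support (phi := phi) _ _ Sc).
  - by rewrite /phi /= /phi0 big1 ?oppr0 // => x _; rewrite p_de.
  - exists b0, i'; split; first by apply/eqP => E; move: bt; rewrite E rki' ltnn.
    by rewrite phi_r rki' leqnn leqNgt bt.
  - move=> i j k ij; rewrite phi_r => pos Sk; apply: nex; exists i, j; split=> //; last by exists k.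
      by move: pos; case: (t <= rk j)%N => //; case: (_ <= _)%N.
    by rewrite ltnNge; move: pos; case: (t <= rk i)%N => //; case: (_ <= _)%N.
(* If the unit was taken from a block above [t], a downward root, which lies in [St], replaces it by
   one from block [t]. *)
have [c1 [Sc1 b1]] : exists c1, S c1 /\
    forall t', bsum p rk t' c1 = bsum p rk t' c + (rk i == t')%:Z - (t == t')%:Z.
  have [E|/eqP ne] := t =P rk j.
    by exists (c + r i j k); split=> // t'; rewrite bsumD (bsum_r p_r) -E addrA.
  have lt : (rk i' < rk j)%N by rewrite rki' ltn_neqAle ne.
  exists (c + r i j k + r j i' 0); split; first exact: (rk_lt 0 lt Sk).
  by move=> t'; rewrite 2!bsumD !(bsum_r p_r) rki'; ring.
have [E|/eqP ne] := rk i =P rk b0.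
  exists c1; split=> // [|t' /eqP tt' /eqP tb]; rewrite b1 ?E.
    by rewrite eqxx [_ == t]ltn_eqF ?addr0.
  by rewrite eq_sym (negPf tb) eq_sym (negPf tt') subr0 addr0.
have lt : (rk b0 < rk i)%N by rewrite ltn_neqAle eq_sym ne b0_min.
(* The unit arrived in an intermediate block; the induction hypothesis for that lower block passes
   it on to the bottom. *)
have [|c2 [Sc2 b2 o2]] := IH (rk i) c1 _ Sc1 lt (ex_intro _ i erefl); first by lia.
exists c2; split=> // [|t' tt' tb].
  rewrite o2; [|lia|lia]; by rewrite b1 eqxx [_ == t]ltn_eqF ?addr0.
have [->|/eqP t'i] := eqVneq t' (rk i).
  rewrite b2 b1 eqxx [t == _]gtn_eqF //; lia.
rewrite o2 // b1.
by move/eqP: t'i; move/eqP: tt'; rewrite eq_sym => /negPf ->; rewrite eq_sym => /negPf ->; rewrite subr0 addr0.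
Qed.

End CombinatoricsA.

Section MainA.
Variables (K : numFieldType) (I T : finType).
Notation Q := {ffun I -> int}.
Variables (eps : T -> Q) (p : T -> {additive Q -> int}) (de : Q) (d : {additive Q -> int}).
Notation r := (rte eps de).
Hypothesis p_r : forall m i j k, p m (r i j k) = (m == i)%:Z - (m == j)%:Z.
Hypothesis d_r : forall i j k, d (r i j k) = k.
Hypothesis span : forall c, c = \sum_i eps i *~ p i c + de *~ d c.
Hypothesis sum_p : forall c, \sum_i p i c = 0.
Variables (t0 t1 : T).
Hypothesis t01 : t0 != t1.

Variables (S N : Q -> Prop) (u : T -> K) (lev : K).
Notation St := (St S).
Hypothesis S1 : forall i j k, i != j -> ~ N (r i j k) -> St (r i j k).
Hypothesis S2 : forall i j k c, i != j -> N (r i j k) -> N (- r i j k) -> S c ->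
  exists m : int, (u i - u j) + lev * k%:~R + (p i c - p j c)%:~R = m%:~R /\
    forall t : nat, t%:Z <= m -> S (c - r i j k *+ t).
Hypothesis Sn0 : ~ S 0.
Hypothesis Sex : exists c, S c.

Variable goal : Prop.
Hypothesis goal_support : forall phi : {additive Q -> int}, phi de = 0 ->
  (exists i j, i != j /\ phi (r i j 0) <> 0) -> forall c, S c ->
  (forall i j k, i != j -> 0 < phi (r i j k) -> ~ S (c + r i j k)) -> goal.
Hypothesis goal_far : forall (phi : {additive Q -> int}) de', de' = de \/ de' = - de ->
  0 < phi de' -> (forall i j k, i != j -> 0 < phi (r i j k) -> N (r i j k)) ->
  (forall c q, exists M : nat, forall k : nat, (M <= k)%N -> ~ S (c + q + de' *+ k)) -> goal.

(** The hypotheses are symmetric under [de] to [- de], with [d] and [lev] negated, so one sign of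
    the level and of the multiples in [St] suffices. *)
Let flip i j k : rte eps (- de) i j k = r i j (- k).
Proof. by rewrite /rte mulNrz mulrNz. Qed.

Let d' : {additive Q -> int} := \- d.
Let p_r' m i j k : p m (rte eps (- de) i j k) = (m == i)%:Z - (m == j)%:Z.
Proof. by rewrite flip. Qed.
Let d_r' i j k : d' (rte eps (- de) i j k) = k.
Proof. by rewrite flip /= d_r opprK. Qed.
Let span' c : c = \sum_i eps i *~ p i c + (- de) *~ d' c.
Proof. by rewrite mulNrz -mulrNz opprK -span. Qed.
Let S1' i j k : i != j -> ~ N (rte eps (- de) i j k) -> St (rte eps (- de) i j k).
Proof. by rewrite flip; exact: S1. Qed.
Let S2' i j k c : i != j -> N (rte eps (- de) i j k) -> N (- rte eps (- de) i j k) -> S c ->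
  exists m : int, (u i - u j) + (- lev) * k%:~R + (p i c - p j c)%:~R = m%:~R /\
    forall t : nat, t%:Z <= m -> S (c - rte eps (- de) i j k *+ t).
Proof.
rewrite flip => ij n1 n2 Sc; have [m [mE str]] := S2 ij n1 n2 Sc.
by exists m; rewrite mulNr -mulrN -mulrNz.
Qed.
Let goal_far' : forall (phi : {additive Q -> int}) de', de' = - de \/ de' = - - de ->
  0 < phi de' -> (forall i j k, i != j -> 0 < phi (rte eps (- de) i j k) -> N (rte eps (- de) i j k)) ->
  (forall c q, exists M : nat, forall k : nat, (M <= k)%N -> ~ S (c + q + de' *+ k)) -> goal.
Proof.
move=> phi de'; rewrite opprK => deE phi0 phiN; apply: goal_far phi0 _; first by case: deE; auto.
by move=> i j k ij; have := @phiN i j (- k) ij; rewrite flip opprK.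
Qed.

Theorem goal_A : goal.
Proof.
have [st|nst] := pselect (strong eps de S); last first.
  have [asym|nasym] := pselect (allsym eps de N); last exact: (mixed p_r d_r span sum_p t01 S1 S2 Sn0 Sex).
  have asym' i j k : i != j -> N (- r i j k).
    by rewrite r_opp eq_sym => /asym.
  (* Strings through the same [c] in directions of level 0 and 1 have integral values that differ by
     [lev]. *)
  have [la levE] : exists la : int, lev = la%:~R.
    have [c Sc] := Sex.
    have [m [mE _]] := S2 t01 (asym t0 t1 0 t01) (asym' t0 t1 0 t01) Sc.
    have [m' [mE' _]] := S2 t01 (asym t0 t1 1 t01) (asym' t0 t1 1 t01) Sc.
    exists (m' - m); rewrite intrB -mE -mE' mulr0 addr0 mulr1; ring.
  have [la0|la0|la0] := ltgtP la 0.
  - have levE' : - lev = (- la)%:~R by rewrite levE mulrNz.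
    apply: (allsym_pos p_r' d_r' span' sum_p t01 S2' Sn0 Sex goal_far' _ levE').
      by move=> i j k; rewrite flip; exact: asym.
    by rewrite oppr_gt0.
  - exact: (allsym_pos p_r d_r span sum_p t01 S2 Sn0 Sex goal_far asym levE).
  - apply: (allsym_zero p_r d_r span sum_p t01 S2 Sn0 Sex) => //.
    by rewrite levE la0.
have st' : strong eps (- de) S.
  by move=> i j ij; have [k Sk] := st i j ij; exists (- k); rewrite flip opprK.
have [nn|] := pselect (forall k : int, St (de *~ k) -> 0 <= k).
  exact: (strong_nonneg p_r d_r span sum_p t01 S1 S2 Sn0).
(* A negative multiple of [de] is in [St]; by [strong_null_mixed] no positive one is, so the
   nonnegative case applies to [- de]. *)
move=> /existsNP[k /not_implyP[Sk /negP]]; rewrite -ltNge => k0.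
apply: (strong_nonneg p_r' d_r' span' sum_p t01 S1' S2' Sn0 goal_far' st') => l.
rewrite mulNrz -mulrNz => Sl; rewrite leNgt; apply/negP => l0.
apply: (strong_null_mixed p_r span sum_p t01 S1 S2 Sn0 Sex st (k := absz l) (l := absz k)).
- by move: l0; lia.
- by move: k0; lia.
- by rewrite pmulrn (_ : (absz l)%:Z = - l) //; move: l0; lia.
- by rewrite pmulrn -mulrNz (_ : - (absz k)%:Z = k) //; move: k0; lia.
Qed.
End MainA.

(** * A weight missing from the support *)

Section MissingWeight.
Variables (K : numFieldType) (n : nat) (A : 'M[int]_n).
Variables (g : kac_moody_algebra K A) (V : lieModType g).

Lemma root_lattice_wt mu : root_lattice g mu -> exists c, mu = wt g c.
Proof.
move=> [s [m [sr ->]]]; elim: s sr => [|al s IH] sr.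
  by exists 0; rewrite big_nil raddf0.
have [|c E] := IH; first by move=> be bs; apply: sr; rewrite inE bs orbT.
have /rootsE[b bE _] : Defs.roots g al by apply: sr; rewrite inE eqxx.
by exists (b *~ m al + c); rewrite big_cons E bE raddfD raddfMz.
Qed.

Lemma missing_weight : weight_module V -> lie_irreducible V -> non_dense V ->
  exists mu, ~ insupp V mu 0 /\ exists c, insupp V mu c.
Proof.
move=> [[VE _] _] [Vn _] [la [sup /existsNP[mu /not_implyP[[b /root_lattice_wt[cb ->] muE] nmu]]]].
have suppP c : insupp V mu c <-> supp V (mu + wt g c).
  by split=> -[v Vv vn]; exists v => // h; rewrite Vv !lfunE.
exists mu; split; first by rewrite suppP raddf0 addr0.
have [la' [v Vv vn]] : exists la', supp V la'.
  apply: contrapT => ns; apply: Vn; apply/seteqP; split=> // v _.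
  have : [set: V]%classic v by [].
  rewrite -VE => -[s [u [_ _ su ->]]] /=.
  rewrite big_seq big1 // => i /su si; apply: contrapT => un; apply: ns.
  by exists i, (u i).
have : root_coset la la' by apply: sup; exists v.
move=> [_ /root_lattice_wt[c' ->] la'E]; exists (c' - cb).
apply/suppP; exists v => //.
suff -> : mu + wt g (c' - cb) = la' by [].
by rewrite -la'E -muE raddfB /= addrA addrAC addrK.
Qed.
End MissingWeight.

Section TypeAMain.
Variables (l : nat) (K : numFieldType).
Hypothesis l_gt0 : (0 < l)%N.
Notation A := (gcm_A_untwisted l).
Notation Q := {ffun 'I_l.+1 -> int}.
Variables (g : kac_moody_algebra K A) (V : lieModType g).

Definition dA (c : Q) : int := c ord_max.

Lemma dA_is_additive : zmod_morphism dA.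
Proof. by move=> c c'; rewrite /dA !ffunE. Qed.
HB.instance Definition _ := GRing.isZmodMorphism.Build Q int dA dA_is_additive.

Theorem primitive_A : weight_module V -> lie_irreducible V -> non_dense V -> has_primitive V.
Proof.
move=> wV irrV /(missing_weight wV irrV)[mu [Sn0 Sex]].
have l01 : (ord0 : 'I_l.+1) != ord_max by rewrite eq_ordE /= eq_sym -lt0n.
have opp := @isroot_oppA l l_gt0 K g.
have isA i j k : i != j -> isroot g (rtA i j k) by move=> ij; apply/(isrootA l_gt0); left; exists i, j, k.
have G := (@goal_A K _ _ (@epsA l) (fun i => @pA l i) (@deA l) dA (pA_rtA l_gt0) (rtA_last l_gt0) (spanA l_gt0) (@sum_pA l)
  _ _ l01 (insupp V mu) (@nilroot _ _ _ _ V) (fun i => mu (corA g (epsA i))) (mu (corA g (@deA l)))). apply: G.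
- move=> i j k ij nN c Sc.
  exact: (insupp_inj (A_diag_A l_gt0) (@A_off_A l) (@A_sym0_A l) irrV (realA l_gt0 g k ij) nN Sc).
- move=> i j k c ij n1 n2 Sc.
  have [m [mE str]] := insupp_string (A_diag_A l_gt0) (@A_off_A l) (@A_sym0_A l) (realA l_gt0 g k ij) n1 n2 Sc.
  exists m; split=> //; rewrite -mE /wval (pair_corA_rtA l_gt0); congr (_ + _).
  rewrite /rtA !(raddfD (corA g)) (raddfN (corA g)) (raddfMz (corA g)) /=.
  by rewrite raddfD raddfB raddfMz /=; congr (_ + _); exact: mulrzr.
- exact: Sn0.
- exact: Sex.
- move=> phi phi_de [i [j [ij phin]]] c Sc H.
  apply: (primitive_support opp (phi := phi) _ Sc).
    by exists (rtA i j 0) => //; exact: isA.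
  move=> b /(isrootA l_gt0)[[i' [j' [k [ij' ->]]]]|[k _ ->]]; first exact: H.
  by rewrite raddfMz phi_de mul0rz.
- move=> phi de' de'E phi_de H far.
  have multE k : exists k', @deA l *~ k = de' *~ k'.
    by case: de'E => ->; [exists k | exists (- k); rewrite mulNrNz].
  pose reps : seq Q := [seq epsA x.1 - epsA x.2 | x <- enum {: 'I_l.+1 * 'I_l.+1}].
  have mem_reps i j : epsA i - epsA j \in reps by apply/mapP; exists (i, j); rewrite ?mem_enum.
  apply: (primitive_far (A_diag_A l_gt0) (@A_off_A l) (@A_sym0_A l) opp (reps := reps) phi_de) => //.
  + move=> c /(isrootA l_gt0)[[i [j [k [ij ->]]]]|[k _ ->]]; have [k' kE] := multE k.
      by exists (epsA i - epsA j); [exact: mem_reps | exists k'; rewrite /rtA kE].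
    by exists (epsA ord0 - epsA ord0); [exact: mem_reps | exists k'; rewrite subrr add0r].
  + move=> c /(isrootA l_gt0)[[i [j [k [ij ->]]]]|[k _ ->]].
      by left; eexists; exact: (realA l_gt0).
    by right; exact: multE.
  + move=> b h /(real_XA l_gt0)[i [j [k [ij ->]]]]; exact: H.
  + exists (@deA l); split; first by apply/(isrootA l_gt0); right; exists 1.
    by case: de'E phi_de => ->; rewrite ?raddfN => lt E; rewrite E in lt.
Qed.
End TypeAMain.

(** Short real roots are +-alpha + k delta, long ones +-2 alpha + k delta with k odd; [p] and [d]
    are the coordinates along alpha and delta. *)
Definition real22 (I : finType) (p d : {ffun I -> int} -> int) b : bool :=
  (absz (p b) == 1)%N || ((absz (p b) == 2) && odd (absz (d b)))%N.

(** * Type A_2^(2) *)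

Section Combinatorics22.
Variables (K : numFieldType) (I : finType).
Notation Q := {ffun I -> int}.
Variables (al de : Q) (p d : {additive Q -> int}).
Hypothesis p_al : p al = 1.
Hypothesis p_de : p de = 0.
Hypothesis d_al : d al = 0.
Hypothesis d_de : d de = 1.
Hypothesis span : forall c, c = al *~ p c + de *~ d c.

Variables (S N : Q -> Prop) (w lev : K).
Notation St := (St S).
Notation R22 := (real22 p d).
Hypothesis S1 : forall b, R22 b -> ~ N b -> St b.
Hypothesis S2 : forall b c, absz (p b) = 1%N -> N b -> N (- b) -> S c ->
  exists m : int, w * (p b)%:~R + lev * (d b)%:~R + (2 * p b * p c)%:~R = m%:~R /\
    forall t : nat, t%:Z <= m -> S (c - b *+ t).
Hypothesis Sn0 : ~ S 0.
Hypothesis Sex : exists c, S c.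

Variable goal : Prop.
Hypothesis goal_support : forall phi : {additive Q -> int}, phi de = 0 -> phi al <> 0 ->
  forall c, S c -> (forall b, R22 b -> 0 < phi b -> ~ S (c + b)) -> goal.
Hypothesis goal_far : forall (phi : {additive Q -> int}) de', de' = de \/ de' = - de ->
  0 < phi de' -> (forall b, R22 b -> 0 < phi b -> N b) ->
  (forall c q, exists M : nat, forall k : nat, (M <= k)%N -> ~ S (c + q + de' *+ k)) -> goal.

(** Only the two short directions enter the string arguments; the coroot of a short root pairs with
    [c] to twice [p c], up to sign. *)
Definition ba (b : bool) : Q := if b then al else - al.
Definition bpr (b : bool) : {additive Q -> int} :=
  if b then p \+ p : {additive Q -> int} else \- (p \+ p).
Definition bw (b : bool) : K := if b then w else - w.

Let a_op b : ba (~~ b) = - ba b. Proof. by case: b; rewrite /ba /= ?opprK. Qed.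
Let w_op b : bw (~~ b) = - bw b. Proof. by case: b; rewrite /bw /= ?opprK. Qed.
Let pr_op b c : bpr (~~ b) c = - bpr b c. Proof. by case: b; rewrite /bpr /= ?opprK. Qed.
Let pr_a b : bpr b (ba b) = 2.
Proof. by case: b; rewrite /bpr /ba /= ?raddfN /= p_al. Qed.
Let pr_de b : bpr b de = 0.
Proof. by case: b; rewrite /bpr /= p_de. Qed.

Let a_gen (P : Q -> Prop) : P 0 -> (forall q b, P q -> P (q + ba b)) ->
  (forall q, P q -> P (q + de)) -> (forall q, P q -> P (q - de)) -> forall q, P q.
Proof.
move=> P0 Pa Pd Pd' q; rewrite [q]span.
apply: closed_mulrz => //; rewrite -[al *~ _]add0r; apply: closed_mulrz P0 => q' Pq'.
- exact: (Pa q' true).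
- exact: (Pa q' false).
Qed.

Notation s := (rt ba de).

Let p_s b k : p (s b k) = if b then 1 else -1.
Proof. by rewrite /rt raddfD raddfMz /= p_de mul0rz addr0 /ba; case: b; rewrite ?raddfN /= p_al. Qed.
Let d_s b k : d (s b k) = k.
Proof. by rewrite /rt raddfD raddfMz /= d_de mulrzz mul1r /ba; case: b; rewrite ?raddfN /= d_al ?oppr0 add0r. Qed.
Let real_s b k : R22 (s b k).
Proof. by rewrite /real22 p_s; case: b. Qed.

Let S1' b k : ~ N (s b k) -> St (s b k).
Proof. exact/S1/real_s. Qed.

Let S2' b k c : N (s b k) -> N (- s b k) -> S c ->
  exists m : int, jval bpr bw lev b k c = m%:~R /\
    forall t : nat, t%:Z <= m -> S (c - s b k *+ t).
Proof.
move=> n1 n2 Sc; have [|m [mE str]] := S2 _ n1 n2 Sc; first by rewrite p_s; case: (b).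
exists m; split=> //; rewrite -mE /jval p_s d_s /bw /bpr; congr (_ + _%:~R).
  by case: (b); rewrite ?mulr1 ?mulrN1.
by case: (b) => /=; ring.
Qed.

Lemma short_nN b k : ~ St (s b k) -> N (s b k).
Proof. by move=> nS; apply: contrapT => /S1'. Qed.

Let s_opp b k : - s b k = s (~~ b) (- k).
Proof. by rewrite (rt_op _ a_op). Qed.

Definition allsym22 := forall b k, N (s b k).

Let asymP : allsym22 -> forall b k, sym N ba de b k.
Proof. by move=> asym b k; split; rewrite ?s_opp; exact: asym. Qed.

Lemma ext22 c c' : p c = p c' -> d c = d c' -> c = c'.
Proof. by move=> E E'; rewrite [c]span [c']span E E'. Qed.

Let pE := (p_s, p_de, p_al, raddf0 p, raddfD p, raddfN p, raddfMz p, raddfMn p).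
Let dE := (d_s, d_de, d_al, raddf0 d, raddfD d, raddfN d, raddfMz d, raddfMn d).

Lemma short_s b : absz (p b) = 1%N -> b = s (0 < p b) (d b).
Proof. by move=> pb; apply: ext22; rewrite ?p_s ?d_s //; case: ifP; lia. Qed.

Lemma allsym22_N : allsym22 -> forall b, R22 b -> N b.
Proof.
move=> asym b Rb; apply: contrapT => nN.
have Sb := S1 Rb nN.
case/orP: (Rb) => [/eqP pb|/andP[/eqP pb odb]]; first by apply: nN; rewrite (short_s pb).
have asymP' := asymP asym.
pose b' := b - s true 0 *~ bpr true b.
have Sb' : St b' := St_refl a_op w_op pr_op pr_a pr_de S2' (asymP' true 0) Sb.
have b'p : p b' = - p b by rewrite /b' !pE /= mulrzz; ring.
have b'd : d b' = d b by rewrite /b' !dE /=; ring.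
(* Parallel short reflections translate by [p b] times twice an integer multiple of [de], and [p b]
   is 2 or -2. *)
have shift t : St (b + de *~ (4 * t)).
  have [k kE] : exists k, 4 * t = (k - 0) * bpr true b.
    have [pb2|pb2] : p b = 2 \/ p b = -2 by lia.
      by exists t; rewrite /= pb2; ring.
    by exists (- t); rewrite /= pb2; ring.
  rewrite kE.
  exact: (St_shift a_op w_op pr_op pr_a pr_de S2' (asymP' true k) (asymP' true 0) Sb).
have null t : St (de *~ (2 * d b + 4 * t)).
  have -> : de *~ (2 * d b + 4 * t) = b + de *~ (4 * t) + b'.
    by apply: ext22; rewrite !(b'p, b'd, pE, dE) /= ?mul0rz ?mulrzz; ring.
  exact: StD.
(* As [d b] is odd, [2 * d b + 4 * t] takes both values 2 and -2. *)
have even t : St (de *~ (2 * t)).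
  have St2 : St (de *~ 2).
    by have := null ((1 - d b) %/ 2)%Z; congr (St (_ *~ _)); lia.
  have St2' : St (de *~ -2).
    by have := null ((- 1 - d b) %/ 2)%Z; congr (St (_ *~ _)); lia.
  case: t => t; first by rewrite mulrzA -pmulrn; exact: StMn.
  by rewrite NegzE (_ : 2 * - _ = -2 * t.+1%:Z) ?mulrzA -?pmulrn; [exact: StMn | ring].
apply: (St_dense a_op pr_a pr_de a_gen true S1' S2' Sn0 Sex) => j k.
(* Twice a long root has four times the alpha-coordinate of a short one, and the levels differ by an
   even number. *)
have four j' k' : St (s j' k' *+ 4).
  have [c [Sc pc dc]] : exists c, [/\ St c, p c = if j' then 2 else -2 & d c = d b].
    have [pb2|pb2] : p b = 2 \/ p b = -2 by lia.
      by case: j'; [exists b | exists b'; rewrite b'p b'd pb2].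
    by case: j'; [exists b'; rewrite b'p b'd pb2 | exists b].
  have -> : s j' k' *+ 4 = c + c + de *~ (2 * (2 * k' - d b)).
    apply: ext22; rewrite !(pE, dE) ?pc ?dc; case: (j'); rewrite ?pmulrn ?mulrzz ?mul0rz; lia.
  by apply: StD => //; exact: StD.
by exists 4%N; split=> //; rewrite -mulNrn s_opp.
Qed.

Lemma allsym22_pos la : allsym22 -> lev = la%:~R -> 0 < la -> goal.
Proof.
move=> asym levE la0; apply: (goal_far (phi := d) (de' := de)); first by left.
- by rewrite d_de.
- by move=> b Rb _; exact: allsym22_N.
exact: (far_integrable a_op pr_a pr_de a_gen true S2' Sn0 Sex levE la0 (asymP asym)).
Qed.

(** As [p] has no maximum on [S], some point has [p] at least 1. From there the string value
    [om + 2 * p c] stays positive down to [p c = 1], and the last step chooses the level that hits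
    0. *)
Lemma allsym22_zero om : allsym22 -> lev = 0 -> w = om%:~R -> 0 <= om -> goal.
Proof.
move=> asym lev0 wE om0; apply: contrapT => ng; apply: Sn0.
have up c : S c -> exists2 b, 0 < p b & S (c + b).
  move=> Sc; apply: contrapT => nb; apply: ng; apply: (goal_support (phi := p) _ _ Sc) => //.
    by rewrite p_al.
  by move=> b _ pb Sb; apply: nb; exists b.
have high n c : S c -> 1 - p c <= n%:Z -> exists2 c', S c' & 1 <= p c'.
  elim: n c => [|n IH] c Sc le; first by exists c => //; lia.
  by have [b pb Sb] := up _ Sc; apply: (IH _ Sb); rewrite raddfD /=; lia.
have down c k : S c -> 0 < p c -> S (c - s true k).
  move=> Sc pc; have [//||m [mE str]] := @S2 (s true k) c _ (asym _ _) _ Sc; first by rewrite p_s.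
    by rewrite s_opp; exact: asym.
  apply: (str 1%N); suff -> : m = om + 2 * p c by lia.
  by apply: (@intr_inj K); rewrite -mE wE lev0 p_s /= mul0r addr0 mulr1 intrD mulr1.
have [c0 Sc0] := Sex; have [c1 Sc1 pc1] := high (absz (1 - p c0)) c0 Sc0 (ler_norm _).
have [n pc1n] : exists n : nat, p c1 = n.+1%:Z by exists (absz (p c1)).-1; lia.
elim: n c1 Sc1 pc1n {pc1} => [|n IH] c Sc pc.
  have -> : 0 = c - s true (d c) by apply: ext22; rewrite !(pE, dE) ?pc /= ?subrr.
  by apply: down; rewrite // pc.
by apply: (IH _ (down _ 0 Sc _)); rewrite ?pc // !pE pc; lia.
Qed.

(** Reflection puts all levels of the available direction into [St]. A point with negative [p] would
    then be led to 0, so [p] has a minimum on [S], where [- p] is maximal. *)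
Lemma one_sided22 : (exists k, St (s true k)) -> ~ (exists k, St (s false k)) -> goal.
Proof.
move=> [q Sq] nf.
have all k : St (s true k).
  apply: contrapT => nS; apply: (nf).
  have sy : sym N ba de true k.
    by split; [exact: short_nN | rewrite s_opp; apply: short_nN => Sk; apply: (nf); exists (- k)].
  exists (q - 2 * k); have := St_refl a_op w_op pr_op pr_a pr_de S2' sy Sq.
  congr St; apply: ext22; rewrite !(pE, dE) /= ?p_s ?mulrzz //.
  by ring.
have low n c : S c -> p c = - (n.+1%:Z) -> S 0.
  elim: n c => [|n IH] c Sc pc.
    have -> : 0 = c + s true (- d c) by apply: ext22; rewrite !(pE, dE) ?pc /= ?subrr.
    exact: all.
  by apply: (IH _ (all 0 _ Sc)); rewrite !pE pc; lia.
have [|x|x [c Sc pc] xmin] := @int_min (fun x => exists2 c, S c & p c = x) 0.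
- by have [c Sc] := Sex; exists (p c), c.
- move=> [c Sc <-]; rewrite leNgt; apply/negP => pc; apply: Sn0.
  by apply: (low (absz (p c)).-1 c Sc); lia.
apply: (goal_support (phi := \- p) _ _ Sc); rewrite /= ?p_de ?p_al //.
move=> b _ pb Sb; have := xmin (p (c + b)) (ex_intro2 _ _ (c + b) Sb erefl).
by rewrite (raddfD p) pc lerDl leNgt -oppr_gt0 => /negP; apply; exact: pb.
Qed.

Hypothesis op_ex : forall b, exists k, St (s b k).

Lemma null_mixed22 (k l : nat) : (0 < k)%N -> (0 < l)%N -> St (de *+ k) -> St (- (de *+ l)) -> False.
Proof. exact: (St_null_mixed a_op pr_a pr_de a_gen true S1' S2' Sn0 Sex op_ex). Qed.

(* With x the least m such that [al *~ 2 + de *~ m] is in St, the functional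
   [x * p - 2 * d] is nonpositive on the real roots in St. *)
Lemma two_sided22 : (forall k : int, St (de *~ k) -> 0 <= k) -> goal.
Proof.
move=> de_nonneg.
have [q' Sq'] := op_ex false; have [q Sq] := op_ex true.
have Sq2 := StD Sq Sq; have Sq2' := StD Sq' Sq'.
(* Doubling a short root makes it comparable with a long one, so a single minimum serves both
   lengths. *)
pose T m := al *~ 2 + de *~ m.
have null c : St c -> p c = 0 -> 0 <= d c.
  by move=> Sc pc; apply: de_nonneg; have <- : c = de *~ d c by rewrite {1}[c]span pc mulr0z add0r.
have pT m : p (T m) = 2 by rewrite /T !pE mul0rz addr0.
have dT m : d (T m) = m by rewrite /T !dE ?mulrzz; ring.
have [||x Sx xmin] := @int_min (fun m => St (T m)) (- (2 * q')).
- exists (2 * q); move: Sq2; congr St; apply: ext22; rewrite !(pT, dT, pE, dE) //; ring.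
- move=> m Sm; have := null _ (StD Sm Sq2'); rewrite !(pT, dT, pE, dE) => /(_ erefl); lia.
pose phi0 (c : Q) : int := x * p c - 2 * d c.
have phi0_add : zmod_morphism phi0.
  by move=> a b; rewrite /phi0 !raddfB /=; ring.
pose phi : {additive Q -> int} := HB.pack phi0 (GRing.isZmodMorphism.Build Q int _ phi0_add).
apply: (goal_far (phi := phi) (de' := - de)); first by right.
- by rewrite raddfN /phi /= /phi0 p_de d_de mulr0 sub0r opprK.
- move=> b Rb; rewrite /phi /= /phi0 => phib; apply: contrapT => /(S1 Rb) Sb.
  have [|pb] := leP 0 (p b).
    move=> pb; have [pb1|pb2] : p b = 1 \/ p b = 2 by case/orP: Rb => [/eqP|/andP[/eqP]]; lia.
      have : x <= 2 * d b.
        apply: xmin; move: (StD Sb Sb); congr St; apply: ext22; rewrite !(pT, dT, pE, dE) ?pb1 //; ring.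
      by move: phib; rewrite pb1; lia.
    have : x <= d b by apply: xmin; move: Sb; congr St; apply: ext22; rewrite ?pT ?dT.
    by move: phib; rewrite pb2; lia.
  have [pb1|pb2] : p b = -1 \/ p b = -2 by case/orP: Rb => [/eqP|/andP[/eqP]]; lia.
    have := null _ (StD (StD Sb Sb) Sx); rewrite !(pT, dT, pE, dE) pb1 => /(_ erefl).
    by move: phib; rewrite pb1; lia.
  have := null _ (StD Sb Sx); rewrite !(pT, dT, pE, dE) pb2 => /(_ erefl).
  by move: phib; rewrite pb2; lia.
exact: (far_nonneg a_op w_op pr_op pr_a pr_de a_gen true S1' S2' Sn0 op_ex de_nonneg).
Qed.

End Combinatorics22.

Section Main22.
Variables (K : numFieldType) (I : finType).
Notation Q := {ffun I -> int}.
Variables (al de : Q) (p d : {additive Q -> int}).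
Hypothesis p_al : p al = 1.
Hypothesis p_de : p de = 0.
Hypothesis d_al : d al = 0.
Hypothesis d_de : d de = 1.
Hypothesis span : forall c, c = al *~ p c + de *~ d c.

Variables (S N : Q -> Prop) (w lev : K).
Notation St := (St S).
Notation R22 := (real22 p d).
Hypothesis S1 : forall b, R22 b -> ~ N b -> St b.
Hypothesis S2 : forall b c, absz (p b) = 1%N -> N b -> N (- b) -> S c ->
  exists m : int, w * (p b)%:~R + lev * (d b)%:~R + (2 * p b * p c)%:~R = m%:~R /\
    forall t : nat, t%:Z <= m -> S (c - b *+ t).
Hypothesis Sn0 : ~ S 0.
Hypothesis Sex : exists c, S c.

Variable goal : Prop.
Hypothesis goal_support : forall phi : {additive Q -> int}, phi de = 0 -> phi al <> 0 ->
  forall c, S c -> (forall b, R22 b -> 0 < phi b -> ~ S (c + b)) -> goal.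
Hypothesis goal_far : forall (phi : {additive Q -> int}) de', de' = de \/ de' = - de ->
  0 < phi de' -> (forall b, R22 b -> 0 < phi b -> N b) ->
  (forall c q, exists M : nat, forall k : nat, (M <= k)%N -> ~ S (c + q + de' *+ k)) -> goal.

(** Negating [al] and [p], or [de] and [d], preserves the hypotheses; this reduces to nonnegative
    [om], positive level and one orientation of the short roots. *)
Let p' : {additive Q -> int} := \- p.
Let d' : {additive Q -> int} := \- d.

Let p'_al : p' (- al) = 1. Proof. by rewrite /= raddfN opprK. Qed.
Let p'_de : p' de = 0. Proof. by rewrite /= p_de oppr0. Qed.
Let d_al' : d (- al) = 0. Proof. by rewrite raddfN /= d_al oppr0. Qed.
Let span_p c : c = (- al) *~ p' c + de *~ d c.
Proof. by rewrite mulNrz -mulrNz opprK -span. Qed.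
Let S1p b : real22 p' d b -> ~ N b -> St b.
Proof. by rewrite /real22 /= abszN; exact: S1. Qed.
Let S2p b c : absz (p' b) = 1%N -> N b -> N (- b) -> S c ->
  exists m : int, (- w) * (p' b)%:~R + lev * (d b)%:~R + (2 * p' b * p' c)%:~R = m%:~R /\
    forall t : nat, t%:Z <= m -> S (c - b *+ t).
Proof.
rewrite /= abszN => pb n1 n2 Sc; have [m [mE str]] := S2 pb n1 n2 Sc; exists m; split=> //.
by rewrite -mE !(mulrNz, mulrN, mulNr, opprK).
Qed.
Let goal_support_p : forall phi : {additive Q -> int}, phi de = 0 -> phi (- al) <> 0 ->
  forall c, S c -> (forall b, real22 p' d b -> 0 < phi b -> ~ S (c + b)) -> goal.
Proof.
move=> phi phi_de phi_al c Sc H; apply: goal_support phi_de _ _ Sc _.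
  by move=> E; apply: phi_al; rewrite raddfN E oppr0.
by move=> b Rb; apply: H; rewrite /real22 /= abszN.
Qed.

Let d'_al : d' al = 0. Proof. by rewrite /= d_al oppr0. Qed.
Let d'_de : d' (- de) = 1. Proof. by rewrite /= raddfN opprK. Qed.
Let p_de' : p (- de) = 0. Proof. by rewrite raddfN /= p_de oppr0. Qed.
Let span_d c : c = al *~ p c + (- de) *~ d' c.
Proof. by rewrite mulNrz -mulrNz opprK -span. Qed.
Let S1d b : real22 p d' b -> ~ N b -> St b.
Proof. by rewrite /real22 /= abszN; exact: S1. Qed.
Let S2d b c : absz (p b) = 1%N -> N b -> N (- b) -> S c ->
  exists m : int, w * (p b)%:~R + (- lev) * (d' b)%:~R + (2 * p b * p c)%:~R = m%:~R /\
    forall t : nat, t%:Z <= m -> S (c - b *+ t).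
Proof.
move=> pb n1 n2 Sc; have [m [mE str]] := S2 pb n1 n2 Sc; exists m; split=> //.
by rewrite -mE /= mulrNz mulrNN.
Qed.
Let goal_far_d : forall (phi : {additive Q -> int}) de', de' = - de \/ de' = - - de ->
  0 < phi de' -> (forall b, real22 p d' b -> 0 < phi b -> N b) ->
  (forall c q, exists M : nat, forall k : nat, (M <= k)%N -> ~ S (c + q + de' *+ k)) -> goal.
Proof.
move=> phi de'; rewrite opprK => deE phi0 phiN; apply: goal_far phi0 _; first by case: deE; auto.
by move=> b Rb; apply: phiN; rewrite /real22 /= abszN.
Qed.

Theorem goal_22 : goal.
Proof.
have rt_flip b k : rt (ba (- al)) de b k = rt (ba al) de (~~ b) k.
  by rewrite /rt /ba; case: b; rewrite ?opprK.
have rt_flip' b k : rt (ba al) (- de) b k = rt (ba al) de b (- k).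
  by rewrite /rt mulNrz mulrNz.
have [asym|nasym] := pselect (allsym22 al de N).
  have asym_d : allsym22 al (- de) N by move=> b k; rewrite rt_flip'; exact: asym.
  have asym_p : allsym22 (- al) de N by move=> b k; rewrite rt_flip; exact: asym.
  have p_rt k : p (rt (ba al) de true k) = 1 by rewrite /rt /ba raddfD raddfMz /= p_al p_de mul0rz addr0.
  have d_rt k : d (rt (ba al) de true k) = k by rewrite /rt /ba raddfD raddfMz /= d_al d_de add0r intz.
  have n2 k : N (- rt (ba al) de true k).
    by have := asym false (- k); rewrite /rt /ba mulrNz -opprD.
  have [c Sc] := Sex.
  have [|m [mE _]] := S2 _ (asym true 0) (n2 0) Sc; first by rewrite p_rt.
  have [|m' [mE' _]] := S2 _ (asym true 1) (n2 1) Sc; first by rewrite p_rt.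
  move: mE mE'; rewrite !p_rt !d_rt mulr0 addr0 !mulr1 => mE mE'.
  have levE : lev = (m' - m)%:~R by rewrite intrB -mE -mE'; ring.
  have wE : w = (m - 2 * p c)%:~R by rewrite intrB -mE addrK.
  move: (m' - m) levE => la levE.
  have [la0|la0|la0] := ltgtP la 0.
  - have levE' : - lev = (- la)%:~R by rewrite levE mulrNz.
    apply: (allsym22_pos p_al p_de' d'_al d'_de span_d S1d S2d Sn0 Sex goal_far_d asym_d levE').
    by rewrite oppr_gt0.
  - exact: (allsym22_pos p_al p_de d_al d_de span S1 S2 Sn0 Sex goal_far asym levE).
  have lev0 : lev = 0 by rewrite levE la0.
  move: (m - _) wE => om wE; have [om0|om0] := leP 0 om.
    exact: (allsym22_zero p_al p_de d_al d_de span S2 Sn0 Sex goal_support asym lev0 wE om0).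
  have wE' : - w = (- om)%:~R by rewrite wE mulrNz.
  apply: (allsym22_zero p'_al p'_de d_al' d_de span_p S2p Sn0 Sex goal_support_p asym_p lev0 wE').
  by rewrite oppr_ge0 ltW.
have [b1 [k1 Sk1]] : exists b k, St (rt (ba al) de b k).
  apply: contrapT => nS; apply: nasym => b k; apply: contrapT => nN; apply: nS; exists b, k.
  apply: S1 nN; rewrite /real22 /rt raddfD raddfMz /= p_de mul0rz addr0 /ba.
  by case: b; rewrite ?raddfN /= p_al.
have [ex|nex] := pselect (exists k, St (rt (ba al) de false k)); last first.
  apply: (one_sided22 p_al p_de d_al d_de span S1 S2 Sn0 Sex goal_support) (nex).
  by case: b1 Sk1 => Sk1; [exists k1 | case: nex; exists k1].
have [ex'|nex] := pselect (exists k, St (rt (ba al) de true k)); last first.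
  apply: (one_sided22 p'_al p'_de d_al' d_de span_p S1p S2p Sn0 Sex goal_support_p).
    by have [k Sk] := ex; exists k; rewrite rt_flip.
  by move=> [k]; rewrite rt_flip => Sk; apply: nex; exists k.
have op_ex b : exists k, St (rt (ba al) de b k) by case: b.
have [nn|] := pselect (forall k : int, St (de *~ k) -> 0 <= k).
  exact: (two_sided22 p_al p_de d_al d_de span S1 S2 Sn0 goal_far op_ex nn).
move=> /existsNP[k /not_implyP[Sk /negP]]; rewrite -ltNge => k0.
apply: (two_sided22 p_al p_de' d'_al d'_de span_d S1d S2d Sn0 goal_far_d).
  by move=> b; have [q Sq] := op_ex b; exists (- q); rewrite rt_flip' opprK.
move=> l; rewrite mulNrz -mulrNz => Sl; rewrite leNgt; apply/negP => l0.
apply: (null_mixed22 p_al p_de d_al d_de span S1 S2 Sn0 Sex op_ex (k := absz l) (l := absz k)).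
- by move: l0; lia.
- by move: k0; lia.
- by rewrite pmulrn (_ : (absz l)%:Z = - l) //; move: l0; lia.
- by rewrite pmulrn -mulrNz (_ : - (absz k)%:Z = k) //; move: k0; lia.
Qed.
End Main22.

(** * The root system of A_2^(2) *)

Section TypeA22.
Notation A := gcm_A2_2.
Notation Q := {ffun 'I_2 -> int}.
Notation i0 := (ord0 : 'I_2).
Notation i1 := (ord_max : 'I_2).

Lemma ord2P (i : 'I_2) : i = i0 \/ i = i1.
Proof. by case: i => -[|[|//]] lt; [left|right]; apply/val_inj. Qed.

Lemma ffun2P (c c' : Q) : c i0 = c' i0 -> c i1 = c' i1 -> c = c'.
Proof. by move=> E E'; apply/ffunP => i; case: (ord2P i) => ->. Qed.

Lemma A_diag22 i : A i i = 2.
Proof. by rewrite mxE eqxx. Qed.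

Lemma A_off22 i j : i != j -> A i j <= 0.
Proof. by move=> /negPf ij; rewrite mxE ij; case: ifP. Qed.

Lemma A_sym022 i j : A i j = 0 -> A j i = 0.
Proof. by rewrite !mxE eq_sym; case: eqP => //; case: ifP. Qed.

(** Coordinates in the basis [al i0], [de22], where delta is 2 alpha_0 + alpha_1: alpha_0 is short,
    and alpha_1, equal to delta - 2 alpha_0, is long. *)
Definition p22 (c : Q) : int := c i0 - 2 * c i1.
Definition d22 (c : Q) : int := c i1.
Definition de22 : Q := [ffun i => if i == i0 then 2 else 1].

Lemma p22_is_additive : zmod_morphism p22.
Proof. by move=> c c'; rewrite /p22 !ffunE; ring. Qed.
HB.instance Definition _ := GRing.isZmodMorphism.Build Q int p22 p22_is_additive.
Lemma d22_is_additive : zmod_morphism d22.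
Proof. by move=> c c'; rewrite /d22 !ffunE. Qed.
HB.instance Definition _ := GRing.isZmodMorphism.Build Q int d22 d22_is_additive.

Lemma p22_al0 : p22 (al i0) = 1. Proof. by rewrite /p22 !ffunE. Qed.
Lemma d22_al0 : d22 (al i0) = 0. Proof. by rewrite /d22 !ffunE. Qed.
Lemma p22_al1 : p22 (al i1) = -2. Proof. by rewrite /p22 !ffunE. Qed.
Lemma d22_al1 : d22 (al i1) = 1. Proof. by rewrite /d22 !ffunE. Qed.
Lemma p22_de : p22 de22 = 0. Proof. by rewrite /p22 !ffunE. Qed.
Lemma d22_de : d22 de22 = 1. Proof. by rewrite /d22 !ffunE. Qed.

Lemma span22 c : c = al i0 *~ p22 c + de22 *~ d22 c.
Proof. by apply: ffun2P; rewrite ffunE !ffunMzE !ffunE !mulrzz /p22 /d22 /=; ring. Qed.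

Lemma spair22 c : spair A i0 c = 2 * p22 c /\ spair A i1 c = - p22 c.
Proof.
rewrite /spair /p22 !big_ord_recl !big_ord0 !mxE /=.
by rewrite (_ : lift ord0 ord0 = i1) ?eqxx; [split; ring | exact/val_inj].
Qed.

Lemma spair_de22 i : spair A i de22 = 0.
Proof.
by have [E0 E1] := spair22 de22; case: (ord2P i) => ->; rewrite ?E0 ?E1 p22_de ?mulr0 ?oppr0.
Qed.

Notation R22 := (real22 p22 d22).
Let X22 c := (p22 c == 0) || R22 c.

Lemma descent22 c : pos c -> (exists k, c = de22 *~ k) \/ exists i, 0 < spair A i c.
Proof.
move=> _; have [E0 E1] := spair22 c; case: (ltgtP (p22 c) 0) => pc.
- by right; exists i1; rewrite E1; lia.
- by right; exists i0; rewrite E0; lia.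
- by left; exists (d22 c); rewrite {1}[c]span22 pc mulr0z add0r.
Qed.

Lemma coherent22 c : X22 c -> c <> 0 -> pos c \/ pos (- c).
Proof.
move=> Xc cn; have cE : c i0 = p22 c + 2 * d22 c by rewrite /p22 /d22; ring.
have [h|h] := pselect (0 <= c i0 /\ 0 <= c i1).
  by left; split=> // i; case: (ord2P i) => ->; case: h.
right; split; last by move/eqP; rewrite oppr_eq0 => /eqP.
move=> i; rewrite ffunE oppr_ge0.
have : c i0 <= 0 /\ c i1 <= 0.
  move: Xc h; rewrite /X22 /real22 cE -/(d22 c); move: (p22 c) (d22 c) => x y.
  by move=> Xc h; lia.
by case: (ord2P i) => -> [].
Qed.

Lemma p22_refl i c : p22 (refl A i c) = - p22 c.
Proof.
have [E0 E1] := spair22 c; rewrite /refl raddfB raddfMz /= mulrzz.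
by case: (ord2P i) => ->; rewrite ?E0 ?E1 ?p22_al0 ?p22_al1; ring.
Qed.

Lemma real22_refl i c : R22 (refl A i c) = R22 c.
Proof.
rewrite /real22 p22_refl abszN; congr (_ || _); case: eqP => //= pc.
have [E0 E1] := spair22 c; rewrite /refl raddfB raddfMz /= mulrzz.
by case: (ord2P i) => ->; rewrite ?E0 ?E1 ?d22_al0 ?d22_al1; lia.
Qed.

Lemma X22_simple i m : X22 (al i *+ m) -> (m <= 1)%N.
Proof.
rewrite /X22 /real22 !raddfMn /=; case: (ord2P i) => ->; rewrite ?p22_al0 ?p22_al1 ?d22_al0 ?d22_al1.
all: rewrite !pmulrn !mulrzz; lia.
Qed.

Section Roots22.
Variables (K : numFieldType) (g : kac_moody_algebra K A).

Lemma real22_exists c : R22 c -> exists h, real g c h.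
Proof.
move=> Rc; have pn : p22 c <> 0 by case/orP: Rc => [/eqP|/andP[/eqP]]; lia.
have [||||[k cE]|//] := @real_descent _ _ _ g A_diag22 de22 X22 spair_de22 descent22 coherent22 _ _ X22_simple c.
- by move=> i b; rewrite /X22 p22_refl oppr_eq0 real22_refl.
- by move=> b; rewrite /X22 /real22 !raddfN /= oppr_eq0 !abszN.
- by rewrite /X22 Rc orbT.
- by move=> c0; apply: pn; rewrite c0 raddf0.
- by case: pn; rewrite cE raddfMz /= p22_de mul0rz.
Qed.

Lemma real_R22 c h : real g c h -> R22 c.
Proof.
elim=> {c h} [i|i c h _]; last by rewrite real22_refl.
by rewrite /real22; case: (ord2P i) => ->; rewrite ?p22_al0 ?p22_al1 ?d22_al0 ?d22_al1.
Qed.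

Lemma isroot22 c : isroot g c -> R22 c \/ exists2 k, k != 0 & c = de22 *~ k.
Proof.
move=> rc; case: (isroot_kind A_diag22 A_off22 A_sym022 spair_de22 descent22 rc) => [[k cE]|[h /real_R22]].
  right; exists k => //; apply/eqP => k0; case: rc => cn _; apply: cn.
  by rewrite cE k0 mulr0z.
by left.
Qed.

Lemma isroot_real22 c : R22 c -> isroot g c.
Proof. by move=> /real22_exists[h]; exact: (real_isroot A_diag22 A_off22 A_sym022). Qed.

Lemma isroot_imag22 k : k != 0 -> isroot g (de22 *~ k).
Proof.
move=> kn.
have R0 : R22 (al i0) by rewrite /real22 p22_al0.
have Rk : R22 (al i0 + de22 *~ k).
  by rewrite /real22 raddfD raddfMz /= p22_al0 p22_de mul0rz addr0.
have [h R] := real22_exists R0; have [h' R'] := real22_exists Rk.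
apply: (imaginary_isroot A_diag22 A_off22 A_sym022 spair_de22 kn _ R R').
by move=> /(congr1 d22); rewrite d22_de raddf0.
Qed.

Lemma isroot_opp22 c : isroot g c -> isroot g (- c).
Proof.
case/isroot22=> [Rc|[k kn ->]].
  by apply: isroot_real22; move: Rc; rewrite /real22 !raddfN /= !abszN.
by rewrite -mulrNz; apply: isroot_imag22; rewrite oppr_eq0.
Qed.

(** The coroot itself is not additive in the root, but its multiple by the squared length is; hence
    the factor 4 at the long simple root. *)
Definition cor22 (c : Q) : cartan g :=
  simple_coroot g i0 *~ c i0 + simple_coroot g i1 *~ (4 * c i1).

Lemma cor22_is_additive : zmod_morphism cor22.
Proof. by move=> c d; rewrite /cor22 !ffunE mulrBr !mulrzBr opprD addrACA. Qed.
HB.instance Definition _ := GRing.isZmodMorphism.Build Q (cartan g) cor22 cor22_is_additive.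

Lemma pair_cor22 b c : pair g c (cor22 b) = (2 * p22 b * p22 c)%:~R.
Proof.
have [E0 E1] := spair22 c.
have pairMzr h m : pair g c (h *~ m) = pair g c h * m%:~R.
  by rewrite /pair raddfMz /= mulrzr.
rewrite /cor22 pairDr !pairMzr !pair_hi E0 E1 -!intrM -intrD; congr (_%:~R).
by rewrite /p22; ring.
Qed.

(* [p22 c ^+ 2] is the squared length of the root c, normalized to 1 on short roots. *)
Lemma real_cor22 c h : real g c h -> h *~ (p22 c * p22 c) = cor22 c.
Proof.
elim=> {c h} [i|i c h _ IH].
  case: (ord2P i) => ->; rewrite ?p22_al0 ?p22_al1 /cor22 !ffunE /=.
    by rewrite mulr0 mulr0z addr0.
  by rewrite mulr0z add0r.
rewrite p22_refl mulrNN /reflc /refl raddfB raddfMz /= mulrzBl IH; congr (_ - _).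
have [E0 E1] := spair22 c.
have pE : pair g (al i) h * (p22 c * p22 c)%:~R = (2 * p22 c * p22 (al i))%:~R.
  by rewrite -pair_cor22 -IH /pair raddfMz /= mulrzr.
rewrite -scaler_int scalerA mulrC pE.
case: (ord2P i) => ->; rewrite ?E0 ?E1 ?p22_al0 ?p22_al1 /cor22 !ffunE /=.
  by rewrite mulr0 mulr0z addr0 scaler_int mulr1 -mulrzA mul1r.
by rewrite mulr0z add0r scaler_int -mulrzA; congr (_ *~ _); ring.
Qed.

Variable V : lieModType g.

Theorem primitive_22 : weight_module V -> lie_irreducible V -> non_dense V -> has_primitive V.
Proof.
move=> wV irrV /(missing_weight wV irrV)[mu [Sn0 Sex]].
apply: (@goal_22 K _ (al i0) de22 p22 d22 p22_al0 p22_de d22_al0 d22_de span22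
  (insupp V mu) (@nilroot _ _ _ _ V) (mu (cor22 (al i0))) (mu (cor22 de22))).
- move=> b /real22_exists[h R] nN c Sc.
  exact: (insupp_inj A_diag22 A_off22 A_sym022 irrV R nN Sc).
- move=> b c pb n1 n2 Sc.
  have [|h R] := @real22_exists b; first by rewrite /real22 pb.
  have hE : h = cor22 b; first move: pb => /= pb.
    have : p22 b = 1 \/ p22 b = -1 by lia.
    by rewrite -(real_cor22 R) => -[] ->.
  have [m [mE str]] := insupp_string A_diag22 A_off22 A_sym022 R n1 n2 Sc.
  exists m; split=> //; rewrite -mE /wval hE pair_cor22; congr (_ + _).
  have -> : cor22 b = cor22 (al i0) *~ p22 b + cor22 de22 *~ d22 b.
    by rewrite -!(raddfMz cor22) -(raddfD cor22) -span22.
  rewrite [RHS]raddfD 2![in RHS]raddfMz /=; congr (_ + _); exact: mulrzr.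
- exact: Sn0.
- exact: Sex.
- move=> phi phi_de phi_al c Sc H.
  apply: (primitive_support isroot_opp22 (phi := phi) _ Sc).
    by exists (al i0) => //; apply: isroot_real22; rewrite /real22 p22_al0.
  move=> b /isroot22[|[k _ ->]]; first exact: H.
  by rewrite raddfMz phi_de mul0rz.
- move=> phi de' de'E phi_de H far.
  have multE k : exists k', de22 *~ k = de' *~ k'.
    by case: de'E => ->; [exists k | exists (- k); rewrite mulNrNz].
  pose reps : seq Q := [seq al i0 *~ k | k <- [:: 0; 1; -1; 2; -2]].
  apply: (primitive_far A_diag22 A_off22 A_sym022 isroot_opp22 (reps := reps) phi_de) => //.
  + move=> c rc; have [k kE] := multE (d22 c); exists (al i0 *~ p22 c).
      apply: map_f; rewrite !inE; case: (isroot22 rc) => [|[k' _ ->]].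
        by rewrite /real22; move: (p22 c) (d22 c) => x y; lia.
      by rewrite raddfMz /= p22_de mul0rz.
    by exists k; rewrite -kE -span22.
  + move=> c /isroot22[/real22_exists|[k _ ->]]; first by left.
    by right; exact: multE.
  + by move=> b h /real_R22; exact: H.
  + exists de22; split; first exact: (isroot_imag22 (k := 1)).
    by case: de'E phi_de => ->; rewrite ?raddfN => lt E; rewrite E in lt.
Qed.
End Roots22.
End TypeA22.

Local Open Scope classical_set_scope.

Theorem theorem16 (R : realType) (X : affine_type)
    (g : kac_moody_algebra R[i] (affine_gcm X)) (V : lieModType g) :
  weight_module V -> lie_irreducible V -> non_dense V ->
  exists (P : set 'Hom(cartan g, R[i]^o)) (v : V),
    [/\ parabolic_system P, v <> 0
      & forall x, parabolic_nil P x -> act x v = 0].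
Proof.
case: X g V => g V wV irrV nd.
- exact: (@primitive_A 1 _ isT g V wV irrV nd).
- exact: (@primitive_22 _ g V wV irrV nd).
- exact: (@primitive_A 2 _ isT g V wV irrV nd).
- exact: (@primitive_A 3 _ isT g V wV irrV nd).
- exact: (@primitive_A 4 _ isT g V wV irrV nd).
Qed.
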